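(* Let $D$ be a positive integer and $(X,\mathbb{Z}^k,T)$ a dynamical system with the marker property. If $\mathrm{mdim}(X)<D/2^{k+1}$, then for a dense $G_\delta$ subset of $f\in C(X,[0,1]^{2D})$ the map $I_f:X\to([0,1]^{2D})^{\mathbb{Z}^k}$, $x\mapsto(f(T^nx))_{n\in\mathbb{Z}^k}$, is a topological embedding.
   Context: $C(X,[0,1]^{2D})$ carries the uniform topology. Marker property: for every finite $F\subset\mathbb{Z}^k$ there is an open $U$ with $X=\bigcup_nT^nU$ and $U\cap T^nU=\emptyset$ for nonzero $n\in F$. Mean dimension: with $[N]=\{0,\dots,N-1\}^k$, $d_\Omega(x,y)=\sup_{n\in\Omega}d(T^nx,T^ny)$, $\mathrm{widim}_\varepsilon(X,d)$ the minimal dimension of a finite simplicial complex admitting a continuous map with fibers of $d$-diameter $<\varepsilon$, $\mathrm{mdim}(X)=\lim_{\varepsilon\to0}\lim_NN^{-k}\mathrm{widim}_\varepsilon(X,d_{[N]})$. *)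

(* Defs.v *)
From HB Require Import structures.
From mathcomp Require Import all_boot all_order all_algebra.
From mathcomp Require Import all_classical all_reals all_analysis.
Set Implicit Arguments. Unset Strict Implicit. Unset Printing Implicit Defensive.
Import Order.TTheory GRing.Theory Num.Theory.
Import numFieldNormedType.Exports.
Local Open Scope classical_set_scope.
Local Open Scope ring_scope.

Section Defs.
Variable R : realType.

Definition is_metric {X : Type} (d : X -> X -> R) :=
  [/\ forall x y, 0 <= d x y,
      forall x y, d x y = 0 <-> x = y,
      forall x y, d x y = d y x &
      forall x y z, d x z <= d x y + d y z].

Definition compatible_metric {X : topologicalType} (d : X -> X -> R) :=
  is_metric d /\
  forall A : set X, open A <->
    (forall x, A x -> exists2 e : R, 0 < e & [set y | d x y < e] `<=` A).

Definition Zk_action {X : topologicalType} (k : nat) (T : 'rV[int]_k -> X -> X) :=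
  [/\ forall x, T 0 x = x,
      forall m n x, T (m + n) x = T m (T n x) &
      forall n, continuous (T n)].

Definition marker_property {X : topologicalType} (k : nat)
    (T : 'rV[int]_k -> X -> X) :=
  forall F : seq 'rV[int]_k,
    exists U : set X, open U /\
      (\bigcup_(n in [set: 'rV[int]_k]) (T n @` U)) = [set: X] /\
      (forall n, n \in F -> n != 0 -> U `&` (T n @` U) = set0).

Definition simplicial_complex (v : nat) (S : {set {set 'I_v}}) :=
  (forall s, s \in S -> (0 < #|s|)%N) /\
  (forall (s t : {set 'I_v}), s \in S -> t \subset s -> (0 < #|t|)%N -> t \in S).

(* its geometric realization in R^v (barycentric coordinates) *)
Definition realization (v : nat) (S : {set {set 'I_v}}) : set ('I_v -> R) :=
  [set p | (forall i, 0 <= p i) /\ \sum_(i < v) p i = 1 /\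
           finset (fun i => p i != 0) \in S].

Definition sc_dim (v : nat) (S : {set {set 'I_v}}) : nat :=
  (\max_(s in S) #|s|).-1.

Definition diam_lt {X : Type} (d : X -> X -> R) (A : set X) (eps : R) :=
  (ereal_sup [set (d x y)%:E | x in A & y in A] < eps%:E)%E.

Definition widim_admissible {X : topologicalType} (d : X -> X -> R)
    (eps : R) (n : nat) :=
  exists (v : nat) (S : {set {set 'I_v}}) (pi : X -> 'I_v -> R),
    [/\ simplicial_complex S, sc_dim S = n,
        forall i, continuous (fun x => pi x i),
        forall x, realization S (pi x) &
        forall p, diam_lt d [set x | pi x = p] eps].

Definition widim {X : topologicalType} (d : X -> X -> R) (eps : R) : \bar R :=
  ereal_inf [set (n%:R)%:E | n in widim_admissible d eps].

Definition box_vec (k N : nat) (n : {ffun 'I_k -> 'I_N}) : 'rV[int]_k :=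
  \row_j ((n j : nat)%:Z).

Definition dN {X : Type} (k : nat) (T : 'rV[int]_k -> X -> X)
    (d : X -> X -> R) (N : nat) (x y : X) : R :=
  \big[Num.max/0]_(n : {ffun 'I_k -> 'I_N}) d (T (box_vec n) x) (T (box_vec n) y).

(* mdim = lim_{eps -> 0} lim_N N^{-k} widim_eps(X, d_[N]) *)
Definition mdim {X : topologicalType} (k : nat) (T : 'rV[int]_k -> X -> X)
    (d : X -> X -> R) : \bar R :=
  ereal_sup [set limn_esup (fun N : nat =>
                   (((N%:R : R) ^+ k)^-1)%:E * widim (dN T d N) eps)%E
            | eps in [set e : R | 0 < e]].

Definition Cunit {X : topologicalType} (m : nat) : set {uniform X -> 'rV[R]_m} :=
  [set f | continuous (f : X -> 'rV[R]_m) /\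
           forall x (i : 'I_m), 0 <= f x 0 i <= 1].

Definition dense_Gdelta_in {Y : topologicalType} (C S : set Y) :=
  S `<=` C /\ C `<=` closure S /\
  exists W : nat -> set Y, (forall n, open (W n)) /\
    S = C `&` \bigcap_(n in [set: nat]) W n.

Definition orbit_map {X : topologicalType} (k m : nat)
    (T : 'rV[int]_k -> X -> X) (f : X -> 'rV[R]_m)
    : X -> {ptws 'rV[int]_k -> 'rV[R]_m} :=
  fun x => (fun n => f (T n x)).

Definition top_embedding {X Y : topologicalType} (g : X -> Y) :=
  [/\ continuous g, injective g &
      forall U : set X, open U ->
        exists2 V : set Y, open V & g @` U = V `&` range g].

End Defs.

(* Main.v *)
(* Baire category reduces the theorem to one perturbation statement: every
   continuous f : X -> [0,1]^(2D) is uniformly close to some g such that equal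
   g-orbits force d x y < eps.

   Tilings.  A marker function a : X -> [0, B] turns the orbit of x into a
   Laguerre diagram of Z^k, the site n having weight a (T^n x).  A homothety of
   ratio c = 1 - 1/q about n maps the cell of n for the weights a into the deep
   interior of its cell for the weights c a.  Hence the points deep inside the
   cells for c a have density close to 1, and the whole cell of a site for a can
   be encoded deep inside its cell for c a.

   Coding.  For a cube [N] with widim(X, d_[N]) < D N^k / 2^(k+1), a partition of
   unity of small mesh and order replaces X by sparse coordinate vectors, and g is
   defined inside the tiles as a generic linear function of these vectors.

   First D coordinates: every N-cube of a small-scale tiling carries its own
   coordinates together with the (at most one) value of the marker function of a
   much sparser large-scale marker seen from it.  If the orbits of x and y under g
   agree, a deep point common to both tilings gives two cubes overlapping in a
   proportion 2^-k; a nonzero offset is excluded by genericity, and a zero offset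
   shows that x and y have the same large-scale markers.

   Last D coordinates: now the large-scale tilings of x and y coincide, so the
   tile of the site whose cell contains 0 can be decoded. *)
Require Import Defs.
From HB Require Import structures.
From mathcomp Require Import all_boot all_order all_algebra.
From mathcomp Require Import all_classical all_reals all_analysis.
From mathcomp Require Import zify ring lra.
Set Implicit Arguments. Unset Strict Implicit. Unset Printing Implicit Defensive.
Import Order.TTheory GRing.Theory Num.Theory.
Import numFieldNormedType.Exports.
Local Open Scope classical_set_scope.
Local Open Scope ring_scope.

(** * General position with repeated variables *)

Section GeneralPosition.
Variable R : realFieldType.

(** The constant [2 ^ k.+1] is consumed by the first [D] coordinates: a factor 2 because the
    coordinates of both points are unknown, and [2 ^ k] because nothing aligns the cubes read from
    [x] with those read from [y]. This misalignment is the main obstacle: one variable of the code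
    then occurs twice in the same linear system, so general position is needed for systems with
    repeated variables. The last [D] coordinates need only about four times the multiplicity of the
    partition of unity, 2 for the two points and 2 for a local and a hidden copy, and
    [4 <= 2 ^ k.+1] once [k] is positive; for [k = 0] a direct argument of Menger-Nobeling type is
    used. Laguerre cells are preferred to Voronoi cells because markers appear and disappear as the
    point moves: a marker whose weight rises loses its cell gradually, and all cutoffs stay
    continuous. Two scales are needed because reading a tile requires knowing its site: the small
    tiles carry just enough to locate the markers of the large ones. *)

Lemma exists_small_nonroot (p : {poly R}) (eps : R) : 0 < eps -> p != 0 ->
  exists2 t, 0 < t <= eps & p.[t] != 0.
Proof.
move=> e0 p0.
(* A nonzero polynomial has fewer than [size p] roots, so one of [size p] distinct candidates is not
   a root. *)
pose s := [seq eps / i.+1%:R | i <- iota 0 (size p)].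
have us : uniq s.
  rewrite map_inj_uniq ?iota_uniq// => i j.
  move/(mulfI (lt0r_neq0 e0))/invr_inj/eqP; rewrite eqr_nat => /eqP[].
  by [].
have : ~~ all (root p) s.
  apply/negP => /(max_poly_roots p0) /(_ us).
  by rewrite size_map size_iota ltnn.
case/allPn => t /mapP[i _ ->] nr; exists (eps / i.+1%:R) => //.
rewrite divr_gt0 ?ltr0n//= ler_pdivrMr ?ltr0n// ler_peMr ?ler1n ?(ltW e0)//.
Qed.

Definition pencil n (A B : 'M[R]_n) : {poly R} :=
  \det (map_mx polyC A + 'X *: map_mx polyC B).

Lemma horner_pencil n (A B : 'M[R]_n) t : (pencil A B).[t] = \det (A + t *: B).
Proof.
rewrite /pencil -horner_evalE -det_map_mx; congr (\det _).
by apply/matrixP => i j; rewrite !mxE /= horner_evalE hornerE /= !hornerE mulrC.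
Qed.

Lemma pencil_neq0l n (A B : 'M[R]_n) : \det A != 0 -> pencil A B != 0.
Proof.
move=> dA; apply/eqP => /(congr1 (horner^~ 0)).
by rewrite horner_pencil scale0r addr0 horner0; apply/eqP.
Qed.

(** Reversal of the pencil: [A + t^-1 *: B] is [t^-1 *: (B + t *: A)], so a nonroot of the exchanged
    pencil gives one here. *)
Lemma pencil_neq0r n (A B : 'M[R]_n) : \det B != 0 -> pencil A B != 0.
Proof.
move=> dB; have [t /andP[t0 _]] := exists_small_nonroot ltr01 (pencil_neq0l A dB).
rewrite horner_pencil => nz; apply/eqP => /(congr1 (horner^~ t^-1)).
rewrite horner_pencil horner0 => /eqP; apply/negP.
have -> : A + t^-1 *: B = t^-1 *: (B + t *: A).
  by rewrite scalerDr scalerA mulVf ?gt_eqF// scale1r addrC.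
by rewrite detZ mulf_neq0// expf_neq0// invr_eq0 gt_eqF.
Qed.

Lemma mem_In (T : eqType) (a : T) (s : seq T) : a \in s -> List.In a s.
Proof.
by elim: s => //= b s IH; rewrite in_cons => /orP[/eqP->|/IH]; [left|right].
Qed.

Section Patterns.
Variables (Var Row Col : eqType).
Implicit Types (phi : Row -> Col -> option Var) (x : Var -> R).
Implicit Types l : seq (Row * Col).

Definition pval x (o : option Var) : R := if o is Some w then x w else 0.

(* The head of the list is the pivot added last: its variable occurs nowhere
   else in the square subsystem spanned by the list. *)
Fixpoint fresh phi l : Prop :=
  if l is (r, c) :: l' then
    [/\ fresh phi l', r \notin unzip1 l', c \notin unzip2 l' &
      exists2 w, phi r c = Some w &
        forall r' c', r' \in r :: unzip1 l' -> c' \in c :: unzip2 l' ->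
          phi r' c' = Some w -> r' = r /\ c' = c]
  else True.

Definition pmat phi x l : 'M[R]_(size l) :=
  \matrix_(i, j) pval x (phi (tnth (in_tuple l) i).1 (tnth (in_tuple l) j).2).

Lemma fresh_uniq2 phi l : fresh phi l -> uniq (unzip2 l).
Proof. by elim: l => [|[r c] l IH] //= [/IH-> _ ->]. Qed.

Lemma tnth_cons (T : Type) (a : T) (s : seq T) (i : 'I_(size s)) :
  tnth (in_tuple (a :: s)) (lift ord0 i) = tnth (in_tuple s) i.
Proof. by rewrite !(tnth_nth a) /=. Qed.

Lemma pmat_cons_minor phi x a l :
  row' ord0 (col' ord0 (pmat phi x (a :: l))) = pmat phi x l.
Proof. by apply/matrixP => i j; rewrite !mxE !tnth_cons. Qed.

(** Expanded along the pivot row, the determinant is affine in the pivot variable, and its slope is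
    the determinant of the remaining pivots. Hence 0 or 1 is a good value for this variable. *)
Lemma fresh_nonsingular phi l : fresh phi l ->
  exists2 h : Var -> R, (forall w, 0 <= h w <= 1) & \det (pmat phi h l) != 0.
Proof.
elim: l => [|[r c] l IH] /=.
  by move=> _; exists (fun _ => 0) => [w|]; rewrite ?lexx ?ler01// det_mx00 oner_neq0.
case=> /IH[h h01 dh] rl cl [w rcw wfresh].
pose h' (t : R) v := if v == w then t else h v.
have h'E (t : R) (i j : 'I_(size l).+1) : (i, j) != (ord0, ord0) ->
    pmat phi (h' t) ((r, c) :: l) i j = pmat phi h ((r, c) :: l) i j.
  move=> ij; rewrite !mxE.
  set r' := (tnth _ i).1; set c' := (tnth _ j).2.
  case E: (phi r' c') => [v|] //=; rewrite /h'; case: eqP => // vw.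
  have r'in : r' \in r :: unzip1 l.
    by rewrite -[_ :: _]/(unzip1 ((r, c) :: l)) map_f// mem_tnth.
  have c'in : c' \in c :: unzip2 l.
    by rewrite -[_ :: _]/(unzip2 ((r, c) :: l)) map_f// mem_tnth.
  move: E; rewrite vw => /(wfresh _ _ r'in c'in)[r'r c'c].
  move: ij; rewrite xpair_eqE negb_and => /orP[|] ne.
    move: ne r'r rl; case: (unliftP ord0 i) => [i' ii|-> /eqP//] _.
    rewrite /r' ii tnth_cons => <-.
    by rewrite map_f// mem_tnth.
  move: ne c'c cl; case: (unliftP ord0 j) => [i' ii|-> /eqP//] _.
  rewrite /c' ii tnth_cons => <-.
  by rewrite map_f// mem_tnth.
have cofE (t : R) j : cofactor (pmat phi (h' t) ((r, c) :: l)) ord0 j =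
    cofactor (pmat phi h ((r, c) :: l)) ord0 j.
  rewrite /cofactor; congr (_ * \det _).
  by apply/matrixP => i i'; rewrite mxE [in RHS]mxE [LHS]mxE [RHS]mxE h'E.
have detE (t : R) : \det (pmat phi (h' t) ((r, c) :: l)) =
    t * \det (pmat phi h l) +
    \sum_(j < size l) pmat phi h ((r, c) :: l) ord0 (lift ord0 j) *
       cofactor (pmat phi h ((r, c) :: l)) ord0 (lift ord0 j).
  rewrite (expand_det_row _ ord0) big_ord_recl cofE; congr (_ * _ + _).
  - by rewrite mxE /= rcw /= /h' eqxx.
  - by rewrite /cofactor pmat_cons_minor expr0 mul1r.
  - by apply: eq_bigr => j _; rewrite cofE h'E.
have h'01 t : 0 <= t <= 1 -> forall v, 0 <= h' t v <= 1.
  by move=> t01 v; rewrite /h'; case: eqP.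
have [d0|] := eqVneq (\det (pmat phi (h' 0) ((r, c) :: l))) 0; last first.
  by move=> d0; exists (h' 0) => //; apply: h'01; rewrite lexx ler01.
exists (h' 1); first by apply: h'01; rewrite lexx ler01.
move: d0; rewrite !detE mul0r add0r => ->.
by rewrite mul1r addr0.
Qed.

Lemma pmatD phi x y (t : R) l :
  pmat phi (fun w => x w + t * y w) l = pmat phi x l + t *: pmat phi y l.
Proof.
apply/matrixP => i j; rewrite !mxE; case: (phi _ _) => [v|] //=.
by rewrite mulr0 addr0.
Qed.

(** Independence of the columns on the listed rows, stated for unknowns indexed by [Col] so that
    applications never form a matrix. *)
Definition nonsing phi x l : Prop :=
  forall xi : Col -> R,
    (forall r, r \in unzip1 l -> \sum_(c <- unzip2 l) xi c * pval x (phi r c) = 0) ->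
  forall c, c \in unzip2 l -> xi c = 0.

Lemma det_nonsing phi x l : \det (pmat phi x l) != 0 -> nonsing phi x l.
Proof.
move=> dn xi eqn c /mapP[[r c'] rcl ->] {c} /=.
have um : pmat phi x l \in unitmx by rewrite unitmxE unitfE.
pose v : 'cV[R]_(size l) := \col_i xi (tnth (in_tuple l) i).2.
have : pmat phi x l *m v = 0.
  apply/matrixP => i j; rewrite !mxE.
  have := eqn (tnth (in_tuple l) i).1 (map_f _ (mem_tnth i (in_tuple l))).
  rewrite big_map big_tnth => {}eqn; rewrite -[RHS]eqn.
  by apply: eq_bigr => i' _; rewrite !mxE mulrC.
move/(congr1 (mulmx (invmx (pmat phi x l)))); rewrite mulKmx// mulmx0 => v0.
have /tnthP[i] : (r, c') \in in_tuple l by [].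
move/matrixP: v0 => /(_ i ord0); rewrite !mxE => + E; rewrite -E //=.
Qed.

(** Makes the collection of candidate pivot lists finite, so that one perturbation serves them
    all. *)
Fixpoint seqs_upto n (s : seq (Row * Col)) : seq (seq (Row * Col)) :=
  if n is n'.+1 then [::] :: [seq a :: l | a <- s, l <- seqs_upto n' s]
  else [:: [::]].

Lemma mem_seqs_upto n s l : (size l <= n)%N -> {subset l <= s} -> l \in seqs_upto n s.
Proof.
elim: n l => [|n IH] [|a l] //= ln ls; rewrite in_cons /=.
apply: allpairs_f; first by rewrite ls// mem_head.
by apply: IH => // y yl; rewrite ls// in_cons yl orbT.
Qed.

(** Along a line [x + t * h] each determinant is a polynomial in [t]. Those already treated are
    nonzero at [t = 0], the new one has the nonzero top coefficient given by [h], and a small [t]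
    avoids the roots of the product. *)
Lemma perturb_family (fam : seq ((Row -> Col -> option Var) * seq (Row * Col)))
   (x0 : Var -> R) (eps : R) : 0 < eps ->
  exists2 x : Var -> R, (forall w, `|x w - x0 w| <= eps) &
    forall a, List.In a fam -> fresh a.1 a.2 -> \det (pmat a.1 x a.2) != 0.
Proof.
elim: fam eps => [|a fam IH] eps e0.
  by exists x0 => // w; rewrite subrr normr0 ltW.
have e20 : 0 < eps / 2 by rewrite divr_gt0.
have [x xx0 xfam] := IH _ e20.
have [Pa|nPa] := pselect (fresh a.1 a.2); last first.
  exists x => [w|b [<-//|/xfam//]].
  by rewrite (le_trans (xx0 w))// ler_pdivrMr// ler_peMr// ?ler1n// ltW.
have [h h01 dh] := fresh_nonsingular Pa.
(* The value 1 for systems that are not fresh keeps the product nonzero. *)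
pose Q (b : (Row -> Col -> option Var) * seq (Row * Col)) :=
  if `[< fresh b.1 b.2 >] then pencil (pmat b.1 x b.2) (pmat b.1 h b.2) else 1.
have prod0 : forall s, (forall b, List.In b s -> Q b != 0) ->
   \prod_(b <- s) Q b != 0.
  elim=> [|b s IHs] Hs; first by rewrite big_nil oner_neq0.
  rewrite big_cons mulf_neq0 ?Hs//; first by left.
  by apply: IHs => c cs; apply: Hs; right.
have Q0 : \prod_(b <- a :: fam) Q b != 0.
  apply: prod0 => b [<-|bf]; rewrite /Q; case: asboolP => [Pb|_].
  - exact: pencil_neq0r.
  - exact: oner_neq0.
  - exact: pencil_neq0l (xfam _ bf Pb).
  - exact: oner_neq0.
have [t /andP[t0 te] tn] := exists_small_nonroot e20 Q0.
exists (fun w => x w + t * h w) => [w|b bf Pb].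
  rewrite addrAC (le_trans (ler_normD _ _))//.
  rewrite [leRHS](splitr eps) lerD//.
  have /andP[hw0 hw1] := h01 w.
  by rewrite ger0_norm ?mulr_ge0// ?(ltW t0)// (le_trans _ te)// ler_piMr// ltW.
rewrite pmatD -horner_pencil.
have : forall s, List.In b s -> (\prod_(b <- s) Q b).[t] != 0 -> (Q b).[t] != 0.
  elim=> [|c s IHs] //= [->|bs]; rewrite big_cons hornerM mulf_eq0 negb_or => /andP[]//.
  by move=> _; exact: IHs.
by move=> /(_ _ bf tn); rewrite /Q asboolT.
Qed.

(** The perturbation is fixed before the pivots, which will depend on the two points compared. The
    index [k] allows several patterns at once, such as one for each offset between two cubes. *)
Lemma general_position (K : Type) (phi : K -> Row -> Col -> option Var)
    (Ks : seq K) (rows : seq Row) (cols : seq Col) (x0 : Var -> R) (eps : R) :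
  0 < eps ->
  exists2 x : Var -> R, (forall w, `|x w - x0 w| <= eps) &
    forall k l, List.In k Ks -> fresh (phi k) l ->
      {subset unzip1 l <= rows} -> {subset unzip2 l <= cols} ->
      nonsing (phi k) x l.
Proof.
move=> e0.
pose L := seqs_upto (size cols) [seq (r, c) | r <- rows, c <- cols].
pose fam := List.flat_map (fun k => List.map (fun l => (phi k, l)) L) Ks.
have [x xx0 xfam] := perturb_family fam x0 e0; exists x => // k l kK fr lr lc.
apply/det_nonsing/(xfam (phi k, l)) => //.
apply/List.in_flat_map; exists k; split=> //; apply/List.in_map_iff; exists l.
split=> //; apply: mem_In.
apply: mem_seqs_upto.
  by rewrite -(size_map snd) uniq_leq_size// (fresh_uniq2 fr).
move=> [r c] rcl; apply: allpairs_f.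
  by apply: lr; rewrite (map_f fst rcl).
by apply: lc; rewrite (map_f snd rcl).
Qed.
End Patterns.
End GeneralPosition.

(** If no variable is repeated on the listed columns, every transversal of occupied entries is
    fresh, in any order. *)
Lemma fresh_distinct (Var Row Col : eqType) (phi : Row -> Col -> option Var)
    (l : seq (Row * Col)) :
  uniq (unzip1 l) -> uniq (unzip2 l) ->
  (forall r c, (r, c) \in l -> exists w, phi r c = Some w) ->
  (forall r c r' c' w, c \in unzip2 l -> c' \in unzip2 l ->
    phi r c = Some w -> phi r' c' = Some w -> r = r' /\ c = c') ->
  fresh phi l.
Proof.
elim: l => [|[r c] l IH] //= /andP[rl ul] /andP[cl vl] ex inj.
split=> //.
  apply: IH => // [r' c' rc|r1 c1 r2 c2 w h1 h2].
    by apply: ex; rewrite in_cons rc orbT.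
  by apply: inj; rewrite in_cons ?h1 ?h2 orbT.
have [|w rcw] := ex r c; first exact: mem_head.
by exists w => // r' c' _ c'l rcw'; apply: inj rcw' rcw => //; exact: mem_head.
Qed.

(** * Cubes and approximate homotheties of the lattice *)

Section Lattice.
Variable k : nat.
Implicit Types (u v b : 'rV[int]_k) (L N S : nat).

Definition grid b S : seq 'rV[int]_k :=
  [seq \row_i (b 0 i + (f i : nat)%:Z) | f : {ffun 'I_k -> 'I_S}].

Lemma mem_grid b S u :
  (u \in grid b S) = [forall i, (b 0 i <= u 0 i) && (u 0 i < b 0 i + S%:Z)].
Proof.
apply/mapP/forallP => [[f _ ->] i|uS].
  by rewrite mxE; move: (nat_of_ord (f i)) (ltn_ord (f i)) => m; lia.
have lt i : (absz (u 0%R i - b 0%R i)%R < S)%N by have := uS i; lia.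
exists [ffun i => Ordinal (lt i)]; first by rewrite mem_enum.
by apply/rowP => i; rewrite mxE ffunE /=; have := uS i; lia.
Qed.

Lemma grid_uniq b S : uniq (grid b S).
Proof.
rewrite map_inj_uniq ?enum_uniq// => f g /rowP fg.
by apply/ffunP => i; apply/val_inj; have := fg i; rewrite !mxE /=; lia.
Qed.

Lemma size_grid b S : size (grid b S) = (S ^ k)%N.
Proof. by rewrite size_map -cardE card_ffun !card_ord. Qed.

Definition inbox L u := [forall i, (absz (u 0%R i) <= L)%N].
Definition box L := grid (const_mx (- L%:Z)) L.*2.+1.

Lemma mem_box L u : (u \in box L) = inbox L u.
Proof.
rewrite mem_grid; apply/forallP/forallP => H i; have := H i; rewrite mxE; lia.
Qed.

Lemma inboxP L u : reflect (forall i, (absz (u 0%R i) <= L)%N) (inbox L u).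
Proof. exact: forallP. Qed.

Definition cdiv N u : 'rV[int]_k := \row_i (u 0%R i %/ N)%Z.
Definition cmod N u : 'rV[int]_k := \row_i (u 0%R i %% N)%Z.

Lemma cdiv_eq N u : u = cdiv N u *+ N + cmod N u.
Proof.
apply/rowP => i; rewrite mxE mulmxnE !mxE {1}(divz_eq (u 0%R i) N).
by rewrite -mulr_natr natz.
Qed.

Lemma cmod_grid N u : (0 < N)%N -> cmod N u \in grid 0 N.
Proof.
move=> N0; rewrite mem_grid; apply/forallP => i; rewrite !mxE add0r.
by rewrite modz_ge0 ?ltz_pmod//; lia.
Qed.

Lemma cdiv_unique N (j r : 'rV[int]_k) : r \in grid 0 N -> 
  cdiv N (j *+ N + r) = j /\ cmod N (j *+ N + r) = r.
Proof.
rewrite mem_grid => /forallP rN.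
have e i : (j *+ N + r) 0 i = j 0 i * N%:Z + r 0 i.
  by rewrite mxE mulmxnE -mulr_natr natz.
split; apply/rowP => i; rewrite mxE e; have := rN i; rewrite !mxE add0r => /andP[r0 rN'].
  by rewrite divzMDl; [rewrite divz_small ?addr0//; lia|lia].
by rewrite modzMDl modz_small//; lia.
Qed.

(** An integral version of the homothety of ratio [1 - 1/q]. In each coordinate it merges [a] with
    [a - 1] when [q] divides [a + s]; [nocol] discards such [a], and varying [s] moves the places
    where this happens. *)
Definition rho (q s : nat) u : 'rV[int]_k :=
  \row_i (u 0%R i - ((u 0%R i + s%:Z)%R %/ q)%Z).

Definition nocol (q s : nat) u := [forall i, ~~ (q %| (u 0%R i + s%:Z)%R)%Z].

Lemma rho_inj q s u v : (0 < q)%N -> nocol q s u -> nocol q s v ->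
  rho q s u = rho q s v -> u = v.
Proof.
move=> q0 /forallP uq /forallP vq /rowP e; apply/rowP => i.
have := e i; rewrite !mxE.
have /dvdz_mod0P/eqP := uq i; have /dvdz_mod0P/eqP := vq i.
move: (u 0 i) (v 0 i) => a b.
have := divz_eq (a + s%:Z) q; have := divz_eq (b + s%:Z) q.
have := ltz_pmod (a + s%:Z) (_ : 0 < q%:Z); have := modz_ge0 (a + s%:Z) (_ : q%:Z != 0).
have := ltz_pmod (b + s%:Z) (_ : 0 < q%:Z); have := modz_ge0 (b + s%:Z) (_ : q%:Z != 0).
move: (divz _ _) (divz _ _) (modz _ _) (modz _ _) => A B C E.
move=> /(_ ltac:(lia)) ? /(_ ltac:(lia)) ? /(_ ltac:(lia)) ? /(_ ltac:(lia)) ?.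
move=> e1 e2 /eqP ? /eqP ? e3.
(* Both remainders lie between 1 and [q - 1], so they differ by less than [q - 1] and the quotients
   must agree. *)
have : (A - B) * (q%:Z - 1) = C - E \/ (A - B) * (q%:Z - 1) = E - C by nia.
have [|AB] : A = B \/ A <> B by lia.
  nia.
nia.
Qed.

Lemma sum_dvdz_le1 (q : nat) (z : int) : (0 < q)%N ->
  (\sum_(s < q) (q %| (z + (s : nat)%:Z)%R)%Z <= 1)%N.
Proof.
move=> q0; rewrite -(@big_mkcond _ _ addn _ _ (fun s : 'I_q => (q %| (z + (s : nat)%:Z)%R)%Z) (fun=> 1%N)).
rewrite sum1_card; apply/card_le1_eqP => s t; rewrite !unfold_in => sq tq; apply/val_inj; move: sq tq => /=.
move: (nat_of_ord s) (nat_of_ord t) (ltn_ord s) (ltn_ord t) => a b aq bq sq tq.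
have : (q %| (b%:Z - a%:Z)%R)%Z.
  have -> : b%:Z - a%:Z = (z + b%:Z) - (z + a%:Z) by lia.
  exact: rpredB.
move=> /dvdzP[x e].
have [x0|[x0|x0]] : x = 0 \/ (x >= 1 \/ x <= -1) by lia.
- by move: e; rewrite x0 mul0r; lia.
- have : x * q%:Z >= q%:Z by rewrite ler_peMl//; lia.
  by lia.
- have : (- x) * q%:Z >= q%:Z by rewrite ler_peMl//; lia.
  by lia.
Qed.

Lemma sum_collisions (q : nat) u : (0 < q)%N -> (\sum_(s < q) ~~ nocol q s u <= k)%N.
Proof.
move=> q0; apply: (@leq_trans (\sum_(s < q) \sum_(i < k) (q %| (u 0%R i + (s : nat)%:Z)%R)%Z)).
  apply: leq_sum => s _; rewrite negb_forall; case: existsP => //= -[i].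
  by rewrite negbK => qi; rewrite (bigD1 i)//= qi.
rewrite exchange_big/= -[leqRHS]card_ord -sum1_card.
by apply: leq_sum => i _; exact: sum_dvdz_le1.
Qed.

(** Each coordinate of a point is bad for at most one [s], so a point collides for at most [k] of
    the [q] shifts. Averaging over [s] yields a shift that loses at most a proportion [k/q] of the
    points. *)
Lemma exists_shift (T : Type) (q : nat) (A : seq T) (g : T -> 'rV[int]_k) : (0 < q)%N ->
  exists2 s, (s < q)%N &
    (q * size A <= q * count (fun x => nocol q s (g x)) A + k * size A)%N.
Proof.
move=> q0; pose bad s := count (fun x => ~~ nocol q s (g x)) A.
have tot : (\sum_(s < q) bad s <= k * size A)%N.
  rewrite /bad; elim: A {bad} => [|x A IH] /=; first by rewrite big1.
  by rewrite big_split mulnS leq_add// sum_collisions.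
have [[s sq h]|no] := pselect (exists2 s, (s < q)%N & (q * bad s <= k * size A)%N).
  exists s => //; rewrite -(count_predC (fun x => nocol q s (g x)) A) mulnDr leq_add2l.
  by rewrite count_predC.
have {}no (s : 'I_q) : (k * size A < q * bad s)%N.
  by rewrite ltnNge; apply/negP => H; apply: no; exists s.
have : (\sum_(s < q) k * size A < \sum_(s < q) q * bad s)%N.
  case: q q0 bad tot no => // q _ bad tot no.
  rewrite !big_ord_recl -addSn leq_add// leq_sum// => i _; exact/ltnW.
rewrite sum_nat_const card_ord -big_distrr /= ltn_mul2l => /andP[_].
by rewrite ltnNge tot.
Qed.

End Lattice.

(** * Laguerre cells *)

Section PowerCells.
Variables (R : realFieldType) (k : nat).
Implicit Types (u v n m e : 'rV[int]_k) (w : 'rV[int]_k -> R) (L N E q s : nat).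

Definition rc u (i : 'I_k) : R := (u 0 i)%:~R.
Definition sqn u : R := \sum_i rc u i ^+ 2.
Definition n1 u : R := \sum_i `|rc u i|.
Definition dot u v : R := \sum_i rc u i * rc v i.

Lemma rcD u v i : rc (u + v) i = rc u i + rc v i.
Proof. by rewrite /rc mxE intrD. Qed.
Lemma rcN u i : rc (- u) i = - rc u i.
Proof. by rewrite /rc mxE intrN. Qed.
Lemma rcB u v i : rc (u - v) i = rc u i - rc v i.
Proof. by rewrite rcD rcN. Qed.

Lemma norm_rc u i : `|rc u i| = (absz (u 0%R i))%:R.
Proof. by rewrite /rc -intr_norm -abszE. Qed.

Lemma natr_mul_sum (a : R) : k%:R * a = \sum_(i < k) a.
Proof. by rewrite sumr_const card_ord mulr_natl. Qed.

Lemma sqn_ge0 u : 0 <= sqn u.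
Proof. by apply: sumr_ge0 => i _; exact: sqr_ge0. Qed.

Lemma n1_ge0 u : 0 <= n1 u.
Proof. by apply: sumr_ge0. Qed.

Lemma n1_ge1 u : u != 0 -> 1 <= n1 u.
Proof.
move=> u0; have [i ui] : exists i, u 0%R i != 0.
  apply/existsP; apply: contraNT u0 => /existsPn u0.
  by apply/eqP/rowP => i; rewrite mxE; have := u0 i; rewrite negbK => /eqP.
rewrite /n1 (bigD1 i)//= norm_rc ler_wpDr//; first exact: sumr_ge0.
by rewrite (ler1n R); move: ui; lia.
Qed.

Definition cost w n u : R := sqn (u - n) + w n.

Lemma cost_diff w n m u :
  cost w m u - cost w n u = sqn (m - n) - 2 * dot (u - n) (m - n) + w m - w n.
Proof.
have e : sqn (u - m) = sqn (u - n) + (sqn (m - n) - 2 * dot (u - n) (m - n)).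
  rewrite /sqn /dot mulr_sumr -sumrB -big_split; apply: eq_bigr => i _ /=.
  by rewrite !rcB; ring.
by rewrite /cost e; ring.
Qed.

Lemma dot_le u v L : inbox L u -> `|dot u v| <= L%:R * n1 v.
Proof.
move=> /inboxP uL; rewrite /n1 mulr_sumr (le_trans (ler_norm_sum _ _ _))// ler_sum// => i _.
by rewrite normrM ler_wpM2r// norm_rc ler_nat.
Qed.

(** The margin is proportional to the distance of the competitor because translating [v] changes a
    cost difference by an amount linear in [m - n]. *)
Definition beats w E n v := forall m, m != n ->
  cost w n v + E%:R * n1 (m - n) <= cost w m v.

Lemma beats_uniq w n n' v : beats w 1 n v -> beats w 1 n' v -> n = n'.
Proof.
move=> b b'; apply/eqP; apply: contraT => nn'.
have := b _ (contra_neq esym nn'); have := b' _ nn'.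
have := @n1_ge1 (n' - n); rewrite subr_eq0 => /(_ (contra_neq esym nn')).
have := @n1_ge1 (n - n'); rewrite subr_eq0 => /(_ nn').
by rewrite !mul1r; lra.
Qed.

Lemma beatsW w E F n v : (F <= E)%N -> beats w E n v -> beats w F n v.
Proof.
move=> FE b m mn; apply: le_trans (b m mn); rewrite lerD2l.
by rewrite ler_wpM2r ?n1_ge0// ler_nat.
Qed.

Lemma beats_move w N E n v e : inbox N e -> beats w (N.*2 + E) n v -> beats w E n (v + e).
Proof.
move=> eN b m mn; have := b m mn.
rewrite -lerBrDl cost_diff => b1; rewrite -lerBrDl cost_diff.
have -> : v + e - n = (v - n) + e by rewrite addrAC.
have -> : dot (v - n + e) (m - n) = dot (v - n) (m - n) + dot e (m - n).
  by rewrite /dot -big_split; apply: eq_bigr => i _; rewrite rcD mulrDl.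
have := dot_le (m - n) eN; rewrite ler_norml => /andP[_ d1].
have : (N.*2 + E)%:R = 2 * N%:R + E%:R :> R by rewrite natrD -mul2n natrM.
move: b1; set x := n1 _ in d1 *; move=> + xE; rewrite xE mulrDl; lra.
Qed.

(** For sites far apart, the squared distance dominates any linear margin. Coordinates of size at
    most [M] are paid for by the large coordinate, the others by their own square. *)
Lemma sqn_sep M u : (exists i, (M <= absz (u 0%R i))%N) -> M%:R * n1 u <= k%:R * sqn u.
Proof.
move=> [j Mj].
have Msq : M%:R ^+ 2 <= sqn u.
  rewrite /sqn (bigD1 j)//= ler_wpDr ?sumr_ge0// => [i _|]; first exact: sqr_ge0.
  by rewrite -[leRHS]real_normK ?num_real// norm_rc lerXn2r ?nnegrE ?ler0n// ler_nat.
rewrite /n1 mulr_sumr (natr_mul_sum (sqn u)).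
apply: ler_sum => i _; rewrite norm_rc.
have [iM|Mi] := leqP (absz (u 0%R i)) M.
  by rewrite (le_trans _ Msq)// expr2 ler_wpM2l// ler_nat.
rewrite (@le_trans _ _ (rc u i ^+ 2))//; last first.
  by rewrite /sqn (bigD1 i)//= lerDl sumr_ge0// => j' _; exact: sqr_ge0.
rewrite -[leRHS]real_normK ?num_real// norm_rc expr2 ler_wpM2r// ler_nat.
exact: ltnW.
Qed.

Definition ratio q : R := 1 - q%:R^-1.
Definition scale q w n : R := ratio q * w n.

Lemma rho_approx q s x i : (0 < q)%N -> (s < q)%N ->
  `|rc (rho q s x) i - ratio q * rc x i| <= 1.
Proof.
move=> q0 sq; rewrite /rc mxE /ratio; move: (x 0%R i) => a.
have := divz_eq (a + s%:Z) q.
have := ltz_pmod (a + s%:Z) (_ : 0 < q%:Z); have := modz_ge0 (a + s%:Z) (_ : q%:Z != 0).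
set b := divz _ _; set r := modz _ _; clearbody b r.
move=> /(_ ltac:(lia)) r0 /(_ ltac:(lia)) rq /(congr1 (fun z : int => z%:~R : R)).
move=> e; rewrite !intrD intrM in e.
have {r0} r0 : 0 <= r%:~R :> R by rewrite ler0z.
have {rq} rq : r%:~R <= q%:R :> R by rewrite -[q%:R]/(q%:~R) ler_int ltW.
have s0 : 0 <= s%:~R :> R by rewrite ler0z.
have {}sq : s%:~R <= q%:R :> R by rewrite -[q%:R]/(q%:~R) ler_int; move: sq; lia.
have qp : 0 < q%:R :> R by rewrite ltr0n.
have -> : (a - b)%:~R - (1 - q%:R^-1) * a%:~R = (r%:~R - s%:~R) / q%:R :> R.
  have -> : a%:~R = b%:~R * q%:R + r%:~R - s%:~R :> R by rewrite -e addrK.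
  rewrite intrB.
  have -> : a%:~R = b%:~R * q%:R + r%:~R - s%:~R :> R by rewrite -e addrK.
  by field; rewrite gt_eqF.
rewrite normrM normfV [`|q%:R|]gtr0_norm// ler_pdivrMr// mul1r ler_norml.
by apply/andP; split; lra.
Qed.

(* Homothety of ratio [1 - 1/q] about a site maps its power cell deep into its
   cell for the rescaled weights. *)
Lemma beats_scale q s E L M w n u : (1 < q)%N -> (s < q)%N -> (0 < k)%N ->
  (q * k * (E.*2 + 2) <= M)%N ->
  inbox L (u - n) ->
  (forall m, m != n -> w m < (2 * L + k * (2 * L.+1 + E) ^ 2 *2)%:R ->
      exists i, (M <= absz ((m - n)%R 0%R i))%N) ->
  0 <= w n <= L%:R ->
  (forall m, m != n -> cost w n u <= cost w m u + E%:R * n1 (m - n)) ->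
  beats (scale q w) E n (n + rho q s (u - n)).
Proof.
move=> q1 sq k0 qM uL sep /andP[wn0 wnL] near m mn.
have vn : n + rho q s (u - n) - n = rho q s (u - n) by rewrite addrAC subrr add0r.
rewrite -lerBrDl cost_diff vn /scale.
set x := u - n; set t := m - n; set y := rho q s x; set c := ratio q.
have q0 : (0 < q)%N by lia.
have qR : 2 <= q%:R :> R by rewrite (ler_nat R 2).
have qi : q%:R^-1 <= 2^-1 :> R by rewrite lef_pV2 ?posrE ?ltr0n// (lt_le_trans _ qR).
have qi0 : 0 < q%:R^-1 :> R by rewrite invr_gt0 ltr0n.
have c12 : 2^-1 <= c by rewrite /c /ratio; lra.
have c1 : c <= 1 by rewrite /c /ratio; lra.
have yb i : `|rc y i| <= L.+1%:R.
  have := rho_approx x i q0 sq; rewrite -/y -/c.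
  have /inboxP/(_ i) := uL; rewrite -/x -(ler_nat R) -norm_rc => xL h.
  have : `|c * rc x i| <= `|rc x i|.
    by rewrite normrM ler_piMl// ger0_norm; lra.
  have := ler_normD (rc y i - c * rc x i) (c * rc x i); rewrite subrK.
  by rewrite -natr1; lra.
(* A competitor of low weight is far from [n]: scaling leaves a surplus [(1 - c) * sqn t], which
   pays for the initial deficit, the rounding in [rho] and the new margin. A competitor of high
   weight loses by its weight alone, since half of it outweighs the minimum of a quadratic
   polynomial in the distance. *)
have [wm|wm] := ltrP (w m) (2 * L + k * (2 * L.+1 + E) ^ 2 *2)%:R.
  have Mt := sqn_sep (sep _ mn wm); rewrite -/t in Mt.
  have tn : q%:R * (E.*2 + 2)%:R * n1 t <= sqn t.
    have : (q * k * (E.*2 + 2))%:R * n1 t <= k%:R * sqn t.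
      by apply: le_trans Mt; rewrite ler_wpM2r ?n1_ge0// ler_nat.
    have -> : (q * k * (E.*2 + 2))%:R = k%:R * (q%:R * (E.*2 + 2)%:R) :> R.
      by rewrite !natrM; ring.
    by rewrite -mulrA ler_pM2l ?ltr0n.
  have {}tn : (E.*2 + 2)%:R * n1 t <= q%:R^-1 * sqn t.
    by rewrite [leRHS]mulrC ler_pdivlMr ?ltr0n// mulrC mulrA.
  have := near _ mn; have := cost_diff w n m u; rewrite -/x -/t => d1 d2.
  have dy : dot y t <= c * dot x t + n1 t.
    rewrite /dot /n1 mulr_sumr -big_split; apply: ler_sum => i _ /=.
    have := rho_approx x i q0 sq; rewrite -/y -/c => h.
    rewrite mulrA -lerBlDl -mulrBl (le_trans (ler_norm _))// normrM.
    by rewrite ler_piMl.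
  have n10 := n1_ge0 t.
  have cd : c * (cost w m u - cost w n u) >= - E%:R * n1 t.
    have [p|p] := lerP 0 (cost w m u - cost w n u).
      by apply: (@le_trans _ _ 0); [rewrite mulNr oppr_le0 mulr_ge0|rewrite mulr_ge0//; lra].
    have : 1 * (cost w m u - cost w n u) <= c * (cost w m u - cost w n u).
      by rewrite ler_wnM2r// ltW.
    by lra.
  rewrite d1 in cd.
  have cq : (1 - c) * sqn t >= (E.*2 + 2)%:R * n1 t by rewrite /c /ratio opprB addrC subrK.
  have : (E.*2 + 2)%:R * n1 t = 2 * (E%:R * n1 t) + 2 * n1 t.
    by rewrite natrD -mul2n natrM mulrDl mulrA.
  rewrite mulNr in cd; move: cq cd dy; clearbody c; set P := E%:R * n1 t.
  move=> cq cd dy e; rewrite e in cq; lra.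
have lo : - (k%:R * (2 * L.+1%:R + E%:R) ^+ 2) <= sqn t - 2 * dot y t - E%:R * n1 t.
  rewrite /sqn /dot /n1 !mulr_sumr -!sumrB natr_mul_sum -sumrN.
  apply: ler_sum => i _.
  have h1 : rc y i * rc t i <= L.+1%:R * `|rc t i|.
    by rewrite (le_trans (ler_norm _))// normrM ler_wpM2r.
  have h2 : rc t i ^+ 2 = `|rc t i| ^+ 2 by rewrite real_normK ?num_real.
  rewrite h2; move: h1; set a := rc y i * _; move: `|_| (L.+1%:R) (E%:R) => T Lr Er h1.
  have := sqr_ge0 (T - (2 * Lr + Er) / 2); have := sqr_ge0 (2 * Lr + Er).
  rewrite !expr2; lra.
have hc : 2^-1 * (w m - w n) <= c * (w m - w n).
  apply: ler_wpM2r => //; move: wm; rewrite natrD natrM.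
  have := ler0n R (k * (2 * L.+1 + E) ^ 2 *2); lra.
have : (2 * L + k * (2 * L.+1 + E) ^ 2 *2)%:R = 2 * L%:R + (k%:R * (2 * L.+1%:R + E%:R) ^+ 2) * 2 :> R.
  by rewrite natrD !natrM !natrD !natrM expr2.
move: lo hc wm wnL wn0; set Q := k%:R * _; move=> lo hc wm wnL wn0 e; rewrite e in wm.
have := ler0n R L.
lra.
Qed.
End PowerCells.

(** * Density of deep points for sparse weights *)

Definition reach (k L0 : nat) := (k * L0 ^ 2).+1.
(** The threshold of [beats_scale] for radius [reach k L0 + N] and margin [2N + 1]. In [reach], the
    term [k * L0 ^ 2] bounds the cost of a zero-weight site within [L0], and the added 1 allows for
    soft comparisons of costs. *)
Definition height (k L0 N : nat) :=
  (2 * (reach k L0 + N) + k * (2 * (reach k L0 + N).+1 + N.*2.+1) ^ 2 * 2)%N.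

Section WeightField.
Variables (R : realFieldType) (k L0 N M q : nat) (w : 'rV[int]_k -> R).
Implicit Types (u v n m e o : 'rV[int]_k).

Definition sparse_weights := 
  [/\ forall n, 0 <= w n,
      forall u, exists n, inbox L0 (u - n) /\ w n = 0 &
      forall n m, n != m -> w n < (height k L0 N)%:R -> w m < (height k L0 N)%:R ->
        exists i, (M <= absz ((n - m)%R 0%R i))%N].

Hypotheses (k0 : (0 < k)%N) (q1 : (1 < q)%N) 
  (qM : (q * k * (N.*2.+1.*2 + 2) <= M)%N) (sw : sparse_weights).

Let L1 := reach k L0.

Lemma sqn_inbox L u : inbox L u -> sqn R u <= (k * L ^ 2)%:R.
Proof.
move=> /inboxP uL; rewrite natrM natr_mul_sum ler_sum// => i _.
by rewrite -[leLHS]real_normK ?num_real// norm_rc natrX lerXn2r ?nnegrE ?ler0n// ler_nat.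
Qed.

Lemma sqn_notin L u : ~~ inbox L u -> L.+1%:R <= sqn R u.
Proof.
rewrite negb_forall => /existsP[i]; rewrite -ltnNge => iL.
rewrite /sqn (bigD1 i)//= ler_wpDr ?sumr_ge0// => [j _|]; first exact: sqr_ge0.
rewrite -[leRHS]real_normK ?num_real// norm_rc -natrX ler_nat.
by rewrite (leq_trans iL)// -mulnn; nia.
Qed.

Lemma low_cost u : exists n, cost w n u <= (k * L0 ^ 2)%:R /\ inbox L0 (u - n).
Proof.
have [_ /(_ u)[n [nu wn]] _] := sw; exists n; split=> //.
by rewrite /cost wn addr0 sqn_inbox.
Qed.

Lemma cost_inbox n u : cost w n u <= L1%:R -> inbox L1 (u - n) /\ w n <= L1%:R.
Proof.
have [w0 _ _] := sw; rewrite /cost => h; split.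
  apply: contraT => /sqn_notin; have := w0 n; rewrite -natr1; lra.
by have := sqn_ge0 R (u - n); lra.
Qed.

Lemma exists_minimizer u : exists n, 
  [/\ inbox L1 (u - n), w n <= L1%:R & forall m, cost w n u <= cost w m u].
Proof.
have [w0 _ _] := sw; have [n0 [n0c n0u]] := low_cost u.
pose s := [seq u - x | x <- box k L1].
have n0s : n0 \in s.
  apply/mapP; exists (u - n0); last by rewrite subKr.
  rewrite mem_box; have [] := cost_inbox (le_trans n0c _) => //.
  by rewrite ler_nat.
have [n ns nmin] : exists2 n, n \in s & forall m, m \in s -> cost w n u <= cost w m u.
  elim: s n0s => //= a s IH; rewrite in_cons => /orP[/eqP n0a|/IH[n ns nmin]].
    clear n0a IH; elim: s => [|b s [n]].
      by exists a; rewrite ?mem_head// => m; rewrite inE => /eqP->.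
    move=> nas nmin; have [bn|nb] := lerP (cost w b u) (cost w n u).
      exists b; first by rewrite !inE eqxx orbT.
      move=> m; rewrite !inE => /or3P[/eqP->|/eqP->//|ms].
        by rewrite (le_trans bn)// nmin// mem_head.
      by rewrite (le_trans bn)// nmin// in_cons ms orbT.
    exists n; first by move: nas; rewrite !inE => /orP[->//|->]; rewrite !orbT.
    move=> m; rewrite !inE => /or3P[/eqP->|/eqP->|ms]; rewrite ?(ltW nb)//.
      by rewrite nmin// mem_head.
    by rewrite nmin// in_cons ms orbT.
  have [an|na] := lerP (cost w a u) (cost w n u).
    exists a; rewrite ?mem_head// => m; rewrite in_cons => /orP[/eqP->//|/nmin].
    exact: le_trans.
  exists n; first by rewrite in_cons ns orbT.
  by move=> m; rewrite in_cons => /orP[/eqP->|/nmin//]; exact: ltW.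
have nc : cost w n u <= (k * L0 ^ 2)%:R := le_trans (nmin _ n0s) n0c.
have [un wn] : inbox L1 (u - n) /\ w n <= L1%:R.
  by apply: cost_inbox; rewrite (le_trans nc)// ler_nat.
exists n; split=> // m.
have [ms|ms] := boolP (m \in s); first exact: nmin.
have : ~~ inbox L1 (u - m).
  apply: contra ms => um; apply/mapP; exists (u - m); rewrite ?mem_box//.
  by rewrite subKr.
move/sqn_notin => h; rewrite (le_trans nc)// /cost ler_wpDr//.
by rewrite (le_trans _ h)// ler_nat /L1 /reach; lia.
Qed.

(** A zero-weight site lies in the tested box and bounds the cost of [n] by [L1], while a site
    outside the box [L1] around [u] costs more than that. So finitely many comparisons decide, and
    the slack 1 lets a continuous cutoff make them. *)
Lemma soft_minimizer n u : inbox L1 (u - n) ->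
  (forall m, inbox L1.*2 (m - n) -> cost w n u <= cost w m u + 1) ->
  w n <= L1%:R /\ forall m, cost w n u <= cost w m u + 1.
Proof.
move=> un near; have [w0 _ _] := sw; have [n0 [n0c n0u]] := low_cost u.
have nc : cost w n u <= L1%:R.
  have -> : L1%:R = (k * L0 ^ 2)%:R + 1 :> R by rewrite natr1.
  rewrite (le_trans (near n0 _)) ?lerD2r//.
  apply/inboxP => i; move/inboxP: un => /(_ i); move/inboxP: n0u => /(_ i).
  rewrite !mxE; have : (L0 <= L1)%N by rewrite /L1 /reach; nia.
  by move: (u _ i) (n0 _ i) (n _ i) L1 => a b c L; lia.
split; first by have [] := cost_inbox nc.
move=> m; have [um|um] := boolP (inbox L1 (u - m)).
  apply: near; apply/inboxP => i; move/inboxP: un => /(_ i); move/inboxP: um => /(_ i).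
  by rewrite !mxE; move: (u _ i) (m _ i) (n _ i) L1 => a b c L; lia.
rewrite (le_trans nc)// ler_wpDr// /cost ler_wpDr//.
by rewrite (le_trans _ (sqn_notin um))// ler_nat; lia.
Qed.

(** The displacement [e] costs up to [2N] per unit of distance, and the slack 1 at most one more
    unit; this is the deficit that [beats_scale] tolerates. The margin obtained has the same size,
    so it allows crossing a cube of side [N] and still winning by 1. *)
Lemma beats_deep s n u e : (s < q)%N -> inbox L1 (u - n) -> w n <= L1%:R ->
  inbox N e -> (forall m, cost w n u <= cost w m u + 1) ->
  beats (scale q w) N.*2.+1 n (n + rho q s (u + e - n)).
Proof.
move=> sq un wn eN near; have [w0 _ sep] := sw.
apply: (@beats_scale _ _ q s N.*2.+1 (L1 + N)%N M) => //.
- apply/inboxP => i; move/inboxP: un => /(_ i); move/inboxP: eN => /(_ i).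
  by rewrite !mxE; move: (u _ i) (e _ i) (n _ i) L1 => a b c L; lia.
- move=> m mn wm; apply: sep => //.
  rewrite (le_lt_trans wn)// ltr_nat /height -/L1.
  have : (0 < k * (2 * (L1 + N).+1 + N.*2.+1) ^ 2 * 2)%N by rewrite !muln_gt0 k0 /=; lia.
  lia.
- by rewrite w0 (le_trans wn)// ler_nat leq_addr.
move=> m mn; have := near m; rewrite -lerBlDl -opprB lerNl cost_diff => h.
rewrite -lerBlDl -opprB lerNl cost_diff.
have -> : u + e - n = (u - n) + e by rewrite addrAC.
have -> : dot R (u - n + e) (m - n) = dot R (u - n) (m - n) + dot R e (m - n).
  by rewrite /dot -big_split; apply: eq_bigr => i _; rewrite rcD mulrDl.
have := dot_le R (m - n) eN; rewrite ler_norml => /andP[_ d1].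
have := @n1_ge1 R _ (m - n); rewrite subr_eq0 => /(_ mn).
have -> : N.*2.+1%:R = 2 * N%:R + 1 :> R by rewrite -natr1 -mul2n natrM.
rewrite mulrDl; lra.
Qed.

Lemma scale_le n : 0 <= scale q w n <= w n.
Proof.
have [/(_ n) w0 _ _] := sw; have qi : 0 <= (q%:R : R)^-1 <= 1.
  by rewrite invr_ge0 ler0n invf_le1 ?ltr0n ?ler1n; lia.
by rewrite /scale /ratio; move: qi w0; move: (q%:R^-1) => a qi w0; nra.
Qed.

Lemma beats_inbox n v : beats (scale q w) 1 n v -> inbox L1 (v - n).
Proof.
move=> b; have [n0 [n0c _]] := low_cost v; apply: contraT => /sqn_notin h.
have /andP[s0 _] := scale_le n; have /andP[_ s1] := scale_le n0.
have [nn0|nn0] := eqVneq n0 n; move: n0c; rewrite /cost.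
  have [/(_ n) w0 _ _] := sw.
  rewrite nn0 => n0c; have : (k * L0 ^ 2)%:R < L1.+1%:R :> R by rewrite ltr_nat /L1 /reach; lia.
  by move: h n0c w0; lra.
have := b _ nn0; rewrite /cost; have := n1_ge0 R (n0 - n).
have : (k * L0 ^ 2)%:R < L1.+1%:R :> R by rewrite ltr_nat /L1 /reach; lia.
move: h s0 s1; lra.
Qed.

Definition good E v := exists n, beats (scale q w) E n v.

(** Each [u] is sent to its scaled image in the cell of a minimizing site. The image determines the
    site, since a point has at most one winner, and then determines [u] unless [rho] collides. The
    image stays within [L1 + 1] of [u], whence the enlarged window. *)
Lemma good_dense o S :
  ((q - k) * S ^ k <= q * count (fun v => `[< good N.*2.+1 v >])
      (grid (o - const_mx L1.+1%:Z) (S + L1.+1.*2)%N))%N.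
Proof.
pose c u := sval (cid (exists_minimizer u)).
have cP u : [/\ inbox L1 (u - c u), w (c u) <= L1%:R & forall m, cost w (c u) u <= cost w m u].
  by rewrite /c; case: cid.
have q0 : (0 < q)%N by lia.
have [s sq Hs] := exists_shift (grid o S) (fun u => u - c u) q0.
rewrite size_grid in Hs.
rewrite mulnBl leq_subLR addnC (leq_trans Hs)// leq_add2r leq_mul2l; apply/orP; right.
pose f u := c u + rho q s (u - c u).
have fb u : beats (scale q w) N.*2.+1 (c u) (f u).
  have [c1 c2 c3] := cP u; rewrite /f -[u in rho _ _ (u - _)]addr0.
  apply: beats_deep => //; first by apply/inboxP => i; rewrite mxE.
  by move=> m; rewrite (le_trans (c3 m))// lerDl.
rewrite -!size_filter -(size_map f); apply: uniq_leq_size.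
  rewrite map_inj_in_uniq ?filter_uniq ?grid_uniq// => u u'; rewrite !mem_filter.
  move=> /andP[nu _] /andP[nu' _] e.
  have cc : c u = c u'.
    apply: (@beats_uniq _ _ (scale q w) _ _ (f u)); first exact: beatsW (fb u).
    by rewrite e; exact: beatsW (fb u').
  move: e; rewrite /f cc => /addrI e.
  move: nu; rewrite cc => nu; have := rho_inj q0 nu nu' e.
  by move/addIr.
move=> v /mapP[u]; rewrite !mem_filter => /andP[_ ugrid] ->.
apply/andP; split; first by apply/asboolP; exists (c u); exact: fb.
have [c1 _ _] := cP u.
move: ugrid; rewrite !mem_grid => /forallP ug; apply/forallP => i.
have := ug i; move/inboxP: c1 => /(_ i); rewrite /f !mxE.
move: (u _ i) (c u _ i) (o _ i) => a b d.
have := divz_eq (a - b + s%:Z) q.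
have := ltz_pmod (a - b + s%:Z) (_ : 0 < q%:Z); have := modz_ge0 (a - b + s%:Z) (_ : q%:Z != 0).
set B := divz _ _; set r := modz _ _; clearbody B r.
move=> /(_ ltac:(lia)) r0 /(_ ltac:(lia)) rq e abL ad.
have : - L1.+1%:Z <= B <= L1.+1%:Z by apply/andP; split; nia.
by move: ad; lia.
Qed.

End WeightField.

Lemma bernoulli_grid (k b S : nat) : (0 < k)%N -> (4 * k * b <= S)%N ->
  (3 * (S + b) ^ k <= 4 * S ^ k)%N.
Proof.
move=> k0 kS.
(* Bernoulli's inequality in the form [(1 + b/S)^j * (1 - j*b/S) <= 1], with denominators
   cleared. *)
have H j : (j <= k)%N -> ((S + b) ^ j * (S - j * b) <= S ^ j.+1)%N.
  elim: j => [|j IH] jk; first by rewrite mul0n subn0 expn0 mul1n.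
  have h : ((S + b) * (S - j.+1 * b) <= S * (S - j * b))%N by nia.
  have := IH (ltnW jk); rewrite (expnS (S + b)%N j) (expnS S j.+1).
  move: h; move: ((S + b) ^ j)%N (S ^ j.+1)%N (S - j.+1 * b)%N (S - j * b)%N => P Q y z h1 h2.
  apply: (@leq_trans (P * (S * z))); last by rewrite mulnCA leq_mul2l h2 orbT.
  by rewrite mulnAC [leqLHS]mulnC leq_mul2l h1 orbT.
have [S0|S0] := posnP S; first rewrite S0 in kS *.
  have -> : b = 0%N by nia.
  by rewrite addn0 exp0n.
have := H k (leqnn _); rewrite expnS => h.
have : (3 * S <= 4 * (S - k * b))%N by nia.
move=> h3; rewrite -(leq_pmul2l S0).
have : ((S + b) ^ k * (3 * S) <= (S + b) ^ k * (4 * (S - k * b)))%N by rewrite leq_mul2l h3 orbT.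
lia.
Qed.

(** Collisions lose less than a quarter of the points because [4 * k < q], and the larger window
    costs at most another factor 3/4. Each good set thus has density above 9/16, and two sets of
    density above 1/2 meet. *)
Lemma common_good (R : realFieldType) (k L0 N M q : nat) (w w' : 'rV[int]_k -> R) (o : 'rV[int]_k) S :
  (0 < k)%N -> (4 * k < q)%N -> (q * k * (N.*2.+1.*2 + 2) <= M)%N ->
  sparse_weights L0 N M w -> sparse_weights L0 N M w' ->
  (4 * k * (reach k L0).+1.*2 <= S)%N -> (0 < S)%N ->
  exists2 v, v \in grid (o - const_mx (reach k L0).+1%:Z) (S + (reach k L0).+1.*2) &
    good q w N.*2.+1 v /\ good q w' N.*2.+1 v.
Proof.
move=> k0 kq qM sw sw' kS S0.
have q1 : (1 < q)%N by lia.
have := good_dense k0 q1 qM sw o S; have := good_dense k0 q1 qM sw' o S.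
set G := grid _ _; set P' := fun _ => _; set P := fun _ => _ => hP' hP.
have sG : size G = ((S + (reach k L0).+1.*2) ^ k)%N by rewrite size_grid.
have hb := bernoulli_grid k0 kS; rewrite -sG in hb.
have : has (predI P P') G.
  rewrite has_count; have := count_predUI P P' G; have := count_size (predU P P') G.
  have Sk : (0 < S ^ k)%N by rewrite expn_gt0 S0.
  have hk : (3 * q < 4 * (q - k))%N by lia.
  have : (q * size G < q * (count P G + count P' G))%N.
    move: (S ^ k)%N (size G) (count P G) (count P' G) Sk hb hP hP' => Y Z a b *; nia.
  rewrite ltn_mul2l; lia.
by case/hasP => v vG /andP[/asboolP ? /asboolP ?]; exists v.
Qed.

(** * Compact metric spaces *)

Section RealContinuity.
Variables (R : realType) (X : topologicalType).
Implicit Types f g : X -> R.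

Lemma contD f g : continuous f -> continuous g -> continuous (fun x => f x + g x).
Proof. by move=> cf cg x; apply: cvgD; [exact: cf|exact: cg]. Qed.

Lemma contB f g : continuous f -> continuous g -> continuous (fun x => f x - g x).
Proof. by move=> cf cg x; apply: cvgB; [exact: cf|exact: cg]. Qed.

Lemma contM f g : continuous f -> continuous g -> continuous (fun x => f x * g x).
Proof. by move=> cf cg x; apply: cvgM; [exact: cf|exact: cg]. Qed.

Lemma cont_cst (c : R) : continuous (fun _ : X => c).
Proof. by move=> x; exact: cvg_cst. Qed.

Lemma cont_max f g : continuous f -> continuous g -> continuous (fun x => Num.max (f x) (g x)).
Proof. by move=> cf cg x; apply: continuous_max; [exact: cf|exact: cg]. Qed.

Lemma cont_min f g : continuous f -> continuous g -> continuous (fun x => Num.min (f x) (g x)).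
Proof. by move=> cf cg x; apply: continuous_min; [exact: cf|exact: cg]. Qed.

Lemma contV f : (forall x, f x != 0) -> continuous f -> continuous (fun x => (f x)^-1).
Proof. by move=> f0 cf x; apply: cvgV => //; exact: cf. Qed.

Lemma cont_big (op : R -> R -> R) (idx : R) (I : Type) (s : seq I) (P : pred I) (F : I -> X -> R) :
  (forall f g, continuous f -> continuous g -> continuous (fun x => op (f x) (g x))) ->
  (forall i, continuous (F i)) ->
  continuous (fun x => \big[op/idx]_(i <- s | P i) F i x).
Proof.
move=> cop cF; elim: s => [|i s IH].
  by under eq_fun do rewrite big_nil; exact: cont_cst.
under eq_fun do rewrite big_cons.
by case: (P i) => //; apply: cop.
Qed.

Lemma cont_sum (I : Type) (s : seq I) (P : pred I) (F : I -> X -> R) :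
  (forall i, continuous (F i)) -> continuous (fun x => \sum_(i <- s | P i) F i x).
Proof. by apply: cont_big => f g; exact: contD. Qed.

Lemma cont_prod (I : Type) (s : seq I) (P : pred I) (F : I -> X -> R) :
  (forall i, continuous (F i)) -> continuous (fun x => \prod_(i <- s | P i) F i x).
Proof. by apply: cont_big => f g; exact: contM. Qed.

Lemma cont_precomp (h : X -> X) f : continuous h -> continuous f -> continuous (fun x => f (h x)).
Proof. by move=> ch cf x; apply: (@continuous_comp _ _ _ h f); [exact: ch|exact: cf]. Qed.

Lemma cont_near f x (e : R) : continuous f -> 0 < e -> \forall y \near x, `|f y - f x| < e.
Proof.
move=> cf e0; have /cvgrPdist_lt /(_ _ e0) := cf x; apply: filterS => y.
by rewrite distrC.
Qed.

End RealContinuity.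

Section CompactMetric.
Variables (R : realType) (X : topologicalType) (d : X -> X -> R).
Hypotheses (cX : compact [set: X]) (dm : compatible_metric d).

Lemma d_ge0 x y : 0 <= d x y. Proof. by have [[]] := dm. Qed.
Lemma d_xx x : d x x = 0. Proof. by have [[_ /(_ x x) [_ ->]]] := dm. Qed.
Lemma d_eq0 x y : d x y = 0 -> x = y. Proof. by have [[_ /(_ x y) []]] := dm. Qed.
Lemma d_sym x y : d x y = d y x. Proof. by have [[]] := dm. Qed.
Lemma d_tri y x z : d x z <= d x y + d y z. Proof. by have [[]] := dm. Qed.

Lemma d_near x (e : R) : 0 < e -> \forall y \near x, d x y < e.
Proof.
move=> e0; have [_ dO] := dm; apply: open_nbhs_nbhs; split => /=; last first.
  by rewrite /= d_xx.
apply/(dO [set y | d x y < e]) => y /= xy; exists (e - d x y); first by rewrite subr_gt0.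
move=> z /= yz; rewrite (le_lt_trans (d_tri y _ _))//; lra.
Qed.

Lemma d_near2 x y (e : R) : 0 < e ->
  \forall p \near (x, y), `|d p.1 p.2 - d x y| < e.
Proof.
move=> e0; have e2 : 0 < e / 2 by lra.
exists ([set x' | d x x' < e / 2], [set y' | d y y' < e / 2]) => /=.
  by split; exact: d_near.
move=> [x' y'] /= [xx yy]; rewrite ltr_norml; apply/andP; split.
  have := d_tri x' x y; have := d_tri y' x' y; rewrite (d_sym y' y); lra.
have := d_tri x x' y'; have := d_tri y x y'; rewrite (d_sym x' x); lra.
Qed.

Lemma cont_lipschitz (f : X -> R) : (forall x y, f x <= f y + d x y) -> continuous f.
Proof.
move=> fl x; apply/cvgrPdist_lt => e e0; apply: filterS (d_near x e0) => y xy.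
have := fl x y; have := fl y x; rewrite (d_sym y x) ltr_norml => *.
by apply/andP; split; lra.
Qed.

(** For a family increasing in [n], a locally uniform choice of [n] becomes global. *)
Lemma compact_eventually (P : nat -> X -> Prop) :
  (forall n m x, (n <= m)%N -> P n x -> P m x) ->
  (forall x : X, exists n, \forall y \near x, P n y) -> exists n, forall x, P n x.
Proof.
move=> Pm Px; have cc := (compact_near_coveringP [set: X]).1 cX.
have [|n _ Hn] := @cc nat eventually P _; last first.
  by exists n => x; apply: (Hn n) => //=.
move=> x _; have [n nx] := Px x.
exists ([set y | P n y], [set m | (n <= m)%N]) => /=.
  by split => //; exists n.
by move=> [y m] /= [Py nm]; exact: Pm Py.
Qed.

Lemma compact_eventually2 (P : nat -> X -> X -> Prop) :
  (forall n m x y, (n <= m)%N -> P n x y -> P m x y) ->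
  (forall x y : X, exists n, \forall p \near (x, y), P n p.1 p.2) -> exists n, forall x y, P n x y.
Proof.
move=> Pm Px; have := compact_setX cX cX; rewrite setXTT => /(compact_near_coveringP [set: X * X]).1 cc.
have [|n _ Hn] := @cc nat eventually (fun n p => P n p.1 p.2) _; last first.
  by exists n => x y; apply: (Hn n _ (x, y)) => //=.
move=> [x y] _; have [n nx] := Px x y.
exists ([set p | P n p.1 p.2], [set m | (n <= m)%N]) => /=.
  by split => //; exists n.
by move=> [p m] /= [Py nm]; exact: Pm Py.
Qed.

Lemma invn_lt (e : R) : 0 < e -> exists n : nat, n.+1%:R^-1 < e.
Proof.
move=> e0; exists (Num.truncn e^-1).
rewrite invf_plt ?posrE ?ltr0n//.
by have := truncnS_gt e^-1.
Qed.

Lemma invn_le (n m : nat) : (n <= m)%N -> m.+1%:R^-1 <= n.+1%:R^-1 :> R.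
Proof. by move=> nm; rewrite lef_pV2 ?posrE ?ltr0n// ler_nat. Qed.

Lemma unif_cont (f : X -> R) (e : R) : continuous f -> 0 < e ->
  exists2 del : R, 0 < del & forall x y, d x y < del -> `|f x - f y| <= e.
Proof.
move=> cf e0.
pose P (n : nat) x y := d x y < n.+1%:R^-1 -> `|f x - f y| <= e.
have [|x y|n Pn] := @compact_eventually2 P; last by exists n.+1%:R^-1; rewrite ?invr_gt0 ?ltr0n.
  by move=> n m x y nm Pn xy; apply: Pn; rewrite (lt_le_trans xy)// invn_le.
have [xy|xy] := eqVneq x y.
  exists 0%N; rewrite -xy; have e2 : 0 < e / 2 by lra.
  exists ([set y' | `|f y' - f x| < e / 2], [set y' | `|f y' - f x| < e / 2]) => /=.
    by split; exact: cont_near.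
  move=> [x' y'] /= [h1 h2] _.
  have := ler_normB (f x' - f x) (f y' - f x); rewrite opprB addrA subrK; lra.
have dxy : 0 < d x y.
  by rewrite lt_neqAle d_ge0 andbT; apply: contra_neq xy => /esym/d_eq0.
have [n nd] : exists n : nat, n.+1%:R^-1 < d x y / 2 by apply: invn_lt; lra.
exists n; have d2 : 0 < d x y / 2 by lra.
apply: filterS (d_near2 x y d2) => p; rewrite ltr_norml => /andP[p1 p2] h.
by exfalso; move: h nd p1; move: (d p.1 p.2) (d x y) (_^-1) => a b c *; lra.
Qed.

End CompactMetric.

(** * Partitions of unity from widim *)

Section FreudenthalPartition.
Variables (R : realType) (v K : nat).
Implicit Types (y p : 'I_v -> R) (e : {ffun 'I_v -> 'I_K.+1}).

(** The condition that [e] is the integer part of [y + t] reads [low y e <= t < high y e]; the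
    initial values 0 and 1 of the iterated maximum and minimum impose [0 <= t < 1]. *)
Definition low y e : R := \big[Num.max/0]_i ((e i : nat)%:R - y i).
Definition high y e : R := \big[Num.min/1]_i ((e i : nat)%:R + 1 - y i).
(* Length of the set of t in [0, 1) such that e is the integer part of y + t. *)
Definition weight y e : R := Num.max 0 (high y e - low y e).

Lemma low_ge y e : 0 <= low y e /\ forall i, (e i : nat)%:R - y i <= low y e.
Proof.
split; first by rewrite /low; elim/big_rec: _ => // i a _ a0; rewrite le_max a0 orbT.
move=> i; rewrite /low (bigD1 i)//= le_max lexx//.
Qed.

Lemma high_le y e : high y e <= 1 /\ forall i, high y e <= (e i : nat)%:R + 1 - y i.
Proof.
split; last by move=> i; rewrite /high (bigD1 i)//= ge_min lexx.
by rewrite /high; elim/big_rec: _ => // i a _ a0; rewrite ge_min a0 orbT.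
Qed.

Lemma low_witness y e : low y e = 0 \/ exists i, low y e = (e i : nat)%:R - y i.
Proof.
rewrite /low; elim/big_rec: _ => [|i a _ IH]; first by left.
by rewrite maxElt; case: ifP => _ //; right; exists i.
Qed.

Lemma high_pos y e : (forall i, 0 < (e i : nat)%:R + 1 - y i) -> 0 < high y e.
Proof. by move=> H; rewrite /high; elim/big_rec: _ => // i a _ a0; rewrite lt_min H. Qed.

Lemma weight_ge0 y e : 0 <= weight y e.
Proof. by rewrite /weight le_max lexx. Qed.

Lemma weight_neq0 y e : weight y e != 0 -> low y e < high y e.
Proof.
rewrite /weight maxElt; case: ifP => h; rewrite ?eqxx// => _.
by rewrite subr_gt0 in h.
Qed.

Lemma weight_close y e i : weight y e != 0 -> `|(e i : nat)%:R - y i| < 1.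
Proof.
move=> /weight_neq0 lh; have [l0 /(_ i) li] := low_ge y e; have [h0 /(_ i) hi] := high_le y e.
rewrite ltr_norml; apply/andP; split; lra.
Qed.

(** The integer part of [y] itself, at [t = 0], has positive weight. Positivity suffices, as the
    weights are normalized later. *)
Lemma weight_sum_pos y : (forall i, 0 <= y i <= K%:R) -> 0 < \sum_e weight y e.
Proof.
move=> y0K.
have tl i : (Num.truncn (y i) < K.+1)%N.
  have /andP[y0 yK] := y0K i; rewrite ltnS.
  by rewrite -(ler_nat R) (le_trans _ yK)// truncn_le.
pose e : {ffun 'I_v -> 'I_K.+1} := [ffun i => Ordinal (tl i)].
have eE i : (e i : nat) = Num.truncn (y i) by rewrite ffunE.
rewrite (bigD1 e)//= ltr_pwDl//; last by apply: sumr_ge0 => *; exact: weight_ge0.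
have l0 : low y e = 0.
  have [//|[i]] := low_witness y e.
  have [+ _] := low_ge y e; rewrite eE => l0 li; apply/eqP; rewrite eq_le l0 andbT.
  by rewrite li subr_le0 truncn_le//; have /andP[] := y0K i.
rewrite /weight l0 subr0 lt_max; apply/orP; right; apply: high_pos => i.
rewrite eE subr_gt0 natr1 truncnS_gt//.
Qed.

(** Partial sums are the coordinates of the Freudenthal subdivision: scaled by [K], the barycentric
    coordinates become a monotone sequence ending at [K], and cutting it by the integer lattice
    refines the simplex without raising its dimension. *)
Definition psum p (i : 'I_v) : R := \sum_(l < v | (l <= i)%N) p l.

Variable p : 'I_v -> R.
Hypotheses (p0 : forall i, 0 <= p i) (p1 : \sum_i p i = 1).
Let y i := K%:R * psum p i.

Lemma psum_bounds i : 0 <= y i <= K%:R.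
Proof.
rewrite /y mulr_ge0 ?sumr_ge0//= ler_piMr// -p1 /psum [leLHS]big_mkcond ler_sum//= => l _.
by case: ifP.
Qed.

(** As [t] grows from 0 to 1, the integer part of [y + t] changes only at the values [tau l], and
    new values of [y] arise only at indices in the support of [p]. The last such index has [y = K]
    and [tau = 0], which accounts for the start [t = 0]; so there are no more integer parts than
    support points. *)
Lemma weight_support (S : {set 'I_v}) : (forall i, p i != 0 -> i \in S) ->
  (#|[set e | weight y e != 0%R]%SET| <= #|S|)%N.
Proof.
move=> supp.
pose tau l := (Num.ceil (y l))%:~R - y l.
have lowtau e : weight y e != 0 -> exists2 l, l \in S & low y e = tau l.
  move=> we.
  have [z|nz] := eqVneq (low y e) 0.
    have [i0 pi0] : exists i, p i != 0.
      apply/existsP; apply: contraT => /existsPn h.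
      by move: p1; rewrite big1 => [/eqP|j _]; [rewrite eq_sym oner_eq0|apply/eqP; rewrite -[_ == _]negbK h].
    case: (@arg_maxnP _ i0 (fun i => p i != 0) (fun i => i : nat) pi0) => l pl lmax.
    exists l; first exact: supp.
    have yl : y l = K%:R.
      rewrite /y -[RHS]mulr1 -p1 /psum; congr (_ * _).
      rewrite [RHS](bigID (fun l' : 'I_v => (l' <= l)%N))/= [X in _ + X]big1 ?addr0// => l' l'l.
      by apply/eqP; apply: contraNT l'l; exact: lmax.
    by rewrite z /tau yl -[K%:R]/(K%:~R) intrKceil subrr.
  have [z|[i li]] := low_witness y e; first by rewrite z eqxx in nz.
  have [l0 _] := low_ge y e; have [h1 /(_ i) hi] := high_le y e.
  have lh := weight_neq0 we.
  have lp : 0 < low y e by rewrite lt_neqAle eq_sym nz.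
  have yi0 : y i != 0.
    apply/eqP => yi; move: hi lh li; rewrite yi => hi lh li; move: lp lh h1.
    rewrite li subr0; case: (nat_of_ord (e i)) => [|n]; first by rewrite ltxx.
    by move=> _ lh h1; have := lt_le_trans lh h1; rewrite -natr1; have := ler0n R n; lra.
  have [i0 /andP[i0i pi0]] : exists l : 'I_v, (l <= i)%N && (p l != 0).
    apply/existsP; apply: contraNT yi0 => /existsPn h.
    rewrite /y /psum big1 ?mulr0// => l li'; apply/eqP; rewrite -[_ == _]negbK.
    by have := h l; rewrite li'.
  have P0 : (i0 <= i)%N && (p i0 != 0) by rewrite i0i pi0.
  case: (@arg_maxnP _ i0 (fun l : 'I_v => (l <= i)%N && (p l != 0)) (fun i => i : nat) P0) => l /andP[li' pl] lmax.
  exists l; first exact: supp.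
  have yl : y l = y i.
    rewrite /y /psum; congr (_ * _).
    rewrite [RHS](bigID (fun l' : 'I_v => (l' <= l)%N))/= [X in _ + X]big1 ?addr0 => [|l' /andP[l'i l'l]].
      by apply: eq_bigl => l'; apply/idP/andP => [h|[]//]; split => //; exact: leq_trans h li'.
    by apply/eqP; apply: contraNT l'l => pl'; apply: lmax; rewrite l'i.
  rewrite /tau yl li; congr (_ - _); rewrite -[_%:R]/((e i : nat)%:~R); congr (_%:~R).
  apply/esym/ceil_def; rewrite intrB -[(e i : nat)%:Z%:~R]/((e i : nat)%:R).
  by apply/andP; split; lra.
have linj e e' : weight y e != 0 -> weight y e' != 0 -> low y e = low y e' -> e = e'.
  move=> we we' ll; apply/ffunP => i; apply/val_inj => /=.
  have [_ /(_ i) l1] := low_ge y e; have [_ /(_ i) h1] := high_le y e.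
  have [_ /(_ i) l2] := low_ge y e'; have [_ /(_ i) h2] := high_le y e'.
  have := weight_neq0 we; have := weight_neq0 we'.
  move: l1 h1 l2 h2; rewrite ll; move: (nat_of_ord (e i)) (nat_of_ord (e' i)) => a b *.
  have : a%:R < b.+1%:R :> R by rewrite -natr1; lra.
  have : b%:R < a.+1%:R :> R by rewrite -natr1; lra.
  by rewrite !ltr_nat; lia.
rewrite !cardE -(size_map (low y)) -(size_map tau) uniq_leq_size//.
  rewrite map_inj_in_uniq ?enum_uniq// => e e'; rewrite !mem_enum !inE; exact: linj.
move=> r /mapP[e]; rewrite mem_enum inE => /lowtau[l lS ->] ->.
by apply/mapP; exists l => //; rewrite mem_enum.
Qed.

End FreudenthalPartition.

Section FinePartition.
Variables (R : realType) (X : topologicalType).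

Definition fine_partition (dd : X -> X -> R) (eps : R) (m : nat)
    (E : finType) (F : E -> X -> R) :=
  [/\ forall e, continuous (F e), forall e x, 0 <= F e x,
      forall x, \sum_e F e x = 1,
      forall x, (#|[set e | F e x != 0%R]%SET| <= m)%N &
      forall e x y, F e x != 0 -> F e y != 0 -> dd x y < eps].

Lemma cont_weight (v K : nat) (y : 'I_v -> X -> R) (e : {ffun 'I_v -> 'I_K.+1}) :
  (forall i, continuous (y i)) -> continuous (fun x => weight (y ^~ x) e).
Proof.
move=> cy; apply: cont_max; first exact: cont_cst.
apply: contB.
  apply: (@cont_big _ _ Num.min) => [f g|i]; first exact: cont_min.
  by apply: contB => //; exact: cont_cst.
apply: (@cont_big _ _ Num.max) => [f g|i]; first exact: cont_max.
by apply: contB => //; exact: cont_cst.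
Qed.

Lemma psumB (v : nat) (p q : 'I_v -> R) (l : 'I_v) (b : R) :
  (forall i, `|psum p i - psum q i| <= b) -> `|p l - q l| <= b + b.
Proof.
move=> H.
have key (r : 'I_v -> R) : psum r l = r l + \sum_(i < v | (i < l)%N) r i.
  rewrite /psum (bigD1 l)//=; congr (_ + _); apply: eq_bigl => i.
  by rewrite -val_eqE /= ltn_neqAle andbC.
case: (posnP l) => [l0|l0].
  have := H l; rewrite !key !big_pred0 ?addr0; [|by move=> i; rewrite l0..].
  by have := le_trans (normr_ge0 _) (H l); move: (`|p l - q l|) => *; lra.
have lv : (l.-1 < v)%N by have := ltn_ord l; lia.
have prev (r : 'I_v -> R) : psum r (Ordinal lv) = \sum_(i < v | (i < l)%N) r i.
  by rewrite /psum; apply: eq_bigl => i /=; lia.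
have := H l; have := H (Ordinal lv); rewrite !key !prev.
set a := \sum_(_ < _ | _) _; set c := \sum_(_ < _ | _) _ => h1 h2.
have -> : p l - q l = (p l + a - (q l + c)) - (a - c) by ring.
by rewrite (le_trans (ler_normB _ _))// lerD.
Qed.

(** The weights of the Freudenthal subdivision are pulled back along [pi]. A simplex of dimension
    [n] has [n.+1] vertices, which bounds the multiplicity, and a fine subdivision makes the
    supports almost as small as the fibers. *)
Lemma widim_fine_partition (dd : X -> X -> R) (eps : R) (n : nat) :
  compact [set: X] ->
  (forall x y, dd x y < eps -> \forall p \near (x, y), dd p.1 p.2 < eps) ->
  widim_admissible dd eps n ->
  exists (E : finType) (F : E -> X -> R), fine_partition dd eps n.+1 F.
Proof.
move=> cX ddn [v [S [pi [[S1 _] Sn cpi piS pid]]]].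
have pi0 x i : 0 <= pi x i by have [] := piS x.
have pi1 x : \sum_i pi x i = 1 by have [_ []] := piS x.
(* The 4 arises because points sharing a vertex have scaled partial sums less than 2 apart, and a
   coordinate is a difference of two partial sums. Compactness turns the bound on the fibers into a
   bound on points with close images. *)
have [K PK] : exists K : nat, forall x y, (forall i, `|pi x i - pi y i| <= 4 * K.+1%:R^-1) -> dd x y < eps.
  apply: (@compact_eventually2 _ cX (fun K x y => (forall i, `|pi x i - pi y i| <= 4 * K.+1%:R^-1) -> dd x y < eps)).
    move=> a b x y ab H h; apply: H => i; rewrite (le_trans (h i))// ler_pM2l//.
    exact: invn_le.
  move=> x y; have [xy|xy] := pselect (dd x y < eps).
    by exists 0%N; apply: filterS (ddn _ _ xy).
  have [i pii] : exists i, pi x i != pi y i.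
    apply/existsP; apply: contraT => /existsPn h; exfalso; apply: xy.
    have e : pi x = pi y.
      by apply/funext => i; apply/eqP; rewrite -[_ == _]negbK h.
    have := pid (pi y); rewrite /diam_lt; rewrite -lte_fin; apply: le_lt_trans.
    by apply: ereal_sup_ubound; exists x => //; exists y.
  set del : R := `|pi x i - pi y i|.
  have del0 : 0 < del by rewrite normr_gt0 subr_eq0.
  have d4 : 0 < del / 4 by lra.
  have [K0 HK] : exists K : nat, K.+1%:R^-1 < del / 16 by apply: invn_lt; lra.
  exists K0.
  exists ([set x' | `|pi x' i - pi x i| < del / 4], [set y' | `|pi y' i - pi y i| < del / 4]).
    by split; exact: (cont_near _ (cpi i) d4).
  move=> [x' y'] /= [h1 h2] /(_ i) h3; exfalso.
  have e : pi x i - pi y i = (pi x' i - pi y' i) - (pi x' i - pi x i) + (pi y' i - pi y i) by ring.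
  have : del <= `|pi x' i - pi y' i| + `|pi x' i - pi x i| + `|pi y' i - pi y i|.
    by rewrite /del e (le_trans (ler_normD _ _))// lerD2r ler_normB.
  set z : R := K0.+1%:R^-1 in HK h3; clearbody z del; lra.
pose L := (K.+1)%N.
pose y (i : 'I_v) x : R := L%:R * psum (pi x) i.
have cy i : continuous (y i).
  apply: contM; first exact: cont_cst.
  by apply: cont_sum => l; exact: cpi.
pose lam (e : {ffun 'I_v -> 'I_L.+1}) x := weight (y ^~ x) e.
have clam e : continuous (lam e) by exact: cont_weight.
have Lam0 x : 0 < \sum_e lam e x.
  by apply: weight_sum_pos => i; exact: psum_bounds.
exists {ffun 'I_v -> 'I_L.+1}, (fun e x => lam e x / \sum_e lam e x).
have nz e x : lam e x / \sum_e lam e x != 0 -> lam e x != 0.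
  by apply: contra_neq => ->; rewrite mul0r.
split.
- move=> e; apply: contM => //; apply: contV; last exact: cont_sum.
  by move=> x; rewrite gt_eqF.
- by move=> e x; rewrite divr_ge0 ?weight_ge0// ltW.
- by move=> x; rewrite -mulr_suml divff// gt_eqF.
- move=> x; set s := finset (fun i => pi x i != 0).
  have sS : s \in S by have [_ [_]] := piS x.
  have sn : (#|s| <= n.+1)%N.
    have : (#|s| <= \max_(s in S) #|s|)%N by exact: leq_bigmax_cond.
    by move: Sn; rewrite /sc_dim; lia.
  apply: leq_trans sn.
  apply: (@leq_trans #|[set e | lam e x != 0%R]%SET|).
    by apply/subset_leq_card/fintype.subsetP => e; rewrite !inE; exact: nz.
  by apply: weight_support => // i; rewrite inE.
move=> e x x' /nz ex /nz ex'; apply: PK => i.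
have L0 : 0 < L%:R :> R by rewrite ltr0n.
have -> : 4 * K.+1%:R^-1 = 2 / L%:R + 2 / L%:R :> R by rewrite /L; field; rewrite gt_eqF.
apply: psumB => l; have h := weight_close l ex; have h' := weight_close l ex'.
rewrite ler_pdivlMr// -[X in _ * X]gtr0_norm// -normrM.
have -> : (psum (pi x) l - psum (pi x') l) * L%:R =
   ((e l : nat)%:R - y l x') - ((e l : nat)%:R - y l x) by rewrite /y; ring.
rewrite (le_trans (ler_normB _ _))//; move: h h'; move: (`|_|) (`|_|) => a b *; lra.
Qed.

End FinePartition.

(** * Marker functions and tilings of orbits *)

Section Action.
Variables (R : realType) (X : topologicalType) (d : X -> X -> R) (k : nat)
  (T : 'rV[int]_k -> X -> X).
Hypotheses (cX : compact [set: X]) (dm : compatible_metric d) (Ta : Zk_action T).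

Lemma act0 x : T 0 x = x. Proof. by have [] := Ta. Qed.
Lemma actD m n x : T m (T n x) = T (m + n) x. Proof. by have [_ ->] := Ta. Qed.
Lemma act_cont n : continuous (T n). Proof. by have [_ _] := Ta. Qed.

Lemma dN_near N eps x y : 0 < eps -> dN T d N x y < eps ->
  \forall p \near (x, y), dN T d N p.1 p.2 < eps.
Proof.
move=> e0; rewrite /dN; elim: (index_enum _) => [|a s IH].
  by rewrite big_nil => _; apply: (@filterE _ (nbhs (x, y))) => p; rewrite big_nil.
rewrite big_cons gt_max => /andP[h1 /IH h2].
have g0 : 0 < eps - d (T (box_vec a) x) (T (box_vec a) y) by rewrite subr_gt0.
have [[A B] [/= nA nB] AB] := d_near2 dm (T (box_vec a) x) (T (box_vec a) y) g0.
have h3 : \forall p \near (x, y), d (T (box_vec a) p.1) (T (box_vec a) p.2) < eps.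
  exists (T (box_vec a) @^-1` A, T (box_vec a) @^-1` B) => /=.
    by split; exact: (act_cont _).
  move=> [x' y'] /= [Ax By]; have := AB (T (box_vec a) x', T (box_vec a) y') (conj Ax By).
  rewrite /= ltr_norml => /andP[_]; lra.
by apply: (@filterS2 _ (nbhs (x, y)) _ _ _ _ _ h2 h3) => p p1 p2; rewrite big_cons gt_max p1 p2.
Qed.

Lemma dN_ge N x y r : r \in grid (0 : 'rV[int]_k) N -> d (T r x) (T r y) <= dN T d N x y.
Proof.
case/mapP => f _ ->; rewrite /dN (bigD1 f)//= le_max.
set r' := matrix_of_fun _ _; have -> : r' = box_vec f.
  by apply/rowP => i; rewrite !mxE add0r.
by rewrite lexx.
Qed.

(** [phi] is a distance to the complement of [U], capped at 1. By compactness every orbit meets a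
    set where [phi] is bounded below within a bounded window; the factor [j.+1] makes [a] vanish
    there, while [a < 1] still forces membership in [U]. *)
Lemma marker_function M : marker_property T ->
  exists (L0 : nat) (a : X -> R), [/\ continuous a, forall x, 0 <= a x <= 1,
    forall x, exists2 n, inbox L0 n & a (T n x) = 0 &
    forall x n, n != 0 -> inbox M n -> a x < 1 -> a (T n x) < 1 -> False].
Proof.
move=> /(_ (box k M))[U [oU [UX UF]]].
(* The element 1 keeps the set nonempty when [U] is the whole space. *)
pose D x : set R := [set r | r = 1 \/ exists2 y, ~ U y & r = d x y].
pose phi x := inf (D x).
have D1 x : D x 1 by left.
have D0 x r : D x r -> 0 <= r by case=> [->//|[y _ ->]]; exact: d_ge0 dm _ _.
have Dhas x : has_inf (D x) by split; [exists 1|exists 0 => r; exact: D0].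
have phi0 x : 0 <= phi x by apply: lb_le_inf; [exists 1|move=> r; exact: D0].
have philip x y : phi x <= phi y + d x y.
  rewrite -lerBlDr; apply: lb_le_inf; first by exists 1.
  move=> r [->|[z Uz ->]].
    have : phi x <= 1 by apply: ge_inf => //; exact: (Dhas x).2.
    have := d_ge0 dm x y; lra.
  have : phi x <= d x z by apply: ge_inf; [exact: (Dhas x).2|right; exists z].
  have := d_tri dm y x z; lra.
have cphi : continuous phi by exact: (cont_lipschitz dm).
have phiU x : 0 < phi x -> U x.
  move=> px; apply: contrapT => Ux.
  have : phi x <= d x x by apply: ge_inf; [exact: (Dhas x).2|right; exists x].
  by rewrite (d_xx dm); lra.
have Uphi x : U x -> 0 < phi x.
  move=> Ux; have [e e0 eU] := (dm.2 U).1 oU x Ux.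
  apply: (@lt_le_trans _ _ (Num.min 1 e)); first by rewrite lt_min ltr01.
  apply: lb_le_inf; first by exists 1.
  move=> r [->|[y Uy ->]]; rewrite ge_min ?lexx//.
  by apply/orP; right; rewrite leNgt; apply/negP => xy; apply: Uy; apply: eU.
have [j Hj] : exists j, forall x, exists2 n, inbox j n & j.+1%:R^-1 < phi (T n x).
  apply: (compact_eventually cX) => [n m x nm [u un h]|x].
    exists u; first by apply/inboxP => i; move/inboxP: un => /(_ i); lia.
    by rewrite (le_lt_trans _ h)// invn_le.
  have : [set: X] x by []. 
  rewrite -UX => -[n _ [y Uy yx]].
  have yE : T (- n) x = y by rewrite -yx actD addNr act0.
  have py : 0 < phi (T (- n) x) by rewrite yE; exact: Uphi.
  have [j Hj] := invn_lt py.
  pose b := \max_i absz ((- n)%R 0%R i).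
  exists (maxn j b).
  have g0 : 0 < phi (T (- n) x) - (maxn j b).+1%:R^-1.
    by rewrite subr_gt0 (le_lt_trans _ Hj)// invn_le// leq_maxl.
  have cphin := cont_precomp (@act_cont (- n)) cphi.
  apply: filterS (cont_near x cphin g0) => z; rewrite ltr_norml => /andP[h _].
  exists (- n); last by move: h; move: (phi _) (phi _) (_^-1) => *; lra.
  apply/inboxP => i; apply: leq_trans (leq_maxr _ _).
  by rewrite /b (bigD1 i)//= leq_maxl.
exists j, (fun x => 1 - Num.min 1 (phi x * j.+1%:R)).
have j0 : 0 < j.+1%:R :> R by rewrite ltr0n.
have pos x : 1 - Num.min 1 (phi x * j.+1%:R) < 1 -> U x.
  rewrite gtrDl oppr_lt0 lt_min => /andP[_]; rewrite pmulr_lgt0//; exact: phiU.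
split.
- apply: contB; first exact: cont_cst.
  apply: cont_min; first exact: cont_cst.
  by apply: contM => //; exact: cont_cst.
- move=> x; have : 0 <= Num.min 1 (phi x * j.+1%:R) <= 1.
    by rewrite le_min ler01 ge_min lexx /= andbT mulr_ge0// ltW.
  lra.
- move=> x; have [n nj h] := Hj x; exists n => //.
  rewrite min_l ?subrr//; move: h; rewrite -[_^-1]mul1r ltr_pdivrMr//; exact: ltW.
- move=> x n n0 nM /pos Ux /pos UTx; have := UF n _ n0; rewrite mem_box nM => /(_ isT).
  by move/seteqP => [/(_ (T n x)) + _]; apply; split => //; exists x.
Qed.

End Action.

(** * Cubes supplied by the bound on mean dimension *)

Section MdimBound.
Variables (R : realType) (X : topologicalType) (d : X -> X -> R) (k : nat)
  (T : 'rV[int]_k -> X -> X).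

Lemma mdim_lt_widim (c eps : R) : (mdim T d < c%:E)%E -> 0 < eps ->
  exists2 c', c' < c & exists N0, forall N, (N0 <= N)%N ->
    exists2 p, widim_admissible (dN T d N) eps p & (N%:R ^+ k)^-1 * p%:R <= c'.
Proof.
move=> mc e0.
set u := fun N : nat => (((N%:R : R) ^+ k)^-1%:E * widim (dN T d N) eps)%E.
have u0 N : (0 <= u N)%E.
  rewrite /u mule_ge0// ?lee_fin ?invr_ge0 ?exprn_ge0//.
  by apply: le_ereal_inf_tmp => _ [n _ <-]; rewrite lee_fin.
have ul : (limn_esup u < c%:E)%E.
  apply: le_lt_trans mc; apply: ereal_sup_ubound; exists eps => //.
move: ul; rewrite /limn_esup limf_esupE => /ereal_inf_lt[_ [A [N0 _ N0A] <-] Ac].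
have Nc N : (N0 <= N)%N -> (u N <= ereal_sup (u @` A))%E.
  by move=> NN; apply: ereal_sup_ubound; exists N => //; exact: N0A.
have s0 : (0 <= ereal_sup (u @` A))%E by apply: le_trans (u0 N0) (Nc _ (leqnn _)).
have [s sE] : exists s : R, ereal_sup (u @` A) = s%:E.
  by move: Ac s0; case: (ereal_sup _) => // r; exists r.
rewrite sE lte_fin in Ac.
(* The midpoint gives the strict inequality needed to extract an admissible dimension from the
   infimum. *)
exists ((s + c) / 2); first lra.
exists (maxn N0 1) => N; rewrite geq_max => /andP[NN N1].
have := Nc _ NN; rewrite sE /u => h.
have Nk : 0 < (N%:R : R) ^+ k by rewrite exprn_gt0// ltr0n.
have : (widim (dN T d N) eps < ((s + c) / 2 * N%:R ^+ k)%:E)%E.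
  rewrite -(@lte_pmul2l _ ((N%:R ^+ k)^-1)%:E)// ?lte_fin ?invr_gt0//.
  apply: le_lt_trans h _; rewrite -EFinM lte_fin mulrCA mulVf ?gt_eqF// mulr1; lra.
rewrite /widim => /ereal_inf_lt[_ [p pa <-]]; rewrite lte_fin => ph.
by exists p => //; rewrite mulrC ler_pdivrMr// ltW.
Qed.

(** [p.+2] counts the at most [p + 1] nonzero functions of the partition and one coordinate for a
    large-scale marker. The strict inequality leaves a surplus [(b - c) * N ^ k], which exceeds 2
    for large [N]. *)
Lemma mdim_admissible (D : nat) (eps : R) : (0 < k)%N ->
  (mdim T d < (D%:R / 2 ^+ k.+1)%:E)%E -> 0 < eps ->
  exists N p, [/\ (0 < N)%N, widim_admissible (dN T d N) eps p & (2 ^ k.+1 * p.+2 <= D * N ^ k)%N].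
Proof.
move=> k0 /mdim_lt_widim h /h[c cD [N0 HN]].
set b : R := D%:R / 2 ^+ k.+1 in cD.
pose N := maxn N0 (Num.truncn (2 / (b - c))).+1.
have [p pa pc] := HN N (leq_maxl _ _).
have N1 : (0 < N)%N by rewrite /N; lia.
exists N, p; split=> //.
have bc : 0 < b - c by lra.
have Nk : 0 < (N%:R : R) ^+ k by rewrite exprn_gt0// ltr0n.
have hN : 2 <= (b - c) * N%:R ^+ k.
  rewrite mulrC -ler_pdivrMr//.
  apply: (@le_trans _ _ N%:R).
    rewrite (@le_trans _ _ (Num.truncn (2 / (b - c))).+1%:R) ?ler_nat ?leq_maxr//.
    by rewrite ltW// truncnS_gt.
  by rewrite -natrX ler_nat -[leqLHS]expn1 leq_pexp2l.
rewrite mulrC ler_pdivrMr// in pc.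
rewrite -(ler_nat R) !natrM natrX -ler_pdivlMl; last by rewrite exprn_gt0.
have -> : (2 ^+ k.+1)^-1 * (D%:R * (N ^ k)%:R) = b * N%:R ^+ k :> R.
  by rewrite /b natrX; ring.
rewrite mulrBl in hN; rewrite -addn2 natrD; lra.
Qed.

Lemma mdim_admissible0 (D : nat) (eps : R) : k = 0%N ->
  (mdim T d < (D%:R / 2 ^+ k.+1)%:E)%E -> 0 < eps ->
  exists N p, [/\ (0 < N)%N, widim_admissible (dN T d N) eps p & (p < D)%N].
Proof.
move=> k0 /mdim_lt_widim h /h[c cD [N0 HN]].
have [p pa pc] := HN (maxn N0 1) (leq_maxl _ _); exists (maxn N0 1), p; split=> //; first lia.
move: pc cD; rewrite k0 expr0 invr1 mul1r expr1 => pc cD.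
rewrite -(ltr_nat R) (le_lt_trans pc)// (lt_le_trans cD)// ler_pdivrMr//.
by rewrite ler_peMr// ?ler1n.
Qed.
End MdimBound.

(** * Gluing functions prescribed on tiles *)

Section Tiling.
Variables (R : realType) (X : topologicalType) (d : X -> X -> R) (k : nat)
  (T : 'rV[int]_k -> X -> X).
Hypotheses (cX : compact [set: X]) (dm : compatible_metric d) (Ta : Zk_action T).

Definition clamp (r : R) : R := Num.min 1 (Num.max 0 r).

Lemma clamp01 r : 0 <= clamp r <= 1.
Proof. by rewrite /clamp le_min ler01 le_max lexx ge_min lexx. Qed.

Lemma clamp1 r : 1 <= r -> clamp r = 1.
Proof. by move=> r1; rewrite /clamp min_l// le_max r1 orbT. Qed.

Lemma clamp_neq0 r : clamp r != 0 -> 0 < r.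
Proof.
by move=> c0; rewrite ltNge; apply: contra_neqN c0 => r0; rewrite /clamp max_l// min_r.
Qed.

Lemma cont_clamp (f : X -> R) : continuous f -> continuous (fun x => clamp (f x)).
Proof.
by move=> cf; apply: cont_min; [exact: cont_cst|apply: cont_max => //; exact: cont_cst].
Qed.

Variables (a : X -> R) (ca : continuous a).

Definition orbw (x : X) (n : 'rV[int]_k) : R := a (T n x).

Lemma cont_cost q n u : continuous (fun x => cost (scale q (orbw x)) n u).
Proof.
apply: contD; first exact: cont_cst.
apply: contM; first exact: cont_cst.
exact: (cont_precomp (act_cont Ta (n := n)) ca).
Qed.

Lemma cost_orbw q x n m v :
  cost (scale q (orbw (T v x))) n m = cost (scale q (orbw x)) (n + v) (m + v).
Proof. by rewrite /cost /scale /orbw (actD Ta) opprD addrACA subrr addr0. Qed.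

(* A continuous cutoff: 1 when the origin is deep in the cell of the site n for
   the rescaled weights, 0 when it lies outside that cell. *)
Definition tile q L n x : R :=
  \prod_(m <- box k L | m != n)
    clamp (cost (scale q (orbw x)) m 0 - cost (scale q (orbw x)) n 0).

Lemma cont_tile q L n : continuous (tile q L n).
Proof.
apply: cont_prod => m; apply: cont_clamp; apply: contB; exact: cont_cost.
Qed.

Lemma tile01 q L n x : 0 <= tile q L n x <= 1.
Proof.
rewrite /tile; elim/big_rec: _ => [|m r _ /andP[r0 r1]]; first by rewrite ler01 lexx.
have /andP[c0 c1] := clamp01 (cost (scale q (orbw x)) m 0 - cost (scale q (orbw x)) n 0).
by rewrite mulr_ge0//= mulr_ile1.
Qed.

Lemma tile_neq0 q L n x : tile q L n x != 0 ->
  forall m, m \in box k L -> m != n -> cost (scale q (orbw x)) n 0 < cost (scale q (orbw x)) m 0.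
Proof.
move=> t0 m mb mn; rewrite -subr_gt0; apply: clamp_neq0; apply: contra_neq t0 => c0.
by rewrite /tile (big_rem m)//= mn c0 mul0r.
Qed.

Lemma tile_beats q L n x : beats (scale q (orbw x)) 1 n 0 -> tile q L n x = 1.
Proof.
move=> b; rewrite /tile big1// => m mn; apply: clamp1.
have := b m mn; have := @n1_ge1 R _ (m - n); rewrite subr_eq0 => /(_ mn).
by rewrite mul1r; lra.
Qed.

(** Two tile functions nonzero at one point would give opposite strict inequalities between two
    costs. So at each point [g] lies between [f] and a single [Psi n], and both continuity and
    closeness survive. *)
Lemma glue_tiles q L (f : X -> R) (Psi : 'rV[int]_k -> X -> R) (eta : R) :
  0 <= eta -> continuous f -> (forall n, continuous (Psi n)) ->
  (forall n x, n \in box k L -> `|Psi n x - f x| <= eta) ->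
  exists g : X -> R, [/\ continuous g, forall x, `|g x - f x| <= eta &
    forall n x, n \in box k L -> beats (scale q (orbw x)) 1 n 0 -> g x = Psi n x].
Proof.
move=> eta0 cf cPsi close.
pose g x := f x + \sum_(n <- box k L) tile q L n x * (Psi n x - f x).
have one n x : n \in box k L -> tile q L n x != 0 ->
    \sum_(n <- box k L) tile q L n x * (Psi n x - f x) = tile q L n x * (Psi n x - f x).
  move=> nL tn; rewrite (big_rem n)//= big_seq big1 ?addr0// => m.
  rewrite mem_rem_uniq ?grid_uniq// !inE => /andP[mn mL].
  have [->|tm] := eqVneq (tile q L m x) 0; first by rewrite mul0r.
  have := tile_neq0 tn mL mn; have := tile_neq0 tm nL (contra_neq esym mn).
  by move=> h1 h2; have := lt_trans h1 h2; rewrite ltxx.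
exists g; split.
- apply: contD => //; apply: cont_sum => n; apply: contM; first exact: cont_tile.
  exact: contB.
- move=> x; rewrite /g addrC addKr.
  have [/hasP[n nL tn]|/hasPn h] := boolP (has (fun n => tile q L n x != 0) (box k L)).
    rewrite (one n)// normrM (le_trans _ (close n x nL))// ler_piMl//.
    by have /andP[t0 t1] := tile01 q L n x; rewrite ger0_norm.
  rewrite big_seq big1 ?normr0// => n /h; rewrite negbK => /eqP->.
  by rewrite mul0r.
- move=> n x nL /(tile_beats L) t1; rewrite /g (one n)// ?t1 ?oner_neq0// mul1r.
  by rewrite addrC subrK.
Qed.

End Tiling.

(** * Generic linear codes *)

Section ShiftCode.
Variables (R : realFieldType) (k N m : nat) (C : eqType).
Local Notation vec := 'rV[int]_k.
Local Notation row := (vec * nat)%type.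
Implicit Types (s u r : vec).

(** Columns [inl] are the coordinates of the first point, columns [inr] those of the second point
    read at a position shifted by [s]. A variable may occur in both halves, in rows that differ by
    [s]. *)
Definition shift_pattern s (ri : row) (c : C + C) : option (C * row) :=
  match c with
  | inl e => Some (e, ri)
  | inr e => Some (e, (ri.1 + s, ri.2))
  end.

(** The rows increase in the direction of [s]. The variable at the pivot [(r, inl c)] recurs only
    under [inr c] in row [r - s], whose key is smaller, so it is absent from the remaining rows.
    Once the columns [inl] are used up, no variable is repeated. *)
Lemma fresh_shift s (cx cy : seq C) (rows : seq row) (key : row -> int) :
  uniq cx -> uniq cy -> uniq rows -> size rows = (size cx + size cy)%N ->
  (forall ri, key (ri.1 - s, ri.2) < key ri) ->
  sorted (fun a b => key a <= key b) rows ->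
  fresh (shift_pattern s) (zip rows (map inl cx ++ map inr cy)).
Proof.
move=> + ucy + + keys; elim: cx rows => [|c cx IH] rows ucx urows /= szr srt.
  have sz : size rows = size [seq (inr c : C + C) | c <- cy] by rewrite size_map szr add0n.
  apply: fresh_distinct; rewrite ?unzip1_zip ?unzip2_zip ?sz//.
  - by rewrite map_inj_uniq// => a b [].
  - move=> r c /(map_f snd); rewrite -/(unzip2 _) unzip2_zip ?sz// => /mapP[e _ /= ->].
    by exists (e, (r.1 + s, r.2)).
  move=> [r i] _ [r' i'] _ w /mapP[e _ ->] /mapP[e' _ ->] /= <- [<-].
  by move=> /addIr -> ->.
case: rows urows szr srt => [|r rows]//= /andP[rr urows] [szr] srt.
move: ucx => /= /andP[cc ucx].
have sz : size rows = size (map inl cx ++ map inr cy).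
  by rewrite size_cat !size_map.
have IHr := IH _ ucx urows szr (path_sorted srt).
split=> //; rewrite ?unzip1_zip ?unzip2_zip ?sz//.
  rewrite mem_cat negb_or; apply/andP; split; apply/negP => /mapP[e ein] //.
  by move=> [ce]; rewrite ce ein in cc.
exists (c, r) => // r' c' r'in; rewrite in_cons mem_cat => /orP[/eqP->|/orP[]].
- by move=> [->].
- by move=> /mapP[e _ ->] [-> ->].
move=> /mapP[e _ ->] [_ rE]; exfalso.
have r'E : r' = (r.1 - s, r.2) by rewrite -rE /= addrK; case: (r').
have lt := keys r; rewrite -r'E in lt.
move: r'in; rewrite in_cons => /orP[/eqP e'|r'in]; first by rewrite e' ltxx in lt.
have := order_path_min (fun b a c => @le_trans _ _ (key b) (key a) (key c)) srt.
by move=> /allP /(_ _ r'in); rewrite leNgt lt.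
Qed.

Lemma nonsing_zip (Var Row Col : eqType) (phi : Row -> Col -> option Var) x
   (rows : seq Row) (cols : seq Col) (xi : Col -> R) :
  size rows = size cols -> nonsing phi x (zip rows cols) ->
  (forall ri, ri \in rows -> \sum_(c <- cols) xi c * pval x (phi ri c) = 0) ->
  forall c, c \in cols -> xi c = 0.
Proof.
move=> sz ns h c cc; have := ns xi; rewrite unzip1_zip ?unzip2_zip ?sz// => H.
exact: H.
Qed.

(** When the offset is at most half the side, the two cubes share a cube of side [uphalf N], whose
    rows must outnumber the unknowns of both points. The second clause is for aligned cubes, where
    both points use the same variables and only differences can be determined. *)
Lemma generic_shift_code (cols : seq C) (x0 : C * row -> R) (eps : R) : 0 < eps ->
  exists x : C * row -> R, [/\ forall w, `|x w - x0 w| <= eps,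
   (forall (xi zeta : C -> R) (cx cy : seq C) s, uniq cx -> uniq cy ->
      {subset cx <= cols} -> {subset cy <= cols} ->
      (size cx + size cy <= (uphalf N) ^ k * m)%N -> s != 0 ->
      (forall i, ((absz (s 0%R i)).*2 <= N)%N) ->
      (forall r i, r \in grid 0 N -> r + s \in grid 0 N -> (i < m)%N ->
        \sum_(c <- cx) xi c * x (c, (r, i)) = \sum_(c <- cy) zeta c * x (c, (r + s, i))) ->
      forall c, c \in cx -> xi c = 0) &
   (forall (xi : C -> R) (cx : seq C), uniq cx -> {subset cx <= cols} ->
      (size cx <= N ^ k * m)%N ->
      (forall r i, r \in grid 0 N -> (i < m)%N -> \sum_(c <- cx) xi c * x (c, (r, i)) = 0) ->
      forall c, c \in cx -> xi c = 0)].
Proof.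
move=> e0.
have [x xx0 xns] := general_position shift_pattern (box k N)
  [seq (r, i) | r <- grid 0 N, i <- iota 0 m] (map inl cols ++ map inr cols) x0 e0.
have subcols (cx cy : seq C) : {subset cx <= cols} -> {subset cy <= cols} ->
    {subset map inl cx ++ map inr cy <= map inl cols ++ map inr cols}.
  move=> sx sy c; rewrite !mem_cat => /orP[] /mapP[e ein ->]; apply/orP; [left|right].
    by apply/map_f/sx.
  by apply/map_f/sy.
exists x; split=> //.
- move=> xi zeta cx cy s ucx ucy scx scy szc s0 sN eqn c cin.
  have [j sj] : exists j, s 0%R j != 0.
    apply/existsP; apply: contraNT s0 => /existsPn s0.
    by apply/eqP/rowP => i; rewrite mxE; have := s0 i; rewrite negbK => /eqP.
  (* The sign of [s 0 j] makes the key grow by the absolute value of that entry under translation by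
     [s]. *)
  pose key (ri : row) := sgz (s 0%R j) * ri.1 0%R j.
  have keys (ri : row) : key (ri.1 - s, ri.2) < key ri.
    rewrite /key /= !mxE mulrBr ltrBlDr ltrDl -abszEsg.
    by move: sj; lia.
  (* The smallest corner with both [b] and [b + s] nonnegative. *)
  pose b : vec := \row_i Num.max 0 (- s 0%R i).
  pose rows0 := [seq (r, i) | r <- grid b (uphalf N), i <- iota 0 m].
  pose rows1 := sort (fun a b => key a <= key b) rows0.
  pose rows := take (size cx + size cy) rows1.
  have sr0 : size rows0 = ((uphalf N) ^ k * m)%N by rewrite size_allpairs size_grid size_iota.
  have ur0 : uniq rows0.
    by apply: allpairs_uniq; [exact: grid_uniq|exact: iota_uniq|move=> [? ?] [? ?] _ _ []-> ->].
  have szr : size rows = (size cx + size cy)%N by rewrite size_takel// size_sort sr0.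
  have inrows ri : ri \in rows -> [/\ ri.1 \in grid 0 N, ri.1 + s \in grid 0 N & (ri.2 < m)%N].
    move=> /mem_take; rewrite mem_sort => /allpairsP[[r i] /= [rb im ->]] /=.
    move: im; rewrite mem_iota add0n => /= im; split => //.
      move: rb; rewrite !mem_grid => /forallP rb; apply/forallP => l.
      have := rb l; have := sN l; rewrite !mxE add0r; move: (r _ l) (s _ l) => a' s' ; lia.
    move: rb; rewrite !mem_grid => /forallP rb; apply/forallP => l.
    have := rb l; have := sN l; rewrite !mxE add0r; move: (r _ l) (s _ l) => a' s' ; lia.
  have fr : fresh (shift_pattern s) (zip rows (map inl cx ++ map inr cy)).
    apply: (fresh_shift ucx ucy _ szr keys); first by rewrite take_uniq// sort_uniq.
    apply: take_sorted; apply: sort_sorted => p q; exact: le_total.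
  have szz : size rows = size (map inl cx ++ map inr cy : seq (C + C)) by rewrite szr size_cat !size_map.
  have ns : nonsing (shift_pattern s) x (zip rows (map inl cx ++ map inr cy)).
    apply: xns => //.
    - apply: mem_In; rewrite mem_box; apply/inboxP => i; have := sN i; lia.
    - rewrite unzip1_zip ?szz// => -[r i] /inrows[/= rN _ im].
      by apply: allpairs_f => //; rewrite mem_iota.
    - by rewrite unzip2_zip ?szz//; exact: subcols.
  have := @nonsing_zip _ _ _ _ _ _ _ (fun c => match c with inl e => xi e | inr e => - zeta e end) szz ns.
  move=> /(_ _ (inl c)); apply; last by rewrite mem_cat map_f.
  move=> [r i] /inrows[/= rN rsN im]; rewrite big_cat !big_map /= eqn//.
  rewrite -big_split big1_seq //= => e _; first by rewrite mulNr addrN.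
- move=> xi cx ucx scx szc eqn c cin.
  pose rows := take (size cx) [seq (r, i) | r <- grid (0 : vec) N, i <- iota 0 m].
  have szr : size rows = size (map inl cx : seq (C + C)).
    by rewrite size_takel ?size_map// size_allpairs size_grid size_iota.
  have inrows ri : ri \in rows -> ri.1 \in grid 0 N /\ (ri.2 < m)%N.
    by move=> /mem_take/allpairsP[[r i] /= [rb im ->]] /=; rewrite mem_iota add0n in im.
  have ns : nonsing (shift_pattern 0) x (zip rows (map inl cx)).
    apply: xns => //.
    - by apply: mem_In; rewrite mem_box; apply/inboxP => i; rewrite mxE.
    - apply: fresh_distinct; rewrite ?unzip1_zip ?unzip2_zip ?szr//.
      + apply: take_uniq; apply: allpairs_uniq; [exact: grid_uniq|exact: iota_uniq|].
        by move=> [? ?] [? ?] _ _ []-> ->.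
      + by rewrite map_inj_uniq// => ? ? [].
      + move=> r c' /(map_f snd); rewrite -/(unzip2 _) unzip2_zip ?szr// => /mapP[e _ /= ->].
        by exists (e, r).
      + by move=> r _ r' _ w /mapP[e _ ->] /mapP[e' _ ->] [<-] [-> ->].
    - rewrite unzip1_zip ?szr// => -[r i] /inrows[/= rN im].
      by apply: allpairs_f => //; rewrite mem_iota.
    - rewrite unzip2_zip ?szr// => c' /mapP[e ein ->]; rewrite mem_cat map_f//; exact: scx.
  have := @nonsing_zip _ _ _ _ _ _ _ (fun c => match c with inl e => xi e | inr e => 0 end) szr ns.
  move=> /(_ _ (inl c)); apply; last by rewrite map_f.
  by move=> [r i] /inrows[/= rN im]; rewrite big_map /= eqn.
Qed.

End ShiftCode.

(** * Codes for a whole tile *)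

Section TileCode.
Variables (R : realFieldType) (k N m : nat) (E : eqType).
Local Notation vec := 'rV[int]_k.
Local Notation row := (vec * nat)%type.
Local Notation cell := (vec * E)%type.

(** Local columns [inl] enter only the rows of their own cube and will keep the function close to
    the given one. Hidden columns [inr] enter every row and will carry the contents of the whole
    cell. *)
Definition tile_pattern (ri : row) (c : cell + cell) : option ((cell + cell) * row) :=
  match c with
  | inl je => if cdiv N ri.1 == je.1 then Some (inl je, ri) else None
  | inr je => Some (inr je, ri)
  end.

Lemma tile_pattern_inj ri c ri' c' w :
  tile_pattern ri c = Some w -> tile_pattern ri' c' = Some w -> ri = ri' /\ c = c'.
Proof.
case: c => [je|je]; case: c' => [je'|je'] /=.
- by case: eqP => // _; case: eqP => // _ [<-] [-> ->].
- by case: eqP => // _ [<-].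
- by case: eqP => // _ [<-].
- by move=> [<-] [-> ->].
Qed.

Definition cube_rows (j : vec) : seq row :=
  [seq (j *+ N + r, i) | r <- grid 0 N, i <- iota 0 m].

Lemma mem_cube_rows j ri : ri \in cube_rows j -> cdiv N ri.1 = j /\
  exists r, [/\ r \in grid 0 N, (ri.2 < m)%N & ri.1 = j *+ N + r].
Proof.
case/allpairsP => -[r i] /= [rN im ->] /=; have [-> _] := cdiv_unique j rN.
by split=> //; exists r; rewrite mem_iota in im.
Qed.

Lemma size_cube_rows j : size (cube_rows j) = (N ^ k * m)%N.
Proof. by rewrite size_allpairs size_grid size_iota. Qed.

Lemma uniq_cube_rows j : uniq (cube_rows j).
Proof.
apply: allpairs_uniq; [exact: grid_uniq|exact: iota_uniq|].
by move=> [? ?] [? ?] _ _ [] /addrI -> ->.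
Qed.

Lemma uniq_flatten_cube_rows B : uniq B -> uniq (flatten [seq cube_rows j | j <- B]).
Proof.
elim: B => //= j B IH /andP[jB uB]; rewrite cat_uniq uniq_cube_rows IH// andbT.
apply/hasPn => ri /flattenP[s /mapP[j' j'B ->] /mem_cube_rows[e _]].
by apply/negP => /mem_cube_rows[e' _]; rewrite -e' e j'B in jB.
Qed.

Section Layout.
Variables (B J : seq vec) (supp : vec -> seq E) (P : nat).
Hypotheses (uB : uniq B) (uJ : uniq J) (us : forall j, uniq (supp j))
  (sP : forall j, (size (supp j) <= P)%N)
  (count : (P * size J + P * size B <= N ^ k * m * size B)%N).

(** Each cube of [B] spends as many rows as it has local unknowns; the rows left over in all cubes
    are pooled for the hidden unknowns. *)
Let hcols : seq (cell + cell) := [seq inr (j, e) | j <- J, e <- supp j].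
Let dcols : seq (cell + cell) := [seq inl (j, e) | j <- B, e <- supp j].
Let drows := flatten [seq take (size (supp j)) (cube_rows j) | j <- B].
Let left := flatten [seq drop (size (supp j)) (cube_rows j) | j <- B].
Let hrows := take (size hcols) left.

Lemma supp_fits j : j \in B -> (size (supp j) <= N ^ k * m)%N.
Proof.
move=> jB; have B0 : (0 < size B)%N by case: (B) jB.
by apply: leq_trans (sP j) _; rewrite -(leq_pmul2r B0); lia.
Qed.

Lemma size_hcols : (size hcols <= P * size J)%N.
Proof.
rewrite size_allpairs_dep; elim: (J) => [|j s IH] /=; first by rewrite muln0.
by rewrite mulnS leq_add.
Qed.

Lemma size_left : (P * size J <= size left)%N.
Proof.
suff : (N ^ k * m * size B <= size left + P * size B)%N by move: count; lia.
rewrite /left; have := supp_fits; elim: (B) => [|j s IH] /= fits; first by rewrite !muln0.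
rewrite !mulnS size_cat size_drop size_cube_rows.
have := IH (fun j' j's => fits j' (mem_behead (s := j :: s) j's)).
by have := sP j; have := fits j (mem_head _ _); lia.
Qed.

Lemma size_hrows : size hrows = size hcols.
Proof. by rewrite size_takel// (leq_trans size_hcols) ?size_left. Qed.

Lemma size_drows : size drows = size dcols.
Proof.
rewrite size_flatten size_allpairs_dep /shape -map_comp; congr sumn.
by apply/eq_in_map => j jB /=; rewrite size_takel// size_cube_rows supp_fits.
Qed.

Definition layout := zip (drows ++ hrows) (dcols ++ hcols).

Lemma size_layout : size (drows ++ hrows) = size (dcols ++ hcols).
Proof. by rewrite !size_cat size_drows size_hrows. Qed.

Lemma layout_rows ri : ri \in drows ++ hrows ->
  exists2 j, j \in B & ri \in cube_rows j.
Proof.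
rewrite mem_cat => /orP[/flattenP[s /mapP[j jB ->] /mem_take rj]|]; first by exists j.
by move=> /mem_take/flattenP[s /mapP[j jB ->] /mem_drop rj]; exists j.
Qed.

Lemma uniq_layout_rows : uniq (drows ++ hrows).
Proof.
have pe : perm_eq (drows ++ left) (flatten [seq cube_rows j | j <- B]).
  rewrite /drows /left; elim: (B) => //= j s IH.
  have e (Z : seq row) : cube_rows j ++ Z =
      take (size (supp j)) (cube_rows j) ++ (drop (size (supp j)) (cube_rows j) ++ Z).
    by rewrite catA cat_take_drop.
  rewrite e.
  by rewrite -!catA perm_cat2l perm_catCA perm_cat2l.
have : uniq (drows ++ left) by rewrite (perm_uniq pe) uniq_flatten_cube_rows.
apply: subseq_uniq; apply: cat_subseq => //; exact: take_subseq.
Qed.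

Lemma uniq_layout_cols : uniq (dcols ++ hcols).
Proof.
rewrite cat_uniq; apply/and3P; split.
- apply: allpairs_uniq_dep => //.
  by move=> [j e] [j' e'] _ _ /= [-> ->].
- by apply/hasPn => c /allpairsPdep[j [e [_ _ ->]]]; apply/negP => /allpairsPdep[j' [e' [_ _]]].
- apply: allpairs_uniq_dep => //.
  by move=> [j e] [j' e'] _ _ /= [-> ->].
Qed.

Lemma zip_drows ri c : (ri, c) \in zip drows dcols ->
  exists je, c = inl je /\ cdiv N ri.1 = je.1.
Proof.
rewrite /drows /dcols; have := supp_fits; elim: (B) => [|j s IH] //= fits.
rewrite zip_cat ?size_map ?size_takel ?size_cube_rows ?fits ?mem_head//.
rewrite mem_cat => /orP[rc|]; last first.
  by apply: IH => j' j's; apply: fits; rewrite in_cons j's orbT.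
have sz : size (take (size (supp j)) (cube_rows j)) =
    size [seq (inl (j, e) : cell + cell) | e <- supp j].
  by rewrite size_map size_takel// size_cube_rows fits ?mem_head.
have rt : ri \in take (size (supp j)) (cube_rows j).
  by rewrite -(unzip1_zip (eq_leq sz)) (map_f fst rc).
have : c \in [seq (inl (j, e) : cell + cell) | e <- supp j].
  by rewrite -(unzip2_zip (eq_leq (esym sz))) (map_f snd rc).
move=> /mapP[e _ ->]; exists (j, e); split=> //=.
by have [] := mem_cube_rows (mem_take rt).
Qed.

Lemma fresh_layout : fresh tile_pattern layout.
Proof.
apply: fresh_distinct; rewrite ?unzip1_zip ?unzip2_zip ?size_layout//.
- exact: uniq_layout_rows.
- exact: uniq_layout_cols.
- move=> ri c; rewrite /layout zip_cat ?size_drows// mem_cat => /orP[/zip_drows[je [-> e]]|].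
    by exists (inl je, ri) => /=; rewrite e eqxx.
  move=> /(map_f snd); rewrite -/(unzip2 _) unzip2_zip ?size_hrows// => /allpairsPdep[j [e [_ _ /= ->]]].
  by exists (inr (j, e), ri).
- by move=> *; apply: tile_pattern_inj; eauto.
Qed.

Lemma layout_nonsing x (xi zeta : cell -> R) : nonsing tile_pattern x layout ->
  (forall j r i, j \in B -> r \in grid 0 N -> (i < m)%N ->
     let u := j *+ N + r in
     \sum_(e <- supp j) xi (j, e) * x (inl (j, e), (u, i)) +
     \sum_(j' <- J) \sum_(e <- supp j') zeta (j', e) * x (inr (j', e), (u, i)) = 0) ->
  forall j e, j \in J -> e \in supp j -> zeta (j, e) = 0.
Proof.
move=> ns eqn j e jJ ej.
have := nonsing_zip (xi := fun c => match c with inl je => xi je | inr je => zeta je end) size_layout ns.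
move=> /(_ _ (inr (j, e))); apply; last first.
  by rewrite mem_cat; apply/orP; right; apply/allpairsPdep; exists j, e.
move=> [u i] /layout_rows[j' j'B /mem_cube_rows[/= uj' [r [rN im uE]]]].
rewrite -[RHS](eqn j' r i j'B rN im) /= -uE big_cat /= !big_allpairs_dep /=; congr (_ + _).
rewrite (big_rem j')//= uj' eqxx [X in _ + X]big_seq [X in _ + X]big1 ?addr0// => j2.
rewrite mem_rem_uniq// inE => /andP[j2j' _]; rewrite big1// => e' _.
by rewrite eq_sym (negbTE j2j') mulr0.
Qed.

End Layout.

(** One code serves all [B], [J] and supports in finite ranges, since these depend on the points
    compared. Local and hidden unknowns are treated as independent, although they will come from the
    same differences. *)
Lemma generic_tile_code (Js Ls : seq vec) (Es : seq E)
    (x0 : (cell + cell) * row -> R) (eps : R) : 0 < eps ->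
  exists2 x : (cell + cell) * row -> R, (forall w, `|x w - x0 w| <= eps) &
   forall (B J : seq vec) (supp : vec -> seq E) (P : nat) (xi zeta : cell -> R),
     uniq B -> uniq J -> (forall j, uniq (supp j)) -> (forall j, (size (supp j) <= P)%N) ->
     {subset B <= Js} -> {subset J <= Js} -> (forall j, {subset supp j <= Es}) ->
     (forall j r, j \in B -> r \in grid 0 N -> j *+ N + r \in Ls) ->
     (P * size J + P * size B <= N ^ k * m * size B)%N ->
     (forall j r i, j \in B -> r \in grid 0 N -> (i < m)%N ->
       let u := j *+ N + r in
       \sum_(e <- supp j) xi (j, e) * x (inl (j, e), (u, i)) +
       \sum_(j' <- J) \sum_(e <- supp j') zeta (j', e) * x (inr (j', e), (u, i)) = 0) ->
     forall j e, j \in J -> e \in supp j -> zeta (j, e) = 0.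
Proof.
move=> e0; pose cells := [seq (j, e) | j <- Js, e <- Es].
have [x xx0 xns] := general_position (fun _ : unit => tile_pattern) [:: tt]
  [seq (u, i) | u <- Ls, i <- iota 0 m] (map inl cells ++ map inr cells) x0 e0.
exists x => // B J supp P xi zeta uB uJ us sP BJs JJs sE BL cnt eqn.
apply: (layout_nonsing uB uJ sP cnt _ eqn).
have szl := size_layout uB uJ sP cnt.
apply: (xns tt); [by left|exact: fresh_layout cnt|..]; rewrite /layout ?unzip1_zip ?unzip2_zip ?szl//.
  move=> [u i] /layout_rows[j jB /mem_cube_rows[_ [r [rN im /= ->]]]].
  by apply: allpairs_f; rewrite ?mem_iota ?BL.
move=> c; rewrite !mem_cat => /orP[] /allpairsPdep[j [e [jB ej ->]]]; apply/orP; [left|right].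
  by apply/map_f/allpairs_f; [exact: BJs|exact: sE ej].
by apply/map_f/allpairs_f; [exact: JJs|exact: sE ej].
Qed.

End TileCode.

Lemma norm_sum_le (R : realFieldType) (I : Type) (s : seq I) (h : I -> R) (c : R) :
  (forall i, `|h i| <= c) -> `|\sum_(i <- s) h i| <= (size s)%:R * c.
Proof.
move=> hc; elim: s => [|i s IH]; first by rewrite big_nil normr0 mul0r.
by rewrite big_cons -natr1 mulrDl mul1r addrC (le_trans (ler_normD _ _))// lerD.
Qed.

Lemma leq_double_uphalf N : (N <= 2 * uphalf N)%N.
Proof. by lia. Qed.

(** * Perturbing a function into a code *)

Section OrbitWeights.
Variables (R : realType) (X : topologicalType) (k : nat) (T : 'rV[int]_k -> X -> X).
Hypotheses (Ta : Zk_action T).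

Lemma inboxN (L : nat) (u : 'rV[int]_k) : inbox L (- u) = inbox L u.
Proof. by apply/inboxP/inboxP => H i; have := H i; rewrite mxE abszN. Qed.

(** The factor [height] puts every site with [a = 1] exactly at the threshold, so only the separated
    sites with [a < 1] count as low. *)
Lemma orbw_sparse (a : X -> R) L0 N M x :
  (forall x, 0 <= a x <= 1) -> (forall x, exists2 n, inbox L0 n & a (T n x) = 0) ->
  (forall x n, n != 0 -> inbox M n -> a x < 1 -> a (T n x) < 1 -> False) ->
  sparse_weights L0 N M (orbw T (fun x => (height k L0 N)%:R * a x) x).
Proof.
move=> a01 a0 asep; split.
- by move=> n; rewrite /orbw mulr_ge0//; have /andP[] := a01 (T n x).
- move=> u; have [n nL an] := a0 (T u x); exists (n + u).
  rewrite opprD addrCA subrr addr0 inboxN; split=> //.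
  by rewrite /orbw -(actD Ta) an mulr0.
move=> n m nm; rewrite /orbw => wn wm; apply: contrapT => no.
have B0 : (0 < (height k L0 N)%:R :> R).
  by rewrite ltr0n /height /reach; lia.
rewrite -[ltRHS]mulr1 ltr_pM2l// in wn; rewrite -[ltRHS]mulr1 ltr_pM2l// in wm.
apply: (asep (T n x) (m - n)) => //; first by rewrite subr_eq0 eq_sym.
  rewrite -inboxN opprB; apply/inboxP => i; rewrite leqNgt; apply/negP => h.
  by apply: no; exists i; exact: ltnW.
by rewrite (actD Ta) subrK.
Qed.

Lemma beats_orbw (a : X -> R) q x n v :
  beats (scale q (orbw T a x)) 1 n v -> beats (scale q (orbw T a (T v x))) 1 (n - v) 0.
Proof.
move=> b m mn; rewrite !(cost_orbw Ta) subrK add0r.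
have -> : m - (n - v) = (m + v) - n by rewrite opprB addrA.
by apply: b; apply: contra_neq mn => <-; rewrite addrK.
Qed.

End OrbitWeights.

(** * First code: locating the large-scale markers *)

Section Coding.
Variables (R : realType) (X : topologicalType) (d : X -> X -> R) (k : nat)
  (T : 'rV[int]_k -> X -> X).
Hypotheses (cX : compact [set: X]) (dm : compatible_metric d) (Ta : Zk_action T).
Variables (N m P1 : nat) (eps eta : R) (E : finType) (F : E -> X -> R) (f : nat -> X -> R).
Hypotheses (N0 : (0 < N)%N) (eta0 : 0 < eta) (cf : forall i, continuous (f i))
  (fF : fine_partition (dN T d N) eps P1 F)
  (fosc : forall i x y, d x y < eps -> `|f i x - f i y| <= eta).

(** The value of [f] at position [r] for some point in the support of [F e]; its support is small,
    so the choice hardly matters. The default 0 is met only when the support is empty. *)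
Definition sample (e : E) (r : 'rV[int]_k) (i : nat) : R :=
  if pselect (exists y, F e y != 0) is left ex then f i (T r (sval (cid ex))) else 0.

Lemma sample_close (x : E -> R) r i y (del : R) : r \in grid 0 N ->
  (forall e, `|x e - sample e r i| <= del) ->
  `|\sum_e F e y * x e - f i (T r y)| <= eta + del.
Proof.
have [_ F0 F1 _ Fd] := fF => rN xs.
have -> : f i (T r y) = \sum_e F e y * f i (T r y) by rewrite -mulr_suml F1 mul1r.
rewrite -sumrB (le_trans (ler_norm_sum _ _ _))//.
have -> : eta + del = \sum_e F e y * (eta + del) by rewrite -mulr_suml F1 mul1r.
apply: ler_sum => e _; rewrite -mulrBr normrM ger0_norm//.
have [->|Fe] := eqVneq (F e y) 0; first by rewrite !mul0r.
apply: ler_wpM2l => //; have := xs e; rewrite /sample.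
case: pselect => [ex|no]; last by exfalso; apply: no; exists y.
case: cid => y' /= Fy' h.
have : `|f i (T r y') - f i (T r y)| <= eta.
  by apply: fosc; rewrite (le_lt_trans (dN_ge d T y' y rN))// (Fd e).
have := ler_normD (x e - f i (T r y')) (f i (T r y') - f i (T r y)).
rewrite addrA subrK; lra.
Qed.

Section Sync.
Hypotheses (k0 : (0 < k)%N) (cnt : (2 ^ k.+1 * P1.+1 <= m * N ^ k)%N).
Variables (L0 Q : nat) (a a2 : X -> R).
Let q := (4 * k).+1.
Let M := (q * k * (N.*2.+1.*2 + 2))%N.
Let L1 := reach k L0.
Hypotheses (ca : continuous a) (a01 : forall x, 0 <= a x <= 1)
  (a0 : forall x, exists2 n, inbox L0 n & a (T n x) = 0)
  (asep : forall x n, n != 0 -> inbox M n -> a x < 1 -> a (T n x) < 1 -> False).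
Let aw x := (height k L0 N)%:R * a x.
Hypotheses (ca2 : continuous a2) (a201 : forall x, 0 <= a2 x <= 1)
  (a2sep : forall x n, n != 0 -> inbox Q.*2 n -> a2 x < 1 -> a2 (T n x) < 1 -> False)
  (QE : Q = (4 * k * L1.+1.*2 + 1 + L1.+1 + N)%N).

Let C := (E + 'rV[int]_k)%type.
Let cols : seq C := map inl (enum E) ++ map inr (box k Q).

(** [1 - a2] vanishes off the markers, and distinct markers are never within [2Q] of each other; so
    at most one [v] in the box [Q] adds a nonzero coordinate. *)
Definition theta (x : X) (c : C) : R :=
  match c with inl e => F e x | inr v => 1 - a2 (T v x) end.

Lemma cont_theta c : continuous (theta ^~ c).
Proof.
have [cF _ _ _ _] := fF.
case: c => [e|v]; first exact: cF.
apply: contB; first exact: cont_cst.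
exact: (cont_precomp (act_cont Ta (n := v)) ca2).
Qed.

Definition theta_supp (x : X) : seq C := [seq c <- cols | theta x c != 0].

Lemma cols_uniq : uniq cols.
Proof.
have u1 : uniq [seq (inl e : C) | e <- enum E].
  by rewrite map_inj_uniq ?enum_uniq// => ? ? [->].
have u2 : uniq [seq (inr v : C) | v <- box k Q].
  by rewrite map_inj_uniq ?grid_uniq// => ? ? [->].
rewrite cat_uniq u1 u2 andbT; apply/hasPn => c /mapP[v _ ->].
by apply/negP => /mapP[].
Qed.

Lemma size_theta_supp x : (size (theta_supp x) <= P1.+1)%N.
Proof.
have [_ _ _ Fc _] := fF.
rewrite /theta_supp filter_cat size_cat -[P1.+1]addn1 leq_add//.
  rewrite filter_map size_map (leq_trans _ (Fc x))// cardE uniq_leq_size//.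
    by rewrite filter_uniq// enum_uniq.
  by move=> e; rewrite mem_filter !mem_enum !inE /= => /andP[].
rewrite filter_map size_map.
set s := seq.filter _ _.
have sP u v : u \in s -> v \in s -> u = v.
  rewrite !mem_filter /= !mem_box => /andP[hu uQ] /andP[hv vQ].
  apply/eqP; apply: contraT => uv; exfalso.
  have lt1 w : 1 - a2 (T w x) != 0 -> a2 (T w x) < 1.
    move=> h; have /andP[_ w1] := a201 (T w x); rewrite lt_neqAle w1 andbT.
    by apply: contra_neq h => ->; rewrite subrr.
  apply: (a2sep (x := T u x) (n := v - u)); [by rewrite subr_eq0 eq_sym| |exact: lt1|].
    apply/inboxP => i; move/inboxP: uQ => /(_ i); move/inboxP: vQ => /(_ i).
    by rewrite !mxE; move: (u _ i) (v _ i) => b c; lia.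
  by rewrite (actD Ta) subrK; exact: lt1.
have : uniq s by rewrite filter_uniq// grid_uniq.
case: s sP => [|u [|v s]]//= sP /andP[]; rewrite in_cons (sP u v) ?eqxx//.
  exact: mem_head.
by rewrite !in_cons eqxx orbT.
Qed.

Lemma sum_theta_supp x (h : C -> R) :
  \sum_(c <- cols) theta x c * h c = \sum_(c <- theta_supp x) theta x c * h c.
Proof.
rewrite big_filter [RHS]big_mkcond; apply: eq_bigr => c _.
by case: eqP => // ->; rewrite mul0r.
Qed.

Lemma sum_cols (h : C -> R) :
  \sum_(c <- cols) h c = \sum_e h (inl e) + \sum_(v <- box k Q) h (inr v).
Proof. by rewrite big_cat; congr (_ + _); rewrite big_map// big_enum. Qed.

Lemma sync_code : exists g : nat -> X -> R,
  [/\ forall i, continuous (g i), forall i x, `|g i x - f i x| <= 2 * eta &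
   forall x y, (forall n i, (i < m)%N -> g i (T n x) = g i (T n y)) ->
     forall n, a2 (T n x) = a2 (T n y)].
Proof.
have [cF F0 F1 Fc Fd] := fF.
pose x0 (w : C * ('rV[int]_k * nat)) : R :=
  if w.1 is inl e then sample e w.2.1 w.2.2 else 0.
(* The partition part errs by one further [eps1] and the marker part by at most one for each [v] in
   the box; together they make one [eta]. *)
pose eps1 := eta / (size (box k Q)).+1%:R.
have eps10 : 0 < eps1 by rewrite divr_gt0// ltr0n.
have [xx [xx0 xshift xinj]] := @generic_shift_code R k N m C cols x0 _ eps10.
pose code r i z := \sum_(c <- cols) theta z c * xx (c, (r, i)).
have code_close r i z : r \in grid 0 N -> `|code r i z - f i (T r z)| <= 2 * eta.
  move=> rN; rewrite /code sum_cols /=.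
  have h1 := @sample_close (fun e => xx (inl e, (r, i))) r i z eps1 rN (fun e => xx0 (inl e, (r, i))).
  have h2 : `|\sum_(j <- box k Q) (1 - a2 (T j z)) * xx (inr j, (r, i))| <= (size (box k Q))%:R * eps1.
    apply: norm_sum_le => j; rewrite normrM -[leRHS]mul1r ler_pM//.
      have /andP[u0 u1] := a201 (T j z); rewrite ger0_norm; lra.
    by have := xx0 (inr j, (r, i)); rewrite /x0 /= subr0.
  have h3 : eps1 + (size (box k Q))%:R * eps1 = eta.
    by rewrite /eps1 -[X in X + _]mul1r -mulrDl -natr1 addrC mulrC mulfVK// gt_eqF// ltr0n.
  have -> : 2 * eta = (eta + eps1) + (size (box k Q))%:R * eps1 by rewrite -addrA h3; ring.
  by rewrite addrAC (le_trans (ler_normD _ _))// lerD.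
(* Cubes are anchored at the site, and [n] is the position of the site as seen from the point. So
   the point sits at [cmod N (- n)] in its cube, and the corner lies at minus that vector from
   it. *)
pose Psi i n z := code (cmod N (- n)) i (T (- cmod N (- n)) z).
have cPsi i n : continuous (Psi i n).
  apply: (@cont_precomp _ _ (T (- cmod N (- n))) (code (cmod N (- n)) i)); first exact: (act_cont Ta).
  apply: cont_sum => c; apply: contM; last exact: cont_cst.
  exact: cont_theta.
have caw : continuous aw by apply: contM => //; exact: cont_cst.
have eta20 : 0 <= 2 * eta by rewrite mulr_ge0 ?ler0n ?ltW.
have Psi_close i n z : n \in box k L1 -> `|Psi i n z - f i z| <= 2 * eta.
  move=> _; have := @code_close (cmod N (- n)) i (T (- cmod N (- n)) z) (cmod_grid _ N0).
  by rewrite (actD Ta) subrr (act0 Ta).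
have /choice[g gP] : forall i, exists gi : X -> R,
    [/\ continuous gi, forall z, `|gi z - f i z| <= 2 * eta &
     forall n z, n \in box k L1 -> beats (scale q (orbw T aw z)) 1 n 0 -> gi z = Psi i n z].
  move=> i; apply: (glue_tiles Ta caw q eta20 (cf (i := i))); first exact: cPsi.
  by move=> n z; exact: Psi_close.
exists g; split=> [i|i x|x y gxy w]; [by have [] := gP i|by have [_ ->] := gP i|].
have q1 : (1 < q)%N by rewrite /q; lia.
have sx := @orbw_sparse _ _ _ _ Ta a L0 N M x a01 a0 asep.
have sy := @orbw_sparse _ _ _ _ Ta a L0 N M y a01 a0 asep.
have [v vgrid [[nx bx] [ny By]]] := @common_good R k L0 N M q _ _ w (4 * k * L1.+1.*2).+1
  k0 (ltnSn _) (leqnn _) sx sy (leqnSn _) (ltn0Sn _).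
have code_at z nz c j r i : sparse_weights L0 N M (orbw T aw z) ->
    beats (scale q (orbw T aw z)) N.*2.+1 nz v ->
    c - nz = j *+ N -> r \in grid 0 N -> inbox N (c + r - v) -> 
    g i (T (c + r) z) = code r i (T c z).
  move=> sz bz cj rN near.
  have b1 : beats (scale q (orbw T aw z)) 1 nz (c + r).
    have := beats_move near (_ : beats _ (N.*2 + 1) nz v).
    by rewrite addn1 addrCA subrr addr0; apply.
  have inb : nz - (c + r) \in box k L1.
    have H := beats_inbox k0 q1 (leqnn _) sz b1.
    by rewrite mem_box -inboxN opprB; exact: H.
  have [_ _ gE] := gP i; rewrite (gE _ _ inb); last exact: beats_orbw.
  rewrite /Psi; have -> : - (nz - (c + r)) = j *+ N + r by rewrite opprB -cj addrAC.
  have [_ ->] := cdiv_unique j rN.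
  by rewrite (actD Ta) addrCA addNr addr0.
have [r0 r0E] : exists r0, r0 = cmod N (v - nx) by exists (cmod N (v - nx)).
have r0N : r0 \in grid 0 N by rewrite r0E; exact: cmod_grid.
(* The corner of the cube containing [v] in the lattice anchored at the site [nx]. *)
pose c1 := v - r0.
have c1x : c1 - nx = cdiv N (v - nx) *+ N.
  by rewrite /c1 addrAC {1}(cdiv_eq N (v - nx)) -r0E addrK.
have [t tE] : exists t, t = cmod N (c1 - ny) by exists (cmod N (c1 - ny)).
have tN : t \in grid 0 N by rewrite tE; exact: cmod_grid.
(* Rounding to the nearest cube anchored at [ny], instead of the one below, keeps the offset at most
   half of [N] in every coordinate. *)
pose e : 'rV[int]_k := \row_i ((N < (absz (t 0%R i)).*2)%N : nat)%:Z.
pose s := t - e *+ N.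
have sE i : s 0 i = t 0 i - ((N < (absz (t 0%R i)).*2)%N : nat)%:Z * N%:Z.
  by rewrite mxE mxE mulmxnE mxE -mulr_natr natz.
pose c2 := c1 - s.
have c2y : c2 - ny = (cdiv N (c1 - ny) + e) *+ N.
  rewrite /c2 addrAC {1}(cdiv_eq N (c1 - ny)) -tE /s opprB mulrnDl.
  by rewrite addrA -[_ + t + _]addrA [t + _]addrC addrA addrK.
have sN i : ((absz (s 0%R i)).*2 <= N)%N.
  rewrite sE; move: tN; rewrite mem_grid => /forallP/(_ i); rewrite !mxE add0r.
  by move: (t 0 i) => a'; case: ltnP => /=; lia.
have eqn r i : r \in grid 0 N -> r + s \in grid 0 N -> (i < m)%N ->
    code r i (T c1 x) = code (r + s) i (T c2 y).
  move=> rN rsN im.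
  have near : inbox N (c1 + r - v).
    rewrite /c1 addrAC [v - r0]addrC addrK; apply/inboxP => l.
    move: rN r0N; rewrite !mem_grid => /forallP/(_ l) + /forallP/(_ l).
    by rewrite !mxE; move: (r _ l) (r0 _ l) => ? ?; lia.
  have c12 : c2 + (r + s) = c1 + r by rewrite /c2 addrACA addNr addr0.
  rewrite -(code_at _ _ _ _ _ _ sx bx c1x rN near) -(code_at _ _ _ _ _ _ sy By c2y rsN) ?c12//.
  exact: gxy.
(* [Q] adds up the window in which a common deep point exists, its enlargement by [L1 + 1], and the
   side [N] of the cube. *)
have wc : inbox Q (w - c1).
  move: vgrid r0N; rewrite /c1 !mem_grid => /forallP vg /forallP rg; apply/inboxP => l.
  have := vg l; have := rg l; rewrite QE !mxE.
  by move: (v _ l) (w _ l) (r0 _ l) => ? ? ?; lia.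
have uP z : uniq (theta_supp z) by rewrite filter_uniq// cols_uniq.
have subP z : {subset theta_supp z <= cols} by move=> c; rewrite mem_filter => /andP[].
have cols_wc : inr (w - c1) \in cols.
  by rewrite mem_cat; apply/orP; right; apply: map_f; rewrite mem_box.
have P2 : (2 * P1.+1 <= m * N ^ k)%N.
  by apply: leq_trans cnt; rewrite leq_mul2r expnS -{1}[2%N]muln1 leq_mul2l expn_gt0 orbT.
(* A nonzero offset would force all coordinates of [T c1 x] to vanish, whereas the functions [F e]
   sum to 1. *)
have [s0|s0] := eqVneq s 0; last first.
  exfalso.
  have [e0 Fe0] : exists e0, F e0 (T c1 x) != 0.
    apply/existsP; apply: contraT => /existsPn h.
    have := F1 (T c1 x); rewrite big1 => [/eqP|e0 _]; first by rewrite eq_sym oner_eq0.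
    by apply/eqP; rewrite -[_ == _]negbK h.
  have /negP := Fe0; apply; apply/eqP.
  apply: (xshift (theta (T c1 x)) (theta (T c2 y)) (theta_supp (T c1 x)) (theta_supp (T c2 y)) s
    (uP _) (uP _) (subP _) (subP _) _ s0 sN _ (inl e0)).
  - apply: (@leq_trans (2 * P1.+1)).
      by rewrite mul2n -addnn leq_add// size_theta_supp.
    have : (2 ^ k * (2 * P1.+1) <= 2 ^ k * (uphalf N ^ k * m))%N.
      rewrite mulnA -expnSr (leq_trans cnt)// mulnA -expnMn mulnC leq_mul2r leq_exp2r//.
      by rewrite leq_double_uphalf orbT.
    by rewrite leq_pmul2l// expn_gt0.
  - move=> r i rN rsN im; rewrite -!sum_theta_supp; exact: eqn.
  by rewrite mem_filter Fe0 mem_cat map_f// mem_enum.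
have c21 : c2 = c1 by rewrite /c2 s0 subr0.
(* With aligned cubes the unknowns are the differences of the coordinates, supported on the union of
   the two supports. *)
pose cz := [seq c <- cols | (theta (T c1 x) c != 0) || (theta (T c1 y) c != 0)].
have zero c : c \in cz -> theta (T c1 x) c - theta (T c1 y) c = 0.
  apply: (xinj (fun c => theta (T c1 x) c - theta (T c1 y) c) cz).
  - by rewrite filter_uniq// cols_uniq.
  - by move=> c'; rewrite mem_filter => /andP[].
  - apply: (@leq_trans (2 * P1.+1)); last by rewrite [leqRHS]mulnC.
    apply: (@leq_trans (size (theta_supp (T c1 x)) + size (theta_supp (T c1 y)))).
      rewrite !size_filter.
      by rewrite -(count_predUI (fun c => theta (T c1 x) c != 0) (fun c => theta (T c1 y) c != 0)) leq_addr.
    by rewrite mul2n -addnn leq_add// size_theta_supp.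
  move=> r i rN im; rewrite big_filter big_mkcond.
  have := eqn r i rN; rewrite s0 addr0 c21 => /(_ rN im)/eqP; rewrite -subr_eq0 => /eqP h; rewrite -[RHS]h.
  rewrite /code -sumrB; apply: eq_bigr => c' _; rewrite -mulrBl.
  by case: ifP => // /negbT; rewrite negb_or !negbK => /andP[/eqP-> /eqP->]; rewrite subrr mul0r.
have : theta (T c1 x) (inr (w - c1)) = theta (T c1 y) (inr (w - c1)).
  have [cin|] := boolP (inr (w - c1) \in cz); first by apply/eqP; rewrite -subr_eq0; apply/eqP/zero.
  by rewrite mem_filter cols_wc andbT negb_or !negbK => /andP[/eqP-> /eqP->].
by rewrite /= !(actD Ta) !subrK => /(addrI 1)/oppr_inj.
Qed.
End Sync.
End Coding.

Lemma cdiv_inbox k N L (u : 'rV[int]_k) : (0 < N)%N -> inbox L u -> inbox L (cdiv N u).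
Proof.
move=> N0 /inboxP uL; apply/inboxP => i; have := uL i; rewrite mxE.
move: (u 0 i) => a; have := divz_eq a N.
have := ltz_pmod a (_ : 0 < N%:Z); have := modz_ge0 a (_ : N%:Z != 0).
set b := divz _ _; set r := modz _ _; clearbody b r.
move=> /(_ ltac:(lia)) r0 /(_ ltac:(lia)) rq e aL.
by nia.
Qed.

Lemma zero_grid k N : (0 < N)%N -> (0 : 'rV[int]_k) \in grid 0 N.
Proof. by move=> N0; rewrite mem_grid; apply/forallP => l; rewrite mxE; lia. Qed.

(** * Second code: decoding the tile of the origin *)

Section Decode.
Variables (R : realType) (X : topologicalType) (d : X -> X -> R) (k : nat)
  (T : 'rV[int]_k -> X -> X).
Hypotheses (dm : compatible_metric d) (Ta : Zk_action T).
Variables (N m P1 : nat) (eps eta : R) (E : finType) (F : E -> X -> R) (f : nat -> X -> R).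
Hypotheses (N0 : (0 < N)%N) (eta0 : 0 < eta) (cf : forall i, continuous (f i))
  (fF : fine_partition (dN T d N) eps P1 F)
  (fosc : forall i x y, d x y < eps -> `|f i x - f i y| <= eta).
Hypotheses (k0 : (0 < k)%N) (cnt : (4 * P1.+1 <= m * N ^ k)%N).
Variables (L0 : nat) (a : X -> R).
(** Chosen so that the loss [k/q] costs less than the surplus in [4 * P1.+1]: it yields
    [P1 * size J <= P1.+2 * size B] in [deep_cubes]. *)
Let q := (4 * k * P1.+1).+1.
Let M := (q * k * (N.*2.+1.*2 + 2))%N.
Let L1 := reach k L0.
Hypotheses (ca : continuous a) (a01 : forall x, 0 <= a x <= 1)
  (a0 : forall x, exists2 n, inbox L0 n & a (T n x) = 0)
  (asep : forall x n, n != 0 -> inbox M n -> a x < 1 -> a (T n x) < 1 -> False).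
Let aw x := (height k L0 N)%:R * a x.

Definition near_cell u z : R :=
  \prod_(n <- box k L1.*2) clamp (1 + (cost (orbw T aw z) n u - cost (orbw T aw z) 0 u)).

(** A continuous indicator of the cubes that meet a slight enlargement of the unscaled cell of the
    site 0: [near_cell] is 1 where this site has least cost and 0 once a tested site is cheaper by
    1. It multiplies the hidden coordinates, so that cubes outside the cell contribute no
    unknowns. *)
Definition alpha (j : 'rV[int]_k) z : R := \sum_(u <- box k L1 | cdiv N u == j) near_cell u z.

Lemma near_cell01 u z : 0 <= near_cell u z <= 1.
Proof.
rewrite /near_cell; elim/big_rec: _ => [|n r _ /andP[r0 r1]]; first by rewrite ler01 lexx.
have /andP[c0 c1] := clamp01 (1 + (cost (orbw T aw z) n u - cost (orbw T aw z) 0 u)).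
by rewrite mulr_ge0//= mulr_ile1.
Qed.

Lemma caw : continuous aw.
Proof. by apply: contM => //; exact: cont_cst. Qed.

Lemma cont_alpha j : continuous (alpha j).
Proof.
have cc n u : continuous (fun z => cost (orbw T aw z) n u).
  apply: contD; first exact: cont_cst.
  exact: (cont_precomp (act_cont Ta (n := n)) caw).
apply: cont_sum => u; apply: cont_prod => n; apply: cont_clamp.
by apply: contD; [exact: cont_cst|apply: contB].
Qed.

Lemma alpha_le j z : `|alpha j z| <= (size (box k L1))%:R.
Proof.
rewrite -[leRHS]mulr1 /alpha big_mkcond; apply: norm_sum_le => u.
case: ifP => _; last by rewrite normr0 ler01.
by have /andP[c0 c1] := near_cell01 u z; rewrite ger0_norm.
Qed.

Lemma alpha_neq0 j z : alpha j z != 0 -> exists u, [/\ inbox L1 u, cdiv N u = j &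
  forall n, inbox L1.*2 n -> cost (orbw T aw z) 0 u <= cost (orbw T aw z) n u + 1].
Proof.
move=> al0.
have [u [uL uj nz]] : exists u, [/\ u \in box k L1, cdiv N u = j & near_cell u z != 0].
  apply: contrapT => no; have /negP := al0; apply; apply/eqP.
  rewrite /alpha big_seq_cond big1// => u /andP[uL /eqP uj].
  by apply/eqP; apply: contrapT => /negP nz; apply: no; exists u.
exists u; split=> // [|n nL]; first by rewrite -mem_box.
have : clamp (1 + (cost (orbw T aw z) n u - cost (orbw T aw z) 0 u)) != 0.
  apply: contra_neq nz => c0; rewrite /near_cell (big_rem n) ?mem_box//=.
  by rewrite c0 mul0r.
by move/clamp_neq0; move: (cost _ _ _) (cost _ _ _) => b c; lra.
Qed.

Lemma alpha_exact u z : inbox L1 u ->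
  (forall n, cost (orbw T aw z) 0 u <= cost (orbw T aw z) n u) -> alpha (cdiv N u) z != 0.
Proof.
move=> uL umin; rewrite gt_eqF// /alpha (big_rem u) ?mem_box//= eqxx.
rewrite ltr_pwDl//; last by apply: sumr_ge0 => v _; have /andP[] := near_cell01 v z.
rewrite (_ : near_cell u z = 1) ?ltr01// /near_cell big1// => n _; apply: clamp1.
by rewrite lerDl subr_ge0.
Qed.

(** All points of the cubes in [J] are moved by [rho]. Their images win by the margin [2N + 1], so
    the whole cube around an image lies in the scaled cell; [B] consists of these cubes. Since [rho]
    is injective off a proportion [k/q], [B] has nearly as many cubes as [J]. *)
Lemma deep_cubes z : let J := [seq j <- box k L1 | alpha j z != 0] in
  exists B : seq 'rV[int]_k, [/\ uniq B,
    (2 * P1 * size J + 2 * P1 * size B <= N ^ k * m * size B)%N &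
    forall j r, j \in B -> r \in grid 0 N ->
      [/\ j \in box k L1, j *+ N + r \in box k L1 &
       beats (scale q (orbw T aw z)) 1 0 (j *+ N + r)]].
Proof.
move=> J; have q1 : (1 < q)%N by rewrite /q ltnS !muln_gt0 k0.
have q0 : (0 < q)%N by [].
have sw := @orbw_sparse _ _ _ _ Ta a L0 N M z a01 a0 asep.
pose A := [seq j *+ N + r | j <- J, r <- grid (0 : 'rV[int]_k) N].
have uA : uniq A.
  apply: allpairs_uniq; [by rewrite filter_uniq// grid_uniq|exact: grid_uniq|].
  move=> [j r] [j' r'] /allpairsP[[? ?] /= [_ rN [_ ->]]] /allpairsP[[? ?] /= [_ rN' [_ ->]]] /= e.
  have [h1 h2] := cdiv_unique j rN; have [h3 h4] := cdiv_unique j' rN'.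
  by congr (_, _); [rewrite -h1 e h3|rewrite -h2 e h4].
have szA : size A = (size J * N ^ k)%N by rewrite size_allpairs size_grid.
have [s sq Hs] := exists_shift A id q0.
pose A' := [seq u <- A | nocol q s u].
pose B0 := [seq rho q s u | u <- A'].
have uB0 : uniq B0.
  rewrite map_inj_in_uniq ?filter_uniq// => u v; rewrite !mem_filter => /andP[nu _] /andP[nv _].
  exact: rho_inj.
have deep b : b \in B0 -> beats (scale q (orbw T aw z)) N.*2.+1 0 b.
  move=> /mapP[u']; rewrite mem_filter => /andP[_ /allpairsP[[j r] /= [jJ rN uE]]] ->.
  move: jJ; rewrite mem_filter => /andP[/alpha_neq0[u [uL uj near]] _].
  have [||w0 near'] := @soft_minimizer R k L0 N M q (orbw T aw z) k0 q1 (leqnn _) sw 0 u.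
  - by rewrite subr0.
  - by move=> n; rewrite subr0; exact: near.
  have -> : rho q s u' = 0 + rho q s (u + (u' - u) - 0) by rewrite add0r subr0 addrC subrK.
  apply: (@beats_deep R k L0 N M q (orbw T aw z) k0 q1 (leqnn _) sw s 0 u (u' - u) sq _ w0 _ near').
    by rewrite subr0.
  rewrite uE [in X in _ - X](cdiv_eq N u) uj opprD addrACA subrr add0r.
  have := cmod_grid u N0; move: rN; rewrite !mem_grid => /forallP rN /forallP r'N.
  apply/inboxP => i; move: (rN i) (r'N i); rewrite !mxE.
  by move: (r _ i) (modz _ _) => ? ?; lia.
pose B := undup (map (cdiv N) B0).
have B0B : {subset B0 <= [seq j *+ N + r | j <- B, r <- grid (0 : 'rV[int]_k) N]}.
  move=> b bB; rewrite (cdiv_eq N b); apply: allpairs_f; last exact: cmod_grid.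
  by rewrite mem_undup map_f.
exists B; split; first exact: undup_uniq.
- have szB : (size B0 <= size B * N ^ k)%N.
    by have := uniq_leq_size uB0 B0B; rewrite size_allpairs size_grid.
  rewrite szA -size_filter -/A' in Hs; rewrite size_map in szB.
  have Nk : (0 < N ^ k)%N by rewrite expn_gt0 N0.
  have h1 : (q * size J <= q * size B + k * size J)%N.
    by rewrite -(leq_pmul2r Nk) mulnDl -!mulnA (leq_trans Hs)// leq_add2r leq_mul2l szB orbT.
  have qkE : (q - k = 4 * (k * P1) + 3 * k + 1)%N.
    by rewrite /q -mulnA mulnS mulnDr; clear; lia.
  have kq : q = (q - k + k)%N by rewrite qkE /q -mulnA mulnS mulnDr; clear; lia.
  have h2 : ((q - k) * size J <= q * size B)%N.
    by rewrite mulnBl leq_subLR addnC.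
  have h3 : (P1 * q <= P1.+2 * (q - k))%N.
    rewrite [X in (_ * X <= _)%N]kq !mulSn mulnDr addnA addnC leq_add2r mulnC qkE.
    by clear; lia.
  have h4 : (P1 * size J <= P1.+2 * size B)%N.
    have qk : (0 < q - k)%N by rewrite qkE addn1.
    rewrite -(leq_pmul2l qk) mulnCA (leq_trans (leq_mul (leqnn P1) h2))//.
    by rewrite mulnA (leq_trans (leq_mul h3 (leqnn _)))// -mulnA mulnCA.
  have h5 : (2 * P1 * size J + 2 * P1 * size B <= 4 * P1.+1 * size B)%N.
    by move: (size J) (size B) h4; clear => ? ? ?; lia.
  apply: leq_trans h5 _; by rewrite [(N ^ k * m)%N]mulnC leq_mul2r cnt orbT.
move=> j r; rewrite mem_undup => /mapP[b bB0 ->] rN.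
have near : inbox N (cdiv N b *+ N + r - b).
  rewrite [in X in _ - X](cdiv_eq N b) opprD addrACA subrr add0r.
  have := cmod_grid b N0; move: rN; rewrite !mem_grid => /forallP rN /forallP r'N.
  apply/inboxP => i; move: (rN i) (r'N i); rewrite !mxE.
  by move: (r _ i) (modz _ _) => ? ?; lia.
have b1 : beats (scale q (orbw T aw z)) 1 0 (cdiv N b *+ N + r).
  have := beats_move near (_ : beats _ (N.*2 + 1) 0 b).
  by rewrite addrC subrK; apply; rewrite addn1; exact: deep.
have in1 v : beats (scale q (orbw T aw z)) 1 0 v -> v \in box k L1.
  by move=> h; have := beats_inbox k0 q1 (leqnn _) sw h; rewrite subr0 mem_box.
split=> //; last exact: in1.
rewrite mem_box; apply: cdiv_inbox => //; rewrite -mem_box; apply: in1.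
exact: beatsW (deep _ bB0).
Qed.

Lemma decode_code : exists g : nat -> X -> R,
  [/\ forall i, continuous (g i), forall i x, `|g i x - f i x| <= 2 * eta &
   forall x y, (forall n, a (T n x) = a (T n y)) ->
     (forall n i, (i < m)%N -> g i (T n x) = g i (T n y)) -> d x y < eps].
Proof.
have [cF F0 F1 Fc Fd] := fF.
pose x0 (w : (('rV[int]_k * E) + ('rV[int]_k * E)) * ('rV[int]_k * nat)) : R :=
  if w.1 is inl je then sample T F f je.2 (cmod N w.2.1) w.2.2 else 0.
pose sb := size (box k L1).
(* The hidden part has [sb] terms, each with a factor [alpha] of size at most [sb]. *)
pose eps1 := eta / (sb * sb).+1%:R.
have eps10 : 0 < eps1 by rewrite divr_gt0// ltr0n.
have [xx xx0 xgen] := @generic_tile_code R k N m E (box k L1) (box k L1) (enum E) x0 _ eps10.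
(* The local sum alone approximates [f]. The hidden sum, with coefficients near 0, writes the
   contents of every cube of the cell at every position of the tile. *)
pose Psi i n z := \sum_e F e (T (- cmod N (- n)) z) * xx (inl (cdiv N (- n), e), (- n, i)) +
  \sum_(j <- box k L1) alpha j (T n z) * \sum_e F e (T (n + j *+ N) z) * xx (inr (j, e), (- n, i)).
have cPsi i n : continuous (Psi i n).
  have cFT e u c : continuous (fun z => F e (T u z) * c).
    apply: contM; last exact: cont_cst.
    exact: (cont_precomp (act_cont Ta (n := u)) (cF e)).
  apply: contD; apply: cont_sum => j; first exact: cFT.
  apply: contM; last by apply: cont_sum => e; exact: cFT.
  exact: (cont_precomp (act_cont Ta (n := n)) (cont_alpha (j := j))).
have Psi_close i n z : n \in box k L1 -> `|Psi i n z - f i z| <= 2 * eta.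
  move=> _.
  have h1 := sample_close fF fosc (T (- cmod N (- n)) z) (cmod_grid (- n) N0)
    (fun e => xx0 (inl (cdiv N (- n), e), (- n, i))).
  rewrite (actD Ta) subrr (act0 Ta) in h1.
  have h2 : `|\sum_(j <- box k L1) alpha j (T n z) * \sum_e F e (T (n + j *+ N) z) * xx (inr (j, e), (- n, i))|
      <= sb%:R * (sb%:R * eps1).
    apply: norm_sum_le => j; rewrite normrM ler_pM// ?alpha_le//.
    rewrite (le_trans (ler_norm_sum _ _ _))// -[leRHS]mul1r -(F1 (T (n + j *+ N) z)) mulr_suml.
    apply: ler_sum => e _; rewrite normrM ger0_norm// ler_wpM2l//.
    by have := xx0 (inr (j, e), (- n, i)); rewrite /x0 /= subr0.
  have h3 : eps1 + sb%:R * (sb%:R * eps1) = eta.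
    rewrite mulrA -natrM -[X in X + _]mul1r -mulrDl -[1]/(1%:R) -natrD add1n mulrC.
    by rewrite mulfVK// gt_eqF// ltr0n.
  have -> : 2 * eta = (eta + eps1) + sb%:R * (sb%:R * eps1) by rewrite -addrA h3; ring.
  by rewrite /Psi addrAC (le_trans (ler_normD _ _))// lerD.
have eta20 : 0 <= 2 * eta by rewrite mulr_ge0 ?ler0n ?ltW.
have /choice[g gP] : forall i, exists gi : X -> R,
    [/\ continuous gi, forall z, `|gi z - f i z| <= 2 * eta &
     forall n z, n \in box k L1 -> beats (scale q (orbw T aw z)) 1 n 0 -> gi z = Psi i n z].
  move=> i; apply: (glue_tiles Ta caw q eta20 (cf (i := i))); first exact: cPsi.
  by move=> n z; exact: Psi_close.
exists g; split=> [i|i x|x y axy gxy]; [by have [] := gP i|by have [_ ->] := gP i|].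
have q1 : (1 < q)%N by rewrite /q ltnS !muln_gt0 k0.
(* The site whose unscaled cell contains the origin. The origin may be too close to the boundary to
   be read locally, so its cube is recovered through the hidden coordinates. *)
have [n [n0L wn nmin]] := exists_minimizer k0 q1 (leqnn _) (@orbw_sparse _ _ _ _ Ta a L0 N M x a01 a0 asep) 0.
set x' := T n x; set y' := T n y; pose u0 := - n.
have orbE : orbw T aw x' = orbw T aw y'.
  by apply/funext => v; rewrite /orbw /aw /x' /y' !(actD Ta) axy.
have alE j : alpha j x' = alpha j y' by rewrite /alpha /near_cell orbE.
have u0min v : cost (orbw T aw x') 0 u0 <= cost (orbw T aw x') v u0.
  have := nmin (v + n); rewrite /cost /orbw /x' !(actD Ta) !add0r !subr0 /u0.
  by rewrite opprD (addrC (- v) (- n)).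
have u0L : inbox L1 u0 by rewrite /u0 -[- n]add0r.
have al0 := alpha_exact u0L u0min.
have [B [uB cntB inB]] := deep_cubes x'.
set J := [seq j <- box k L1 | alpha j x' != 0] in cntB.
pose dF j e := F e (T (j *+ N) x') - F e (T (j *+ N) y').
pose supp j := [seq e <- enum E | (F e (T (j *+ N) x') != 0) || (F e (T (j *+ N) y') != 0)].
have us j : uniq (supp j) by rewrite filter_uniq// enum_uniq.
have cF1 z : (count (fun e => F e z != 0%R) (enum E) <= P1)%N.
  rewrite -size_filter (leq_trans _ (Fc z))// cardE uniq_leq_size//.
    by rewrite filter_uniq// enum_uniq.
  by move=> e; rewrite mem_filter !mem_enum !inE => /andP[].
have sP j : (size (supp j) <= 2 * P1)%N.
  rewrite size_filter mul2n -addnn (leq_trans _ (leq_add (cF1 (T (j *+ N) x')) (cF1 (T (j *+ N) y'))))//.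
  rewrite -(count_predUI (fun e => F e (T (j *+ N) x') != 0) (fun e => F e (T (j *+ N) y') != 0)).
  exact: leq_addr.
have dF0 j e : e \notin supp j -> dF j e = 0.
  by rewrite mem_filter mem_enum andbT negb_or !negbK /dF => /andP[/eqP-> /eqP->]; rewrite subrr.
have sum_supp j (h : E -> R) : \sum_(e <- supp j) dF j e * h e = \sum_e dF j e * h e.
  rewrite big_filter big_enum_cond/= [RHS](bigID (fun e => e \in supp j))/= [X in _ = _ + X]big1 ?addr0.
    by apply: eq_bigl => e; rewrite mem_filter mem_enum andbT.
  by move=> e /dF0->; rewrite mul0r.
(* Equal large-scale weights give [x'] and [y'] the same [alpha], so each hidden unknown is [alpha]
   times a difference, and it determines that difference where [alpha] is nonzero. The bound
   [2 * P1] counts the union of two supports. *)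
have key := xgen B J supp (2 * P1)%N (fun je => dF je.1 je.2) (fun je => alpha je.1 x' * dF je.1 je.2)
  uB _ us sP _ _ _ _ cntB _ (cdiv N u0).
have j0J : cdiv N u0 \in J by rewrite mem_filter al0 mem_box cdiv_inbox.
have {}key e : F e (T (cdiv N u0 *+ N) x') = F e (T (cdiv N u0 *+ N) y').
  have [es|es] := boolP (e \in supp (cdiv N u0)); last first.
    by apply/eqP; rewrite -subr_eq0; apply/eqP/dF0.
  apply/eqP; rewrite -subr_eq0; have /eqP := al0; rewrite -[_ - _]/(dF (cdiv N u0) e).
  suff : alpha (cdiv N u0) x' * dF (cdiv N u0) e = 0.
    by move/eqP; rewrite mulf_eq0 => /orP[/eqP|].
  apply: key => // {e es}.
  - by rewrite filter_uniq// grid_uniq.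
  - by move=> j jB; have [] := inB j 0 jB (zero_grid k N0).
  - by move=> j; rewrite mem_filter => /andP[].
  - by move=> j e _; rewrite mem_enum.
  - by move=> j r jB rN; have [] := inB j r jB rN.
  move=> j r i jB rN im /=; have [jL vL bx] := inB j r jB rN.
  set v := j *+ N + r in vL bx *.
  have gv z : orbw T aw z = orbw T aw x' -> g i (T v z) = Psi i (- v) (T v z).
    move=> oz; have [_ _ gE] := gP i; apply: gE; first by rewrite mem_box inboxN -mem_box.
    by rewrite -[- v]add0r; apply: beats_orbw => //; rewrite oz.
  have PsiE z : Psi i (- v) (T v z) = \sum_e F e (T (j *+ N) z) * xx (inl (j, e), (v, i)) +
     \sum_(j' <- box k L1) alpha j' z * \sum_e F e (T (j' *+ N) z) * xx (inr (j', e), (v, i)).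
    have [vj vr] := cdiv_unique j rN; rewrite /Psi opprK /v vj vr -/v !(actD Ta) addNr (act0 Ta).
    congr (_ + _).
      by apply: eq_bigr => e _; rewrite addrCA addNr addr0.
    apply: eq_bigr => j' _; congr (_ * _); apply: eq_bigr => e _.
    by rewrite (actD Ta) addrAC addNr add0r.
  have := gxy (v + n) i im; rewrite -(actD Ta v n x) -(actD Ta v n y) -/x' -/y' !gv// !PsiE => /eqP.
  rewrite -subr_eq0 opprD addrACA => /eqP h; rewrite -[RHS]h; congr (_ + _).
    rewrite sum_supp -sumrB; apply: eq_bigr => e _; by rewrite /dF mulrBl.
  rewrite -sumrB /J big_filter big_mkcond; apply: eq_bigr => j' _; rewrite -alE -mulrBr.
  case: eqP => [->|_] /=; first by rewrite mul0r.
  rewrite -sumrB mulr_sumr.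
  rewrite [LHS](eq_bigr (fun e => dF j' e * (alpha j' x' * xx (inr (j', e), (v, i))))).
    rewrite sum_supp; apply: eq_bigr => e _; by rewrite /dF -mulrBl mulrCA.
  by move=> e _; rewrite mulrCA mulrA.
have [e Fe] : exists e, F e (T (cdiv N u0 *+ N) x') != 0.
  apply/existsP; apply: contraT => /existsPn h.
  have := F1 (T (cdiv N u0 *+ N) x'); rewrite big1 => [/eqP|e0 _]; first by rewrite eq_sym oner_eq0.
  by apply/eqP; rewrite -[_ == _]negbK h.
(* A common nonzero [F e] makes the two cube corners close for [dN]; the position [cmod N u0] of
   that cube is the origin, so the bound covers [d x y]. *)
have close := Fd e _ _ Fe; have := Fe; rewrite key => /close; apply: le_lt_trans.
have back z : T (cmod N u0) (T (cdiv N u0 *+ N) (T n z)) = z.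
  by rewrite !(actD Ta) [cmod N u0 + _]addrC -cdiv_eq addNr (act0 Ta).
have := dN_ge d T (T (cdiv N u0 *+ N) x') (T (cdiv N u0 *+ N) y') (cmod_grid u0 N0).
by rewrite /x' /y' !back.
Qed.

End Decode.

(** * The case k = 0 *)

Section TrivialAction.
Variables (R : realType) (X : topologicalType) (d : X -> X -> R) (k : nat)
  (T : 'rV[int]_k -> X -> X).
Hypotheses (dm : compatible_metric d) (Ta : Zk_action T).
Variables (N m P1 : nat) (eps eta : R) (E : finType) (F : E -> X -> R) (f : nat -> X -> R).
Hypotheses (N0 : (0 < N)%N) (eta0 : 0 < eta) (cf : forall i, continuous (f i))
  (fF : fine_partition (dN T d N) eps P1 F)
  (fosc : forall i x y, d x y < eps -> `|f i x - f i y| <= eta).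

(** The argument of Menger and Nobeling: the vectors of two points differ in at most [2 * P1]
    coordinates, and as many generic linear functions detect any such difference. *)
Lemma trivial_code : (2 * P1 <= m)%N -> exists g : nat -> X -> R,
  [/\ forall i, continuous (g i), forall i x, `|g i x - f i x| <= 2 * eta &
   forall x y, (forall i, (i < m)%N -> g i x = g i y) -> d x y < eps].
Proof.
move=> cnt; have [cF F0 F1 Fc Fd] := fF.
have zN := zero_grid k N0.
have [xx [xx0 _ xinj]] := @generic_shift_code R k 1 m E (enum E)
  (fun w => sample T F f w.1 0 w.2.2) _ eta0.
pose g i z := \sum_e F e z * xx (e, (0, i)).
exists g; split=> [i|i x|x y gxy].
- apply: cont_sum => e; apply: contM; last exact: cont_cst.
  exact: cF.
- have := sample_close fF fosc x zN (fun e => xx0 (e, (0, i))).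
  by rewrite (act0 Ta) mulr2n mulrDl mul1r.
pose supp := [seq e <- enum E | (F e x != 0) || (F e y != 0)].
have cF1 z : (count (fun e => F e z != 0%R) (enum E) <= P1)%N.
  rewrite -size_filter (leq_trans _ (Fc z))// cardE uniq_leq_size//.
    by rewrite filter_uniq// enum_uniq.
  by move=> e; rewrite mem_filter !mem_enum !inE => /andP[].
have dF0 e : e \notin supp -> F e x - F e y = 0.
  by rewrite mem_filter mem_enum andbT negb_or !negbK => /andP[/eqP-> /eqP->]; rewrite subrr.
have key e : F e x = F e y.
  have [es|es] := boolP (e \in supp); last first.
    by apply/eqP; rewrite -subr_eq0; apply/eqP/dF0.
  apply/eqP; rewrite -subr_eq0; apply/eqP.
  apply: (xinj (fun e => F e x - F e y) supp) es => [|e' _||].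
  - by rewrite filter_uniq// enum_uniq.
  - by rewrite mem_enum.
  - rewrite exp1n mul1n (leq_trans _ cnt)// size_filter mul2n -addnn.
    rewrite (leq_trans _ (leq_add (cF1 x) (cF1 y)))//.
    by rewrite -(count_predUI (fun e => F e x != 0) (fun e => F e y != 0)) leq_addr.
  move=> r i r0 im; have -> : r = 0.
    apply/rowP => l; move: r0; rewrite mem_grid => /forallP/(_ l); rewrite !mxE.
    by move: (r _ l) => ?; lia.
  have := gxy i im; rewrite /g => /eqP; rewrite -subr_eq0 -sumrB => /eqP h; rewrite -[RHS]h.
  rewrite big_filter big_enum_cond/= [RHS](bigID (fun e => e \in supp))/= [X in _ = _ + X]big1 ?addr0.
    by apply: eq_big => [e'|e' _]; [rewrite mem_filter mem_enum andbT|rewrite mulrBl].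
  by move=> e' /dF0; rewrite -mulrBl => ->; rewrite mul0r.
have [e Fe] : exists e, F e x != 0.
  apply/existsP; apply: contraT => /existsPn h.
  have := F1 x; rewrite big1 => [/eqP|e0 _]; first by rewrite eq_sym oner_eq0.
  by apply/eqP; rewrite -[_ == _]negbK h.
have close := Fd e _ _ Fe; have := Fe; rewrite key => /close; apply: le_lt_trans.
by have := dN_ge d T x y zN; rewrite !(act0 Ta).
Qed.

End TrivialAction.

(** * Both codes combined into one perturbation *)

Section Density.
Variables (R : realType) (X : topologicalType) (d : X -> X -> R) (k D : nat)
  (T : 'rV[int]_k -> X -> X).
Hypotheses (D0 : (0 < D)%N) (cX : compact [set: X]) (dm : compatible_metric d)
  (Ta : Zk_action T) (mp : marker_property T)
  (md : (mdim T d < (D%:R / 2 ^+ k.+1)%:E)%E).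

Lemma common_modulus (f : nat -> X -> R) (m : nat) (eta : R) :
  (forall i, continuous (f i)) -> 0 < eta ->
  exists2 del : R, 0 < del & forall i x y, (i < m)%N -> d x y < del -> `|f i x - f i y| <= eta.
Proof.
move=> cf e0; elim: m => [|m [del del0 IH]]; first by exists 1.
have [del' del'0 H] := unif_cont cX dm (cf m) e0.
exists (Num.min del del'); first by rewrite lt_min del0.
move=> i x y; rewrite ltnS leq_eqVlt lt_min => /orP[/eqP->|im] /andP[h1 h2]; first exact: H.
exact: IH.
Qed.

(** One partition serves both halves. The marker function [a2] is chosen after [a], because its
    separation must exceed the window [2Q], which depends on the reach of the tiling by [a], as well
    as the separation [M2] required for decoding. *)
Lemma dense_step (f : nat -> X -> R) (eta eps : R) :
  (forall i, continuous (f i)) -> 0 < eta -> 0 < eps ->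
  exists g : nat -> X -> R, [/\ forall i, continuous (g i),
    forall i x, (i < 2 * D)%N -> `|g i x - f i x| <= 2 * eta &
    forall x y, (forall n i, (i < 2 * D)%N -> g i (T n x) = g i (T n y)) -> d x y < eps].
Proof.
move=> cf eta0 eps0.
(* Truncation lets one modulus of continuity hold for all indices, as the coding lemmas require. *)
pose f' i x : R := if (i < 2 * D)%N then f i x else 0.
have cf' i : continuous (f' i).
  by rewrite /f'; case: (i < 2 * D)%N; [exact: cf|exact: cont_cst].
have [del del0 osc] := common_modulus (2 * D) cf eta0.
pose e := Num.min del eps.
have e0 : 0 < e by rewrite lt_min del0.
have osc' i x y : d x y < e -> `|f' i x - f' i y| <= eta.
  rewrite /f' /e lt_min => /andP[xy _]; case: ifP => im; first exact: osc.
  by rewrite subrr normr0 ltW.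
have de x y : d x y < e -> d x y < eps by rewrite /e lt_min => /andP[].
have [k0|k0] := posnP k.
  have [N [p [N0 adm pD]]] := mdim_admissible0 k0 md e0.
  have [E [F fF]] := widim_fine_partition cX (fun x y => @dN_near _ _ _ _ _ dm Ta N e x y e0) adm.
  have [|g [cg gf gP]] := @trivial_code _ _ _ _ _ Ta N (2 * D) _ _ _ _ _ _ N0 eta0 fF osc'.
    by rewrite leq_mul2l.
  exists g; split=> // [i x im|x y gxy].
    by have := gf i x; rewrite /f' im.
  by apply/de/gP => i im; have := gxy 0 i im; rewrite !(act0 Ta).
have [N [p [N0 adm cnt]]] := mdim_admissible k0 md e0.
have [E [F fF]] := widim_fine_partition cX (fun x y => @dN_near _ _ _ _ _ dm Ta N e x y e0) adm.
have [L0 [a [ca a01 a0 asep]]] := marker_function cX dm Ta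
  ((4 * k).+1 * k * (N.*2.+1.*2 + 2))%N mp.
pose Q := (4 * k * (reach k L0).+1.*2 + 1 + (reach k L0).+1 + N)%N.
pose M2 := ((4 * k * p.+2).+1 * k * (N.*2.+1.*2 + 2))%N.
have [L02 [a2 [ca2 a201 a20 a2sep]]] := marker_function cX dm Ta (maxn Q.*2 M2) mp.
have a2sepW M : (M <= maxn Q.*2 M2)%N -> forall x n, n != 0 -> inbox M n -> a2 x < 1 -> a2 (T n x) < 1 -> False.
  move=> ML x n n0 /inboxP nM; apply: a2sep => //; apply/inboxP => i.
  exact: leq_trans (nM i) ML.
have [g1 [cg1 g1f g1P]] := @sync_code _ _ _ _ _ Ta N D p.+1 e eta E F f' N0 eta0 cf' fF osc' k0
  cnt L0 Q a a2 ca a01 a0 asep ca2 a201 (a2sepW _ (leq_maxl _ _)) erefl.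
have cnt4 : (4 * p.+2 <= D * N ^ k)%N.
  apply: leq_trans cnt; rewrite leq_mul2r; apply/orP; right.
  by rewrite (@leq_pexp2l 2 2 k.+1).
have [g2 [cg2 g2f g2P]] := @decode_code _ _ _ _ _ Ta N D p.+1 e eta E F (fun i => f' (i + D)%N) N0 eta0
  (fun i => cf' (i + D)%N) fF (fun i => osc' (i + D)%N) k0
  cnt4 L02 a2 ca2 a201 a20 (a2sepW _ (leq_maxr _ _)).
exists (fun i => if (i < D)%N then g1 i else g2 (i - D)%N); split.
- by move=> i; case: ifP.
- move=> i x im; case: ltnP => iD.
    by have := g1f i x; rewrite /f' im.
  by have := g2f (i - D)%N x; rewrite subnK// /f' im.
- move=> x y gxy; apply/de/g2P => [n|n i iD].
    apply: (g1P x y) => n' i iD; have := gxy n' i; rewrite iD; apply; lia.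
  have := gxy n (i + D)%N; have -> : (i + D < D)%N = false by lia.
  by rewrite addnK; apply; lia.
Qed.

End Density.

(** * The function space *)

Section FunctionSpace.
Variables (R : realType) (X : topologicalType) (m : nat).
Implicit Types f g h : {uniform X -> 'rV[R]_m}.

Lemma nbhs_uniform_ball f (P : set {uniform X -> 'rV[R]_m}) :
  nbhs f P <-> exists2 e : R, 0 < e &
    forall h, (forall x i, `|f x 0 i - h x 0 i| < e) -> P h.
Proof.
rewrite uniform_nbhs; split.
  move=> [E [entE sub]].
  have := entE; rewrite -entourage_ballE => -[e /= e0 eE].
  exists e => // h fh; apply: sub => x _; apply: eE; split=> // i j /=.
  by rewrite ord1; exact: fh.
move=> [e e0 sub]; exists [set uv | ball uv.1 e uv.2]; split.
  by rewrite -entourage_ballE; exists e.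
by move=> h fh; apply: sub => x i; have [_ fhx] := fh x Logic.I; exact: (fhx 0 i).
Qed.

Lemma cont_coord f i : continuous (f : X -> 'rV[R]_m) -> continuous (fun x => f x 0 i).
Proof.
move=> cf x; apply: (@continuous_comp _ _ _ f (fun M : 'rV[R]_m => M 0 i)); first exact: cf.
exact: coord_continuous.
Qed.

Lemma cont_row (g : 'I_m -> X -> R) : (forall i, continuous (g i)) ->
  continuous (fun x => \row_i g i x).
Proof.
move=> cg x A [P nP sPA].
have : \forall y \near x, forall i, P 0 i (g i y).
  apply: filter_forall => i; apply: cg; have := nP 0 i; rewrite mxE; exact.
by apply: filterS => y Py; apply: sPA => i j /=; rewrite mxE ord1.
Qed.

End FunctionSpace.

Section SeparatingFunctions.
Variables (R : realType) (X : topologicalType) (d : X -> X -> R) (k m : nat)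
  (T : 'rV[int]_k -> X -> X).
Hypotheses (cX : compact [set: X]) (dm : compatible_metric d) (Ta : Zk_action T).
Implicit Types f g h : {uniform X -> 'rV[R]_m}.

Definition orbit_close (L : nat) (eta : R) f x y :=
  forall n i, inbox L n -> `|f (T n x) 0 i - f (T n y) 0 i| < eta.

(** A finite window and a positive margin make the condition stable under uniform perturbation;
    compactness recovers it from equality of entire orbits. *)
Definition separating (eps : R) : set {uniform X -> 'rV[R]_m} :=
  [set f | exists L eta, 0 < eta /\ forall x y, orbit_close L eta f x y -> d x y < eps].

Lemma orbit_close_near L eta del f h x y :
  (forall x i, `|f x 0 i - h x 0 i| <= del) ->
  orbit_close L eta h x y -> orbit_close L (eta + 2 * del) f x y.
Proof.
move=> fh hxy n i nL; have := hxy n i nL.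
have := fh (T n x) i; have := fh (T n y) i; rewrite !ler_norml !ltr_norml.
move: (f _ _ _) (f _ _ _) (h _ _ _) (h _ _ _) => a b c e.
by move=> /andP[? ?] /andP[? ?] /andP[? ?]; apply/andP; split; lra.
Qed.

Lemma separating_robust eps f : separating eps f -> exists2 del : R, 0 < del &
  forall h, (forall x i, `|f x 0 i - h x 0 i| <= del) -> separating eps h.
Proof.
move=> [L [eta [eta0 sep]]]; exists (eta / 4) => [|h fh]; first lra.
exists L, (eta / 2); split; first lra.
move=> x y /(orbit_close_near fh) hxy; apply: sep.
by have -> : eta = eta / 2 + 2 * (eta / 4) by field.
Qed.

Lemma open_separating eps : open (separating eps).
Proof.
rewrite openE => f /separating_robust[del del0 rob]; apply/nbhs_uniform_ball.
by exists del => // h fh; apply: rob => x i; exact: ltW.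
Qed.

Lemma separatingP eps f : 0 < eps -> (forall i, continuous (fun x => f x 0 i)) ->
  (forall x y, (forall n i, f (T n x) 0 i = f (T n y) 0 i) -> d x y < eps) ->
  separating eps f.
Proof.
move=> eps0 cf sep.
have [n Hn] : exists n : nat, forall x y, orbit_close n n.+1%:R^-1 f x y -> d x y < eps.
  apply: (@compact_eventually2 _ cX (fun n x y => orbit_close n n.+1%:R^-1 f x y -> d x y < eps)).
    move=> a b x y ab H h; apply: H => n i nL.
    have nb : inbox b n by apply/inboxP => j; move/inboxP: nL => /(_ j); lia.
    exact: lt_le_trans (h n i nb) (invn_le R ab).
  move=> x y; have [xy|xy] := ltP (d x y) eps.
    exists 0%N; have g0 : 0 < eps - d x y by rewrite subr_gt0.
    apply: filterS (d_near2 dm x y g0) => p; rewrite ltr_norml => /andP[_ h] _; lra.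
  have [n [i ne]] : exists n i, f (T n x) 0 i != f (T n y) 0 i.
    apply: contrapT => no; move: xy; rewrite leNgt sep// => n i.
    by apply/eqP; apply: contrapT => /negP h; apply: no; exists n, i.
  pose c := `|f (T n x) 0 i - f (T n y) 0 i|.
  have c0 : 0 < c by rewrite normr_gt0 subr_eq0.
  have c4 : 0 < c / 4 by lra.
  have [j0 Hj0] := invn_lt c4.
  pose b := \max_l absz (n 0%R l).
  exists (maxn j0 b).
  pose fn z := f (T n z) 0 i.
  have cfn : continuous fn by exact: (cont_precomp (act_cont Ta (n := n)) (cf i)).
  exists ([set x' | `|fn x' - fn x| < c / 4], [set y' | `|fn y' - fn y| < c / 4]).
    by split; apply: cont_near.
  move=> [x' y'] /= [h1 h2] /(_ n i) h3; exfalso.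
  have {}h3 : `|fn x' - fn y'| < c / 4.
    apply: (lt_trans _ Hj0); apply: (lt_le_trans (h3 _)); last by rewrite invn_le// leq_maxl.
    apply/inboxP => l; apply: leq_trans (leq_maxr _ _).
    by rewrite /b (bigD1 l)//= leq_maxl.
  have e : fn x - fn y = (fn x' - fn y') - (fn x' - fn x) + (fn y' - fn y) by ring.
  have : c <= `|fn x' - fn y'| + `|fn x' - fn x| + `|fn y' - fn y|.
    rewrite /c -/(fn x) -/(fn y) e (le_trans (ler_normD _ _))// lerD2r ler_normB//.
  clearbody c; lra.
by exists n, n.+1%:R^-1; rewrite invr_gt0 ltr0n.
Qed.

(** The conditions for all [j] give injectivity. A continuous injection of a compact space into a
    Hausdorff space is closed onto its image, which provides the open sets [V]. *)
Lemma separating_embedding f : continuous (f : X -> 'rV[R]_m) ->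
  (forall j : nat, separating j.+1%:R^-1 f) ->
  top_embedding (orbit_map T (f : X -> 'rV[R]_m)).
Proof.
move=> cf sep.
have cI : continuous (orbit_map T (f : X -> 'rV[R]_m)).
  move=> x; apply/cvg_sup => n U [V [[W oW <-] Wx]] WU; apply: (filterS WU).
  have cfn : {for x, continuous (fun z => f (T n z))}.
    apply: (@continuous_comp _ _ _ (T n) f x); first exact: (act_cont Ta).
    exact: cf.
  by apply: cfn; exact: open_nbhs_nbhs.
have inj : injective (orbit_map T (f : X -> 'rV[R]_m)).
  move=> x y xy; apply: (d_eq0 dm); apply/eqP; rewrite eq_le (d_ge0 dm) andbT.
  rewrite leNgt; apply/negP => dxy; have [j jd] := invn_lt dxy.
  have [L [eta [eta0 /(_ x y) H]]] := sep j.
  have hxy : orbit_close L eta f x y.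
    move=> n i _; have -> : f (T n x) = f (T n y) := congr1 (@^~ n) xy.
    by rewrite subrr normr0.
  by have := lt_trans (H hxy) jd; rewrite ltxx.
split=> // U oU.
have cU : compact (~` U).
  apply: (subclosed_compact (B := [set: X])) => //; exact: open_closedC.
have cIU : compact (orbit_map T (f : X -> 'rV[R]_m) @` (~` U)).
  by apply: continuous_compact => //; exact: continuous_subspaceT.
have clIU : closed (orbit_map T (f : X -> 'rV[R]_m) @` (~` U)).
  by apply: compact_closed => //; apply: hausdorff_product => _; exact: norm_hausdorff.
exists (~` (orbit_map T (f : X -> 'rV[R]_m) @` (~` U))); first exact: closed_openC.
apply/seteqP; split=> [_ [x Ux <-]|t [nV [x _ xE]]].
  split; last by exists x.
  by move=> [y Uy yx]; apply: Uy; rewrite (inj _ _ yx).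
by exists x => //; apply: contrapT => Ux; apply: nV; exists x.
Qed.

End SeparatingFunctions.

(** * Baire category inside the unit-valued continuous functions *)

Section Baire.
Variables (R : realType) (X : topologicalType) (m : nat).
Implicit Types f g h : {uniform X -> 'rV[R]_m}.

Lemma Cunit_uniform_limit (u : nat -> {uniform X -> 'rV[R]_m}) f (r : nat -> R) :
  (forall j, @Cunit R X m (u j)) -> (forall e : R, 0 < e -> exists j, r j < e) ->
  (forall j x i, `|f x 0 i - u j x 0 i| <= r j) -> @Cunit R X m f.
Proof.
move=> Cu r0 fu; split.
  have -> : (f : X -> 'rV[R]_m) = (fun x => \row_i f x 0 i).
    by apply/funext => x; apply/rowP => i; rewrite mxE.
  apply: cont_row => i x; apply/cvgrPdist_lt => e e0.
  have e4 : 0 < e / 4 by lra.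
  have [j rj] := r0 _ e4; have cu := cont_coord (i := i) (Cu j).1.
  apply: filterS (cont_near x cu e4) => y.
  have := fu j x i; have := fu j y i; rewrite !ler_norml !ltr_norml.
  move: (f _ _ _) (f _ _ _) (u _ _ _ _) (u _ _ _ _) => a b c b'.
  by move=> /andP[? ?] /andP[? ?] /andP[? ?]; apply/andP; split; lra.
move=> x i; apply/andP; split; rewrite leNgt; apply/negP => h.
  have h' : 0 < - f x 0 i by lra.
  have [j rj] := r0 _ h'.
  have := fu j x i; have /andP[u0 _] := (Cu j).2 x i; rewrite ler_norml => /andP[? ?]; lra.
have h' : 0 < f x 0 i - 1 by lra.
have [j rj] := r0 _ h'.
have := fu j x i; have /andP[_ u1] := (Cu j).2 x i; rewrite ler_norml => /andP[? ?]; lra.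
Qed.

(** The intervals of radius [r j] around [u j] are nested, so the supremum of their lower ends lies
    in all of them. *)
Lemma nested_limit (u r : nat -> R) :
  (forall j, 0 <= r j) -> (forall j, r j.+1 <= r j / 2) ->
  (forall j, `|u j.+1 - u j| <= r j / 2) -> exists l, forall j, `|l - u j| <= r j.
Proof.
move=> r0 rh uh.
(* Halving gives [r j / 2 <= r j - r j.+1], so the bounds telescope. *)
have far j n : `|u (j + n)%N - u j| <= r j - r (j + n)%N.
  elim: n => [|n IH]; first by rewrite addn0 subrr normr0 subrr.
  rewrite addnS; have := uh (j + n)%N; have := rh (j + n)%N.
  have := ler_normD (u (j + n).+1 - u (j + n)%N) (u (j + n)%N - u j).
  by rewrite addrA subrK; move: IH; lra.
have cross j l : u j - r j <= u l + r l.
  have [jl|lj] := leqP j l.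
    have := far j (l - j)%N; rewrite subnKC// ler_norml => /andP[? ?].
    by have := r0 l; lra.
  have := far l (j - l)%N; rewrite subnKC 1?ltnW// ler_norml => /andP[? ?].
  by have := r0 j; lra.
pose A := [set u j - r j | j in [set: nat]].
have hA : has_sup A.
  split; first by exists (u 0%N - r 0%N), 0%N.
  by exists (u 0%N + r 0%N) => _ [j _ <-]; exact: cross.
exists (sup A) => j; rewrite ler_norml; apply/andP; split.
  have : u j - r j <= sup A by apply: ub_le_sup; [exact: hA.2|exists j].
  by lra.
have : sup A <= u j + r j by apply: ge_sup => [|_ [l _ <-]]; [exact: hA.1|exact: cross].
by lra.
Qed.

(** Baire's construction with pairs of a centre and a radius: each closed ball lies in the previous
    one and in the next [O j], and the radii at least halve. The limit is built pointwise and
    inherits continuity and values in the unit interval. *)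
Lemma Cunit_baire (O : nat -> set {uniform X -> 'rV[R]_m}) :
  (forall j f, O j f -> exists2 del : R, 0 < del &
     forall h, (forall x i, `|f x 0 i - h x 0 i| <= del) -> O j h) ->
  (forall j f (r : R), @Cunit R X m f -> 0 < r -> exists g,
     [/\ @Cunit R X m g, O j g & forall x i, `|g x 0 i - f x 0 i| <= r]) ->
  forall f (e : R), @Cunit R X m f -> 0 < e -> exists g,
    [/\ @Cunit R X m g, forall j, O j g & forall x i, `|g x 0 i - f x 0 i| <= e].
Proof.
move=> rob den f0 e Cf0 e0.
pose ok (s : {uniform X -> 'rV[R]_m} * R) := @Cunit R X m s.1 /\ 0 < s.2.
pose next (a : nat * ({uniform X -> 'rV[R]_m} * R)) (s : {uniform X -> 'rV[R]_m} * R) :=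
  ok a.2 -> [/\ ok s, s.2 <= a.2.2 / 2,
    forall x i, `|s.1 x 0 i - a.2.1 x 0 i| <= a.2.2 / 2 &
    forall h, (forall x i, `|s.1 x 0 i - h x 0 i| <= s.2) -> O a.1 h].
have /choice[F FP] : forall a, exists s, next a s.
  move=> [j [f r]]; have [[/= Cf r0]|no] := pselect (ok (f, r)); last by exists (f, r).
  have r2 : 0 < r / 2 by lra.
  have [g [Cg Og gf]] := den j f _ Cf r2; have [del del0 H] := rob _ _ Og.
  exists (g, Num.min del (r / 2)) => _; split=> //=.
  - by split=> //=; rewrite lt_min del0.
  - by rewrite ge_min lexx orbT.
  - move=> h gh; apply: H => x i; apply: le_trans (gh x i) _.
    by rewrite ge_min lexx.
pose s := fix s n := if n is n'.+1 then F (n', s n') else (f0, e).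
have sok n : ok (s n) by elim: n => [//|n IH] /=; have [] := FP (n, s n) IH.
have sP n := FP (n, s n) (sok n).
pose u n := (s n).1; pose r n := (s n).2.
have /choice[g0 g0P] : forall xi : X * 'I_m, exists l, forall j, `|l - u j xi.1 0 xi.2| <= r j.
  move=> [x i]; apply: nested_limit => j; first exact: ltW (sok j).2.
    by have [] := sP j.
  by have [_ _ /(_ x i)] := sP j.
pose g : {uniform X -> 'rV[R]_m} := fun x => \row_i g0 (x, i).
have gu j x i : `|g x 0 i - u j x 0 i| <= r j by rewrite /g mxE; exact: (g0P (x, i) j).
have rsmall n : r n <= e / n.+1%:R.
  elim: n => [|n IH]; first by rewrite divr1.
  have [_ h _ _] := sP n; apply: (le_trans h); rewrite ler_pdivrMr//.
  apply: (le_trans IH); rewrite mulrAC ler_pdivlMr ?ltr0n// mulrAC ler_pdivrMr ?ltr0n//.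
  by rewrite -!mulrA ler_pM2l// -!natrM ler_nat; lia.
exists g; split.
- apply: (@Cunit_uniform_limit u _ r) => // [j|c c0]; first exact: (sok j).1.
  have ce : 0 < c / e by rewrite divr_gt0.
  have [n Hn] := invn_lt ce; exists n; apply: (le_lt_trans (rsmall n)).
  by rewrite mulrC -ltr_pdivlMr.
- move=> j; have [_ _ _] := sP j; apply=> x i; rewrite distrC; exact: gu j.+1 x i.
- by move=> x i; exact: gu 0%N x i.
Qed.

End Baire.

Theorem theorem7p1 (R : realType) (X : topologicalType) (d : X -> X -> R)
    (k D : nat) (T : 'rV[int]_k -> X -> X) :
  (0 < D)%N ->
  compact [set: X] ->
  compatible_metric d ->
  Zk_action T ->
  marker_property T ->
  (mdim T d < (D%:R / 2 ^+ k.+1)%:E)%E ->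
  exists S : set {uniform X -> 'rV[R]_(2 * D)},
    dense_Gdelta_in (@Cunit R X (2 * D)) S /\
    forall f, S f -> top_embedding (orbit_map T (f : X -> 'rV[R]_(2 * D))).
Proof.
move=> D0 cX dm Ta mp md.
pose W (j : nat) : set {uniform X -> 'rV[R]_(2 * D)} := separating d T j.+1%:R^-1.
exists (@Cunit R X (2 * D) `&` \bigcap_(j in [set: nat]) W j); split; last first.
  by move=> f [[cf _] Wf]; apply: (separating_embedding cX dm Ta) => // j; exact: Wf.
split; first by move=> f [].
split; last by exists W; split=> // j; exact: open_separating.
move=> f Cf B /nbhs_uniform_ball[e e0 fB].
have e2 : 0 < e / 2 by lra.
have [|j f1 r Cf1 r0|g [Cg Wg gf]] := @Cunit_baire R X (2 * D) W _ _ f (e / 2) Cf e2.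
- by move=> j h; exact: separating_robust.
- pose eta := Num.min (r / 8) (1 / 8).
  have eta0 : 0 < eta by rewrite lt_min; apply/andP; split; lra.
  have eta8 : eta <= 1 / 8 by rewrite ge_min lexx orbT.
  have etar : eta <= r / 8 by rewrite ge_min lexx.
  (* Values are first squeezed into the interval from [2 * eta] to [1 - 2 * eta], so that an error
     of [2 * eta] cannot leave the unit interval. *)
  pose fi (i : nat) (x : X) : R :=
    if insub i is Some i' then (1 - 4 * eta) * f1 x 0 (i' : 'I_(2 * D)) + 2 * eta else 0.
  have cfi i : continuous (fi i).
    rewrite /fi; case: insubP => [i' _ _|_]; last exact: cont_cst.
    apply: contD; last exact: cont_cst.
    by apply: contM; [exact: cont_cst|exact: cont_coord Cf1.1].
  have j0 : 0 < (j.+1%:R : R)^-1 by rewrite invr_gt0 ltr0n.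
  have [g [cg gfi gP]] := dense_step D0 cX dm Ta mp md cfi eta0 j0.
  have gf1 (i : 'I_(2 * D)) x : `|g i x - ((1 - 4 * eta) * f1 x 0 i + 2 * eta)| <= 2 * eta.
    by have := gfi i x (ltn_ord i); rewrite /fi valK.
  pose g' : {uniform X -> 'rV[R]_(2 * D)} := fun x => \row_i g i x.
  exists g'; split.
  + split; first exact: cont_row.
    move=> x i; rewrite /g' mxE; have := gf1 i x; have /andP[h0 h1] := Cf1.2 x i.
    rewrite ler_norml; move: (f1 x 0 i) h0 h1 (g i x) => t h0 h1 s /andP[? ?].
    by apply/andP; split; nra.
  + apply: separatingP => // [i|x y xy].
      have -> : (fun x => g' x 0 i) = g i by apply/funext => x; rewrite /g' mxE.
      exact: cg.
    apply: gP => n i im; have := xy n (Ordinal im); by rewrite /g' !mxE.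
  + move=> x i; rewrite /g' mxE; have := gf1 i x; have /andP[h0 h1] := Cf1.2 x i.
    rewrite !ler_norml; move: (f1 x 0 i) h0 h1 (g i x) => t h0 h1 s /andP[? ?].
    by apply/andP; split; nra.
exists g; split; first by split=> // j _; exact: Wg.
apply: fB => x i; rewrite distrC (le_lt_trans (gf x i))//; lra.
Qed.
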